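(* Let $\Delta_1\subseteq\Delta_2$ be two triangles that support the same negative curve $C$. If $X_2=\operatorname{Bl}_e X_{\Delta_2}$ is a Mori Dream Space, then so is $X_1=\operatorname{Bl}_e X_{\Delta_1}$.
   Context: We work over an algebraically closed field $k$ of characteristic zero. All triangles are plane triangles with rational edge slopes. For such a triangle $\Delta$, $X_\Delta$ is the projective toric surface defined by the normal fan of $\Delta$, $e=(1,1)$ is the identity of its torus $T$, and $E$ is the exceptional curve of $\operatorname{Bl}_e X_\Delta$. A negative curve in $\operatorname{Bl}_e X_\Delta$ is an irreducible curve $C\neq E$ with $C\cdot C\le 0$. Such a curve is defined by an irreducible Laurent polynomial $\xi(x,y)$, as the strict transform of the closure of the zero locus of $\xi$ in $T$. Two triangles are parallel if they differ by scaling and translation. A triangle $\Delta$ supports a negative curve $C$ (defined by $\xi$) if $\xi$ defines a negative curve in $\operatorname{Bl}_e X_\Delta$, the Newton polygon of $\xi$ lies in $\Delta$, and $\Delta$ is the smallest such triangle parallel to $\Delta$. Two triangles support the same negative curve if they support negative curves defined by the same polynomial $\xi$ (the curves in the two surfaces are both obtained from the same curve in $T$ by closure and strict transform). *)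

(* Defs.v *)
From HB Require Import structures.
From mathcomp Require Import all_boot all_order all_algebra.
From mathcomp Require Import ring lra finmap reals.
From mathcomp.multinomials Require Import monalg.

Set Implicit Arguments.
Unset Strict Implicit.
Unset Printing Implicit Defensive.

Import Order.TTheory GRing.Theory Num.Theory.
Local Open Scope ring_scope.

(** * Group algebras

    [{malg R[G]}] only carries a ring structure when [G] is a monoid without
    nontrivial units, so the convolution product on finitely supported
    functions on an abelian group has to be set up separately. *)

Definition galg (R : comNzRingType) (G : zmodType) : Type := {malg R[G]}.

HB.instance Definition _ (R : comNzRingType) (G : zmodType) :=
  GRing.Zmodule.on (galg R G).

Section GroupAlgebra.
Variables (R : comNzRingType) (G : zmodType).
Implicit Types (f g h : galg R G) (a b : G).

Definition gmono (c : R) a : galg R G := mkmalgU a c.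

Definition gone : galg R G := gmono 1 0.

Definition gmul f g : galg R G :=
  \sum_(a <- msupp f) \sum_(b <- msupp g) gmono (f@_a * g@_b) (a + b).

Lemma gmono0 a : gmono 0 a = 0.
Proof. exact: monalgU0. Qed.

Lemma gmonoD a : {morph gmono^~ a : c d / c + d}.
Proof. by move=> c d; exact: monalgUD. Qed.

Lemma gmulE (d1 d2 : {fset G}) f g :
  (msupp f `<=` d1)%fset -> (msupp g `<=` d2)%fset ->
  gmul f g = \sum_(a <- d1) \sum_(b <- d2) gmono (f@_a * g@_b) (a + b).
Proof.
move=> le1 le2; rewrite /gmul (big_fset_incl _ le1) /=.
  apply: eq_bigr => a _; apply: big_fset_incl => // b _ /mcoeff_outdom ->.
  by rewrite mulr0 gmono0.
move=> a _ /mcoeff_outdom fa.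
by rewrite big1 // => b _; rewrite fa mul0r gmono0.
Qed.

Lemma gmulC : commutative gmul.
Proof.
move=> f g; rewrite /gmul exchange_big /=; apply: eq_bigr => b _.
by apply: eq_bigr => a _; rewrite mulrC addrC.
Qed.

Lemma gmulDl : left_distributive gmul +%R.
Proof.
move=> f g h; have s := fsubset_refl (msupp h).
rewrite (gmulE (msuppD_le f g) s) (gmulE (fsubsetUl _ (msupp g)) s).
rewrite (gmulE (fsubsetUr (msupp f) _) s) -big_split /=.
apply: eq_bigr => a _; rewrite -big_split /=; apply: eq_bigr => b _.
by rewrite mcoeffD mulrDl gmonoD.
Qed.

Lemma gmulDr : right_distributive gmul +%R.
Proof. by move=> f g h; rewrite gmulC gmulDl !(gmulC f). Qed.

Lemma gmul0l : left_zero 0 gmul.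
Proof. by move=> g; rewrite /gmul msupp0 big_seq_fset0. Qed.

Lemma gmul0r : right_zero 0 gmul.
Proof. by move=> g; rewrite gmulC gmul0l. Qed.

Lemma gmonoM c d a b : gmul (gmono c a) (gmono d b) = gmono (c * d) (a + b).
Proof. by rewrite (gmulE msuppU_le msuppU_le) !big_seq_fset1 !mcoeffUU. Qed.

Lemma gmul1l : left_id gone gmul.
Proof.
move=> g; rewrite (gmulE msuppU_le (fsubset_refl _)) big_seq_fset1 [RHS]monalgE.
by apply: eq_bigr => b _; rewrite mcoeffUU mul1r add0r.
Qed.

Lemma gsumE f : f = \sum_(a <- msupp f) gmono (f@_a) a.
Proof. exact: monalgE. Qed.

Lemma gmul_suml I (r : seq I) (F : I -> galg R G) g :
  gmul (\sum_(i <- r) F i) g = \sum_(i <- r) gmul (F i) g.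
Proof.
exact: (big_morph (gmul^~ g) (fun x y => gmulDl x y g) (gmul0l g)).
Qed.

Lemma gmul_sumr I (r : seq I) (F : I -> galg R G) f :
  gmul f (\sum_(i <- r) F i) = \sum_(i <- r) gmul f (F i).
Proof. exact: (big_morph (gmul f) (gmulDr f) (gmul0r f)). Qed.

Lemma gmulA : associative gmul.
Proof.
move=> f g h; rewrite [f]gsumE !gmul_suml; apply: eq_bigr => a _.
rewrite [g]gsumE gmul_suml !gmul_sumr gmul_suml; apply: eq_bigr => b _.
rewrite [h]gsumE !gmul_sumr; apply: eq_bigr => c _.
by rewrite !gmonoM mulrA addrA.
Qed.

Lemma gone_neq0 : gone != 0.
Proof. by rewrite monalgU_eq0 oner_neq0. Qed.

HB.instance Definition _ := GRing.Zmodule_isComNzRing.Build (galg R G)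
  gmulA gmulC gmul1l gmulDl gone_neq0.

End GroupAlgebra.

(** * Laurent polynomials: the coordinate ring [k[M]] of the torus [T] *)

Notation lattice := (int * int)%type.

Notation laurent k := (galg k lattice).

Definition dot (S : zmodType) (p : S * S) (v : lattice) : S :=
  p.1 *~ v.1 + p.2 *~ v.2.

Definition det2 (v w : lattice) : int := v.1 * w.2 - v.2 * w.1.

Section Laurent.
Variable k : closedFieldType.
Implicit Types f g : laurent k.

Definition lX : laurent k := gmono 1 (1, 0).
Definition lY : laurent k := gmono 1 (0, 1).

Definition laurent_unit f := exists g, f * g = 1.

Definition laurent_irreducible f :=
  [/\ f <> 0, ~ laurent_unit f &
      forall g h, f = g * h -> laurent_unit g \/ laurent_unit h].

(** Membership in the [m]-th power of the maximal ideal [(x - 1, y - 1)] of the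
    point [e = (1, 1)]. *)
Definition in_me_pow (m : nat) f :=
  exists g : 'I_m.+1 -> laurent k,
    f = \sum_(i < m.+1) g i * ((lX - 1) ^+ i * (lY - 1) ^+ (m - i)).

(** [mult_at_e f m]: the multiplicity of [f] at [e], that is, the order of
    vanishing of [f] along the exceptional curve [E], is [m]. *)
Definition mult_at_e f (m : nat) := in_me_pow m f /\ ~ in_me_pow m.+1 f.

(** Order of vanishing of [f] along the toric prime divisor whose ray has
    primitive generator [v]. *)
Definition ord_ray_ge (v : lattice) f (c : int) :=
  forall u, u \in msupp f -> c <= dot u v.

Definition ord_ray (v : lattice) f (c : int) :=
  ord_ray_ge v f c /\ exists2 u, u \in msupp f & dot u v = c.

(** Order of vanishing of a Laurent polynomial along [E] is at least [c]. *)
Definition ord_exc_ge f (c : int) :=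
  if c is Posz m then in_me_pow m f else True.

End Laurent.

(** * The surface [Bl_e X]

    [X] is the toric surface of the complete fan with three rays, given by their
    primitive generators.  The boundary divisors [D_0, D_1, D_2] of [X] (not
    meeting [e]) and the exceptional curve [E] generate [Cl (Bl_e X)], because
    their complement [T \ {e}] has trivial class group.  The pair [(a, b)]
    stands for the Weil divisor [\sum_i a_i D_i + b E]. *)

Definition fan3 := 'I_3 -> lattice.

Notation bdiv := ({ffun 'I_3 -> int} * int)%type.

(** The divisor of the character [x^u], which is a unit at [e]. *)
Definition div_char (v : fan3) (u : lattice) : bdiv :=
  ([ffun i => dot u (v i)], 0).

(** Intersection numbers [D_i . D_j] on [X].  Distinct [D_i], [D_j] meet only at
    the fixed point of the cone spanned by [v i] and [v j], with multiplicity the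
    inverse of the index of that cone.  The self-intersections are then forced by
    the triviality of principal divisors, see [toric_int_principal]; indices in
    ['I_3] are added modulo 3. *)
Definition toric_int (v : fan3) (i j : 'I_3) : rat :=
  let d i j : rat := `|det2 (v i) (v j)|%:~R in
  if i != j then (d i j)^-1
  else d (i + 1) (i + 2) / (d i (i + 1) * d i (i + 2)).

(** The intersection form on [Bl_e X], with [E . E = -1] and [D_i . E = 0]. *)
Definition inter (v : fan3) (D D' : bdiv) : rat :=
  \sum_i \sum_j (D.1 i * D'.1 j)%:~R * toric_int v i j - (D.2 * D'.2)%:~R.

Section BlowUp.
Variables (k : closedFieldType) (v : fan3).

(** [D] is the part supported on [D_0, D_1, D_2, E] of the divisor of the
    rational function [xi] on [Bl_e X]. *)
Definition boundary_part (xi : laurent k) (D : bdiv) :=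
  (forall i, ord_ray (v i) xi (D.1 i)) /\
  exists2 m : nat, mult_at_e xi m & D.2 = m%:Z.

(** For irreducible [xi], the divisor of [xi] is [C + D], where [C] is the strict
    transform of the closure of the curve [xi = 0] in [T] and [D] is as above.
    So [C] is linearly equivalent to [- D]. *)
Definition defines_negative_curve (xi : laurent k) :=
  laurent_irreducible xi /\
  exists2 D, boundary_part xi D & inter v (- D) (- D) <= 0.

(** [f] belongs to [H^0(Bl_e X, O(D))], i.e. [div f + D >= 0].  As [D] is
    supported outside [T \ {e}], such rational functions are Laurent
    polynomials. *)
Definition global_section (D : bdiv) (f : laurent k) :=
  (forall i, ord_ray_ge (v i) f (- D.1 i)) /\ ord_exc_ge f (- D.2).

(** The Cox ring [\bigoplus_([D] \in Cl) H^0(O(D))] is the quotient of the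
    divisorial algebra [\bigoplus_D H^0(O(D)) t^D], [D] in the group generated by
    [D_0, D_1, D_2, E], by the ideal generated by the elements
    [1 - x^u t^(- div x^u)], which identify the spaces of sections of linearly
    equivalent divisors (a multiple [b E] is principal only for [b = 0], and a
    divisor of the group is principal iff it is some [div x^u]). *)
Definition div_ring := galg (laurent k) bdiv.

Definition in_divisorial_algebra (F : div_ring) :=
  forall D : bdiv, global_section D (F@_D).

Definition char_elt (u : lattice) : div_ring :=
  gmono (gmono 1 u) (- div_char v u).

Definition in_cox_ideal (F : div_ring) :=
  exists2 s : seq (div_ring * lattice),
    (forall p, p \in s -> in_divisorial_algebra p.1) &
    F = \sum_(p <- s) p.1 * (1 - char_elt p.2).

Inductive subalgebra_generated (G : seq div_ring) : div_ring -> Prop :=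
| SubalgScalar (c : k) : subalgebra_generated G (gmono (gmono c 0) 0)
| SubalgGen F of F \in G : subalgebra_generated G F
| SubalgAdd F F' of subalgebra_generated G F & subalgebra_generated G F' :
    subalgebra_generated G (F + F')
| SubalgMul F F' of subalgebra_generated G F & subalgebra_generated G F' :
    subalgebra_generated G (F * F').

(** [Bl_e X] is a Mori Dream Space: its Cox ring is a finitely generated
    [k]-algebra. *)
Definition mori_dream_space :=
  exists2 G : seq div_ring,
    (forall F, F \in G -> in_divisorial_algebra F) &
    forall F, in_divisorial_algebra F ->
      exists2 F', subalgebra_generated G F' & in_cox_ideal (F - F').

End BlowUp.

(** * Triangles *)

(** A triangle in the plane with rational edge slopes: three vertices, together
    with, for each [i], the primitive inward normal [nrm i] of the edge opposite
    to the vertex [vtx i].  The existence of the (unique) integral normals is the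
    rationality of the slopes, and the strict inequalities make the vertices
    affinely independent.  The [nrm i] generate the rays of the normal fan. *)
Record triangle (R : realType) := Triangle {
  vtx : 'I_3 -> R * R;
  nrm : fan3;
  nrm_primitive : forall i, coprimez (nrm i).1 (nrm i).2;
  nrm_edge : forall i j l, j != i -> l != i ->
    dot (vtx j) (nrm i) = dot (vtx l) (nrm i);
  nrm_inward : forall i j, j != i ->
    dot (vtx j) (nrm i) < dot (vtx i) (nrm i)
}.

Section Triangles.
Variable R : realType.
Implicit Types T : triangle R.

Definition in_triangle T (p : R * R) :=
  exists w : 'I_3 -> R, [/\ forall i, 0 <= w i, \sum_i w i = 1 &
    p = (\sum_i w i * (vtx T i).1, \sum_i w i * (vtx T i).2)].

Definition triangle_sub T T' := forall p, in_triangle T p -> in_triangle T' p.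

(** Scaling is by positive factors: parallel triangles have the same normal
    fan. *)
Definition parallel T T' :=
  exists s : R, exists2 t : R * R, 0 < s &
    forall p, in_triangle T p <->
              in_triangle T' (s * p.1 + t.1, s * p.2 + t.2).

Variable k : closedFieldType.
Implicit Types xi : laurent k.

Definition in_newton_polygon xi (p : R * R) :=
  exists w : lattice -> R, [/\ forall u, 0 <= w u,
    \sum_(u <- msupp xi) w u = 1 &
    p = (\sum_(u <- msupp xi) w u * u.1%:~R,
         \sum_(u <- msupp xi) w u * u.2%:~R)].

Definition contains_newton T xi :=
  forall p, in_newton_polygon xi p -> in_triangle T p.

Definition supports T xi :=
  [/\ defines_negative_curve (nrm T) xi, contains_newton T xi &
      forall T', parallel T T' -> contains_newton T' xi -> triangle_sub T T'].

End Triangles.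

(** * Well-definedness of the intersection numbers *)

Lemma sum_ord3 (V : nmodType) (F : 'I_3 -> V) :
  \sum_i F i = F 0 + F 1 + F 2.
Proof.
rewrite !big_ord_recl big_ord0 addr0 addrA.
by congr (F _ + F _ + F _); apply/val_inj.
Qed.

Lemma opp_sign (F : realFieldType) (b c s t : F) :
  s < 0 -> 0 < t -> b * s + c * t = 0 -> (0 < b) = (0 < c) /\ (b < 0) = (c < 0).
Proof.
move=> s0 t0 e; have t_neq0 := lt0r_neq0 t0.
have -> : c = b * (- s / t).
  by apply: (mulIf t_neq0); rewrite mulrA divfK //; lra.
have r0 : 0 < - s / t by rewrite divr_gt0 ?oppr_gt0.
by rewrite pmulr_lgt0 // pmulr_llt0.
Qed.

Lemma det_sign (F : realFieldType) (x0 y0 x1 y1 x2 y2 a0 b0 a1 b1 a2 b2 : F) :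
  x1 * a0 + y1 * b0 < x0 * a0 + y0 * b0 ->
  x0 * a1 + y0 * b1 < x1 * a1 + y1 * b1 ->
  x0 * a2 + y0 * b2 < x2 * a2 + y2 * b2 ->
  x1 * a0 + y1 * b0 = x2 * a0 + y2 * b0 ->
  x0 * a1 + y0 * b1 = x2 * a1 + y2 * b1 ->
  x0 * a2 + y0 * b2 = x1 * a2 + y1 * b2 ->
  let A := a0 * b1 - b0 * a1 in let B := a1 * b2 - b1 * a2 in
  let C := a2 * b0 - b2 * a0 in
  (0 < A /\ 0 < B /\ 0 < C) \/ (A < 0 /\ B < 0 /\ C < 0).
Proof.
move=> h0 h1 h2 e0 e1 e2 A B C.
have cramer p q : B * (p * a0 + q * b0) + C * (p * a1 + q * b1)
    = - A * (p * a2 + q * b2) by rewrite /A /B /C; ring.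
have E2 : (x1 - x0) * a2 + (y1 - y0) * b2 = 0 by rewrite !mulrBl; lra.
have E0 : (x2 - x1) * a0 + (y2 - y1) * b0 = 0 by rewrite !mulrBl; lra.
have s0 : (x1 - x0) * a0 + (y1 - y0) * b0 < 0 by rewrite !mulrBl; lra.
have t0 : 0 < (x1 - x0) * a1 + (y1 - y0) * b1 by rewrite !mulrBl; lra.
have s'0 : (x2 - x1) * a1 + (y2 - y1) * b1 < 0 by rewrite !mulrBl; lra.
have t'0 : 0 < (x2 - x1) * a2 + (y2 - y1) * b2 by rewrite !mulrBl; lra.
have [|BC BC'] := opp_sign (b := B) (c := C) s0 t0.
  by rewrite cramer E2 mulr0.
have [|CA CA'] := opp_sign (b := C) (c := A) s'0 t'0.
  by have := cramer (x2 - x1) (y2 - y1); rewrite E0 mulr0 add0r => ->;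
     rewrite mulNr addNr.
case: (ltgtP 0 C) => C0.
- by left; rewrite BC -CA.
- by right; rewrite BC' -CA'.
have a20 : a2 = 0.
  apply: (mulIf (ltr0_neq0 s0)); rewrite mul0r.
  transitivity (a0 * ((x1 - x0) * a2 + (y1 - y0) * b2) + (y1 - y0) * C).
    by rewrite /C; ring.
  by rewrite E2 -C0 !mulr0 addr0.
have b20 : b2 = 0.
  apply: (mulIf (ltr0_neq0 s0)); rewrite mul0r.
  transitivity (b0 * ((x1 - x0) * a2 + (y1 - y0) * b2) - (x1 - x0) * C).
    by rewrite /C; ring.
  by rewrite E2 -C0 !mulr0 subr0.
by move: h2; rewrite a20 b20 !mulr0 ltxx.
Qed.

Lemma det2_nrm (R : realType) (T : triangle R) :
  let d i j := det2 (nrm T i) (nrm T j) in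
  (0 < d 0 1 /\ 0 < d 1 2 /\ 0 < d 2 0) \/
  (d 0 1 < 0 /\ d 1 2 < 0 /\ d 2 0 < 0).
Proof.
move=> d; rewrite -!(ltr0z R) -!(ltrz0 R) /d /det2 !intrB !intrM.
by apply: (det_sign (x0 := (vtx T 0).1) (y0 := (vtx T 0).2) (x1 := (vtx T 1).1)
  (y1 := (vtx T 1).2) (x2 := (vtx T 2).1) (y2 := (vtx T 2).2));
  rewrite !mulrzr; first [exact: nrm_inward | exact: nrm_edge].
Qed.

(** Principal divisors have intersection number [0] with every boundary
    divisor, so that [inter] only depends on divisor classes. *)
Lemma toric_int_principal (R : realType) (T : triangle R) (u : lattice)
    (i : 'I_3) :
  \sum_j (dot u (nrm T j))%:~R * toric_int (nrm T) i j = 0.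
Proof.
have n10 : (1 + 1 : 'I_3) = 2 by apply/val_inj.
have n11 : (1 + 2 : 'I_3) = 0 by apply/val_inj.
have n20 : (2 + 1 : 'I_3) = 0 by apply/val_inj.
have n21 : (2 + 2 : 'I_3) = 1 by apply/val_inj.
pose d i j : rat := (det2 (nrm T i) (nrm T j))%:~R.
have dC l j : d l j = - d j l.
  by rewrite /d -mulrNz; congr (_%:~R); rewrite /det2; ring.
have rel : (dot u (nrm T 0))%:~R * d 1 2 + (dot u (nrm T 1))%:~R * d 2 0
    + (dot u (nrm T 2))%:~R * d 0 1 = 0 :> rat.
  rewrite /d -!intrM -!intrD /dot /det2 !mulrzz.
  by apply/eqP; rewrite intr_eq0; apply/eqP; ring.
have sg : exists2 s : rat, s != 0 &
    [/\ `|d 0 1| = s * d 0 1, `|d 1 2| = s * d 1 2, `|d 2 0| = s * d 2 0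
       & [/\ d 0 1 != 0, d 1 2 != 0 & d 2 0 != 0]].
  have [[d0 [d1 d2]]|[d0 [d1 d2]]] := det2_nrm T.
    exists 1; rewrite // !mul1r /d !intr_eq0 !gt_eqF // -!intr_norm.
    by split=> //; rewrite gtr0_norm.
  exists (-1); rewrite // !mulN1r /d !intr_eq0 !lt_eqF // -!intr_norm -!mulrNz.
  by split=> //; rewrite ltr0_norm.
case: sg => s s0 [e01 e12 e20 [d01 d12 d20]].
have f01 : `|d 1 0| = s * d 0 1 by rewrite dC normrN.
have f12 : `|d 2 1| = s * d 1 2 by rewrite dC normrN.
have f20 : `|d 0 2| = s * d 2 0 by rewrite dC normrN.
have nE l j : `|det2 (nrm T l) (nrm T j)|%:~R = `|d l j| by rewrite intr_norm.
have three (P : 'I_3 -> Prop) : P 0 -> P 1 -> P 2 -> forall i, P i.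
  move=> P0 P1 P2 j; have : [|| j == 0, j == 1 | j == 2].
    by case: j => [[|[|[|]]]].
  by case/or3P => /eqP ->.
move: i; apply: three; rewrite !sum_ord3 /toric_int /= ?add0r ?n10 ?n11 ?n20 ?n21 !nE.
all: rewrite ?(e01, e12, e20, f01, f12, f20).
- by rewrite -(mul0r (s * d 0 1 * d 2 0)^-1) -rel; field; rewrite s0 d01 d20.
- by rewrite -(mul0r (s * d 0 1 * d 1 2)^-1) -rel; field; rewrite s0 d01 d12.
- by rewrite -(mul0r (s * d 1 2 * d 2 0)^-1) -rel; field; rewrite s0 d12 d20.
Qed.

(* Main.v *)
(** Let [C] be the curve, and call a divisor [D = \sum_i a_i D_i - t E] with
    [t > 0] a witness if [D.C <= 0] and some section of [D] does not vanish on
    [C].  The surface is a Mori Dream Space iff it has a witness.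

    If [h] is a section of a witness, then [k[T] / (xi, h)] is finite
    dimensional.  Modulo [xi], sections are filtered by the powers of [h], with
    finitely many steps between consecutive powers, and the order of a section
    in this filtration is bounded in terms of its divisor; Dickson's lemma then
    yields finitely many sections from which all others are obtained, by
    induction on the degree, up to multiples of [xi].

    If the Cox ring is finitely generated but has no witness, the generators
    not divisible by [xi] satisfy [D.C >= eps * deg D] uniformly.  Hence a section
    of the image of [J C] on the toric surface with large order at [e] is
    divisible by [xi], so fewer exponents occur as lowest terms of Taylor
    expansions at [e] of these sections than there are lattice points in the
    polygon of that divisor.

    Since the triangles are tight around the Newton polygon of [xi], [D.C <= 0]
    says that [V(P, Delta) <= m t / 2], where [P] is the polygon of
    [\sum_i a_i D_i] and [V] the mixed area.  If [f] is a section of a witness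
    for [Delta_2], let [P_1] be the smallest triangle parallel to [Delta_1]
    containing the Newton polygon of [f].  Then
    [V(P_1, Delta_1) <= V(P, Delta_1) <= V(P, Delta_2)], so [f] also gives a
    witness for [Delta_1]. *)

(* Intersection numbers enter only through lattice counts, which bound the dimension of [k[T] / (xi,
   f)] up to a constant. Applied to [h ^+ (n * N)] with [N] large, the constant disappears: for a
   section [h] of a witness, [k[T] / (xi, h ^+ n)] has dimension at most [n m t]. The local ring at
   [e] alone already contributes [n m t], the product of the orders. So equality holds, and every
   function of order at least [n t + m - 1] at [e] lies in [(xi, h ^+ n)]. This controls the
   coefficient of [E] in the proof of finite generation.

   For the converse, let [S] bound the sizes of the degrees of the generators. The failure of an
   integral inequality then leaves a relative gap of [1 / S], and this gap makes the number of
   lowest exponents of sections of [J C] smaller than the number of lattice points in its quadratic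
   term in [J]. The condition [C.C <= 0] ensures that the order beyond which sections are divisible
   by [xi] grows by at most [m] with each step of [J]. *)
Require Import Defs.
From HB Require Import structures.
From mathcomp Require Import all_boot all_order all_algebra.
From mathcomp Require Import reals.
From mathcomp Require Import ring lra zify finmap boolp.
From mathcomp.multinomials Require Import monalg.

Set Implicit Arguments.
Unset Strict Implicit.
Unset Printing Implicit Defensive.

Import Order.TTheory GRing.Theory Num.Theory.
Local Open Scope ring_scope.

(* Abstract interface of the group algebras: the conversion test practically
   diverges on distinct elements of [galg]. *)
Record gmodel (R : comNzRingType) (G : zmodType) := GModel {
  gm_ring :> comNzRingType;
  gcst : {rmorphism R -> gm_ring};
  gmon : G -> gm_ring;
  cf : gm_ring -> G -> R;
  supp : gm_ring -> {fset G};
  mon0 : gmon 0 = 1;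
  monD : forall u w, gmon (u + w) = gmon u * gmon w;
  cfD : forall f g u, cf (f + g) u = cf f u + cf g u;
  cf_gmono : forall c u w, cf (gcst c * gmon u) w = c *+ (u == w);
  supp_cf : forall f u, (u \in supp f) = (cf f u != 0);
  gmE : forall f, f = \sum_(u <- supp f) gcst (cf f u) * gmon u }.

(** * Group algebras and lowest terms *)

Section Model.
Variables (R : comNzRingType) (G : zmodType) (A : gmodel R G).
Implicit Types (f g h : A) (u w : G).
Local Notation cst := (@gcst R G A).
Local Notation mon := (@gmon R G A).

Lemma cf0 u : cf (0 : A) u = 0.
Proof. by apply: (addrI (cf (0 : A) u)); rewrite -cfD !addr0. Qed.

Lemma cfN f u : cf (- f) u = - cf f u.
Proof. by apply: (addrI (cf f u)); rewrite -cfD !subrr cf0. Qed.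

Lemma cf_sum I (r : seq I) (P : pred I) (F : I -> A) w :
  cf (\sum_(i <- r | P i) F i) w = \sum_(i <- r | P i) cf (F i) w.
Proof.
by apply: (big_morph (fun f => cf f w)) => [f g|]; rewrite ?cfD ?cf0.
Qed.

Lemma cf_mon u w : cf (mon u) w = (u == w)%:R.
Proof. by rewrite -[mon u]mul1r -(rmorph1 cst) cf_gmono. Qed.

Lemma cf_cst c w : cf (cst c) w = c *+ (0 == w).
Proof. by rewrite -[cst c]mulr1 -(mon0 A) cf_gmono. Qed.

Lemma monK u : mon u * mon (- u) = 1.
Proof. by rewrite -monD subrr mon0. Qed.

Lemma monNK u : mon (- u) * mon u = 1.
Proof. by rewrite -monD addNr mon0. Qed.

Lemma gmEw f (d : {fset G}) : (supp f `<=` d)%fset ->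
  f = \sum_(u <- d) cst (cf f u) * mon u.
Proof.
move=> le; rewrite [LHS]gmE; apply: (big_fset_incl _ le) => u _.
by rewrite supp_cf negbK => /eqP ->; rewrite rmorph0 mul0r.
Qed.

Lemma cfM f g w : cf (f * g) w =
  \sum_(a <- supp f) \sum_(b <- supp g) (cf f a * cf g b) *+ (a + b == w).
Proof.
rewrite {1}[f]gmE mulr_suml cf_sum; apply: eq_bigr => a _.
rewrite {1}[g]gmE mulr_sumr cf_sum; apply: eq_bigr => b _.
by rewrite mulrACA -rmorphM -monD cf_gmono.
Qed.

Lemma suppM f g w : w \in supp (f * g) ->
  exists a b, [/\ a \in supp f, b \in supp g & w = a + b].
Proof.
rewrite supp_cf cfM => nz.
apply: contrapT => no; case/negP: nz; apply/eqP.
rewrite big_seq big1 // => a af; rewrite big_seq big1 // => b bg.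
by case: eqP => // E; case: no; exists a, b.
Qed.

Lemma suppD f g w : w \in supp (f + g) -> w \in supp f \/ w \in supp g.
Proof.
rewrite !supp_cf cfD => h; apply/orP; apply: contraR h.
by rewrite negb_or !negbK => /andP[/eqP -> /eqP ->]; rewrite addr0.
Qed.

Lemma suppN f w : (w \in supp (- f)) = (w \in supp f).
Proof. by rewrite !supp_cf cfN oppr_eq0. Qed.

Lemma supp0 w : (w \in supp (0 : A)) = false.
Proof. by rewrite supp_cf cf0 eqxx. Qed.

Lemma supp_mon u w : (w \in supp (mon u)) = (w == u).
Proof. by rewrite supp_cf cf_mon [w == u]eq_sym; case: (u == w); rewrite ?oner_eq0 ?eqxx. Qed.

Lemma supp_cst c w : w \in supp (cst c) -> w = 0.
Proof. by rewrite supp_cf cf_cst; case: (eqVneq 0 w) => [-> //|_]; rewrite mulr0n eqxx. Qed.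

Lemma cf_cstM (c : R) f w : cf (cst c * f) w = c * cf f w.
Proof.
rewrite {1}[f]gmE mulr_sumr cf_sum.
under eq_bigr => u _ do rewrite mulrA -rmorphM cf_gmono -mulrnAr.
rewrite -mulr_sumr; congr (_ * _).
by rewrite [in RHS](gmE f) cf_sum; apply: eq_bigr => u _; rewrite cf_gmono.
Qed.

Lemma supp_cstM (c : R) f w : w \in supp (cst c * f) -> w \in supp f.
Proof.
by rewrite !supp_cf cf_cstM; apply: contra => /eqP ->; rewrite mulr0.
Qed.

Lemma cf_monM u f w : cf (mon u * f) w = cf f (w - u).
Proof.
rewrite {1}[f]gmE mulr_sumr cf_sum [in RHS](gmE f) cf_sum.
apply: eq_bigr => v _; rewrite mulrCA -monD !cf_gmono.
by have -> : (u + v == w) = (v == w - u) by rewrite [RHS]eq_sym subr_eq [RHS]eq_sym addrC.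
Qed.

Lemma supp_monM u f w : (w \in supp (mon u * f)) = (w - u \in supp f).
Proof. by rewrite !supp_cf cf_monM. Qed.

End Model.

Lemma dotE (u v : lattice) : dot u v = u.1 * v.1 + u.2 * v.2.
Proof. by rewrite /dot !mulrzz. Qed.

Lemma dotDl (u u' v : lattice) : dot (u + u') v = dot u v + dot u' v.
Proof. by rewrite !dotE /=; ring. Qed.

Lemma dotNl (u v : lattice) : dot (- u) v = - dot u v.
Proof. by rewrite !dotE /=; ring. Qed.

Lemma dotBl (u u' v : lattice) : dot (u - u') v = dot u v - dot u' v.
Proof. by rewrite dotDl dotNl. Qed.

Lemma dot0l (v : lattice) : dot (0 : lattice) v = 0.
Proof. by rewrite dotE !mul0r. Qed.

Section Lowest.
Variables (k : closedFieldType) (A : gmodel k lattice).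
Implicit Types (f g h : A) (u v w : lattice).
Local Notation cst := (@gcst k _ A).
Local Notation mon := (@gmon k _ A).

(** The order on exponents is lexicographic for [dot _ v], then [dot _ (perp v)]. *)
Definition perp v : lattice := (- v.2, v.1).

Lemma dot_perp_inj v u w : v != 0 ->
  dot u v = dot w v -> dot u (perp v) = dot w (perp v) -> u = w.
Proof.
move=> v0 e1 e2; have d0 : v.1 * v.1 + v.2 * v.2 != 0.
  apply: contra v0 => /eqP d0; have [v1 v2] : v.1 = 0 /\ v.2 = 0 by nia.
  by rewrite [v]surjective_pairing v1 v2.
move: e1 e2; rewrite !dotE /= => e1 e2.
rewrite [u]surjective_pairing [w]surjective_pairing.
have e1' : u.1 = w.1; last have e2' : u.2 = w.2; rewrite ?e1' ?e2' //; apply: (mulfI d0).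
  transitivity (v.1 * (u.1 * v.1 + u.2 * v.2) - v.2 * (u.1 * - v.2 + u.2 * v.1)).
    by ring.
  by rewrite e1 e2; ring.
transitivity (v.2 * (u.1 * v.1 + u.2 * v.2) + v.1 * (u.1 * - v.2 + u.2 * v.1)).
  by ring.
by rewrite e1 e2; ring.
Qed.

Definition lexle v u w := dot u v < dot w v \/
  dot u v = dot w v /\ dot u (perp v) <= dot w (perp v).

Definition lowest v f u :=
  u \in supp f /\ forall w, w \in supp f -> lexle v u w.

Lemma lexle_trans v a b c : lexle v a b -> lexle v b c -> lexle v a c.
Proof. rewrite /lexle; lia. Qed.

Lemma lexle_total v a b : lexle v a b \/ lexle v b a.
Proof. rewrite /lexle; lia. Qed.

Lemma lexle_refl v a : lexle v a a.
Proof. by right. Qed.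

Lemma lexle_anti v a b : v != 0 -> lexle v a b -> lexle v b a -> a = b.
Proof. by move=> v0 ab ba; apply: (dot_perp_inj v0); move: ab ba; rewrite /lexle; lia. Qed.

Lemma seq_lowest v (s : seq lattice) : s <> [::] ->
  exists2 u, u \in s & forall w, w \in s -> lexle v u w.
Proof.
elim: s => [//|a s IH] _; case: (eqVneq s [::]) => [->|/eqP /IH[u us umin]].
  by exists a; rewrite ?inE // => w; rewrite inE => /eqP ->; exact: lexle_refl.
have [au|ua] := lexle_total v a u.
  exists a; rewrite ?inE ?eqxx // => w; rewrite inE => /orP[/eqP->|/umin].
    exact: lexle_refl.
  exact: lexle_trans.
exists u; rewrite ?inE ?us ?orbT // => w; rewrite inE => /orP[/eqP->|/umin] //.
Qed.

Lemma lowest_ex v f : f != 0 -> exists u, lowest v f u.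
Proof.
move=> f0; have : (enum_fset (supp f)) <> [::].
  by move=> E; case/negP: f0; rewrite [f]gmE E big_nil.
by case/(seq_lowest v) => u ?; exists u.
Qed.

Lemma lowest_neq0 v f u : lowest v f u -> f != 0.
Proof. by case=> + _; apply: contraL => /eqP ->; rewrite supp0. Qed.

Lemma lowest_uniq v f u w : v != 0 -> lowest v f u -> lowest v f w -> u = w.
Proof. by move=> v0 [uf um] [wf wm]; apply: (lexle_anti v0); auto. Qed.

(** The order on exponents is total and compatible with addition, so [u + w] arises only from the
    two lowest exponents and its coefficient cannot cancel. *)
Lemma lowestM v f g u w : v != 0 ->
  lowest v f u -> lowest v g w -> lowest v (f * g) (u + w).
Proof.
move=> v0 [uf um] [wg wm]; split; last first.
  move=> _ /suppM[a [b [/um + /wm + ->]]].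
  by rewrite /lexle !dotDl; lia.
rewrite supp_cf cfM (big_fsetD1 u) //= (big_fsetD1 w) //= eqxx mulr1n.
rewrite [X in _ + X + _]big_seq big1 ?addr0 => [|b]; last first.
  rewrite !inE => /andP[bw _]; case: eqP => // /addrI bw'.
  by rewrite bw' eqxx in bw.
rewrite [X in _ + X]big_seq big1 ?addr0 => [|a].
  by rewrite mulf_neq0 // -supp_cf.
rewrite !inE => /andP[au af]; rewrite big_seq big1 // => b bg.
case: eqP => // E; case/negP: au; apply/eqP/(lexle_anti v0); last exact: um.
have : dot (a + b) v = dot (u + w) v by rewrite E.
have : dot (a + b) (perp v) = dot (u + w) (perp v) by rewrite E.
move: (um _ af) (wm _ bg); rewrite /lexle !dotDl; lia.
Qed.

Lemma laurent_mulf_eq0 f g : f * g = 0 -> f = 0 \/ g = 0.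
Proof.
move=> fg; have [->|f0] := eqVneq f 0; first by left.
have [->|g0] := eqVneq g 0; first by right.
have n0 : ((1, 0) : lattice) != 0 by [].
have [u uf] := lowest_ex (1, 0) f0; have [w wg] := lowest_ex (1, 0) g0.
by have := lowest_neq0 (lowestM n0 uf wg); rewrite fg eqxx.
Qed.

Definition ord_ge v f (c : int) := forall u, u \in supp f -> c <= dot u v.

Definition ord_eq v f (c : int) :=
  ord_ge v f c /\ exists2 u, u \in supp f & dot u v = c.

Lemma lowest_ord_eq v f u : lowest v f u -> ord_eq v f (dot u v).
Proof.
case=> uf um; split; last by exists u.
by move=> w /um; rewrite /lexle; lia.
Qed.

Lemma ord_eq_uniq v f c d : ord_eq v f c -> ord_eq v f d -> c = d.
Proof.
move=> [cm [u uf uc]] [dm [w wf wd]].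
by have := cm _ wf; have := dm _ uf; rewrite wd uc; lia.
Qed.

Lemma ord_eqM v f g c d : v != 0 ->
  ord_eq v f c -> ord_eq v g d -> ord_eq v (f * g) (c + d).
Proof.
move=> v0 fc gd.
have nz h e : ord_eq v h e -> h != 0.
  by case=> _ [u + _]; apply: contraL => /eqP ->; rewrite supp0.
have [u uf] := lowest_ex v (nz _ _ fc); have [w wg] := lowest_ex v (nz _ _ gd).
rewrite (ord_eq_uniq fc (lowest_ord_eq uf)) (ord_eq_uniq gd (lowest_ord_eq wg)).
by rewrite -dotDl; apply: lowest_ord_eq; apply: lowestM.
Qed.

Lemma ord_ge_divl v f g c d : v != 0 -> ord_eq v f c ->
  ord_ge v (f * g) (c + d) -> ord_ge v g d.
Proof.
move=> v0 fc fg; have [->|g0] := eqVneq g 0; first by move=> u; rewrite supp0.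
have [w wg] := lowest_ex v g0.
have [_ [u ufg ue]] := ord_eqM v0 fc (lowest_ord_eq wg).
have := fg _ ufg; rewrite ue lerD2l => dw a ag; apply: (le_trans dw).
by case: (lowest_ord_eq wg) => + _; apply.
Qed.

Lemma ord_geM v f g c d : ord_ge v f c -> ord_ge v g d ->
  ord_ge v (f * g) (c + d).
Proof.
by move=> fc gd _ /suppM[a [b [/fc ? /gd ? ->]]]; rewrite dotDl lerD.
Qed.

Lemma ord_geD v f g c : ord_ge v f c -> ord_ge v g c ->
  ord_ge v (f + g) c.
Proof. by move=> fc gd w /suppD[/fc|/gd]. Qed.

Lemma ord_ge_mon v u : ord_ge v (mon u) (dot u v).
Proof. by move=> w; rewrite supp_mon => /eqP ->. Qed.

Lemma ord_ge_cst v (c : k) : ord_ge v (cst c) 0.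
Proof.
move=> w /supp_cst ->.
by rewrite dot0l.
Qed.

End Lowest.

(** * Order at the identity of the torus *)

Section Taylor.
Variables (k : closedFieldType) (A : gmodel k lattice).
Implicit Types (f g h F : A) (u v w : lattice).
Local Notation mon := (@gmon k _ A).
Local Notation cst := (@gcst k _ A).

Definition nonneg f := forall w, w \in supp f -> 0 <= w.1 /\ 0 <= w.2.

(** Evaluation at [(p, q)]. The absolute values make it total; it is multiplicative on polynomials,
    that is, under [nonneg]. *)
Definition subst (p q : A) f : A :=
  \sum_(w <- supp f) cst (cf f w) * (p ^+ `|w.1| * q ^+ `|w.2|).

Lemma substEw p q (d : {fset lattice}) f : (supp f `<=` d)%fset ->
  subst p q f = \sum_(w <- d) cst (cf f w) * (p ^+ `|w.1| * q ^+ `|w.2|).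
Proof.
move=> le; rewrite /subst (big_fset_incl _ le) //= => w _.
by rewrite supp_cf negbK => /eqP ->; rewrite rmorph0 mul0r.
Qed.

Lemma substD p q f g : subst p q (f + g) = subst p q f + subst p q g.
Proof.
have le : (supp (f + g) `<=` supp f `|` supp g)%fset.
  by apply/fsubsetP => w /suppD; rewrite inE => -[->|->]; rewrite ?orbT.
rewrite (substEw p q le) (substEw p q (fsubsetUl (supp f) (supp g))).
rewrite (substEw p q (fsubsetUr (supp f) (supp g))) -big_split /=.
by apply: eq_bigr => w _; rewrite cfD rmorphD mulrDl.
Qed.

Lemma subst0 p q : subst p q 0 = 0.
Proof. by rewrite /subst big_seq big1 // => w; rewrite supp0. Qed.

Lemma subst_sum p q I (r : seq I) (P : pred I) (E : I -> A) :
  subst p q (\sum_(i <- r | P i) E i) = \sum_(i <- r | P i) subst p q (E i).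
Proof. exact: (big_morph (subst p q) (substD p q) (subst0 p q)). Qed.

Lemma supp_gmono c u w : w \in supp (cst c * mon u) -> w = u.
Proof. by move=> /supp_cstM; rewrite supp_mon => /eqP. Qed.

Lemma subst_gmono p q (c : k) u :
  subst p q (cst c * mon u) = cst c * (p ^+ `|u.1| * q ^+ `|u.2|).
Proof.
have le : (supp (cst c * mon u) `<=` [fset u])%fset.
  by apply/fsubsetP => w /supp_gmono ->; rewrite inE.
by rewrite (substEw p q le) big_seq_fset1 cf_gmono eqxx.
Qed.

Lemma subst_mon p q u : subst p q (mon u) = p ^+ `|u.1| * q ^+ `|u.2|.
Proof. by rewrite -[mon u]mul1r -(rmorph1 cst) subst_gmono rmorph1 mul1r. Qed.

Lemma absz_addn (m n : int) : 0 <= m -> 0 <= n ->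
  absz (m + n) = (absz m + absz n)%N.
Proof. lia. Qed.

Lemma substM p q f g : nonneg f -> nonneg g ->
  subst p q (f * g) = subst p q f * subst p q g.
Proof.
move=> f0 g0; rewrite {1}[f]gmE {1}[g]gmE mulr_suml subst_sum mulr_suml.
rewrite big_seq [RHS]big_seq; apply: eq_bigr => a /f0 [a1 a2].
rewrite mulr_sumr subst_sum mulr_sumr.
rewrite big_seq [RHS]big_seq; apply: eq_bigr => b /g0 [b1 b2].
rewrite mulrACA -rmorphM -monD subst_gmono rmorphM /=.
by rewrite (absz_addn a1 b1) (absz_addn a2 b2) !exprD [RHS]mulrACA (mulrACA (p ^+ _)).
Qed.

Lemma nonnegD f g : nonneg f -> nonneg g -> nonneg (f + g).
Proof. by move=> f0 g0 w /suppD[/f0|/g0]. Qed.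

Lemma nonnegM f g : nonneg f -> nonneg g -> nonneg (f * g).
Proof.
move=> f0 g0 _ /suppM[a [b [/f0[a1 a2] /g0[b1 b2] ->]]] /=.
by rewrite !addr_ge0.
Qed.

Lemma nonneg0 : nonneg 0. Proof. by move=> w; rewrite supp0. Qed.

Lemma nonneg_mon u : 0 <= u.1 -> 0 <= u.2 -> nonneg (mon u).
Proof. by move=> u1 u2 w; rewrite supp_mon => /eqP ->. Qed.

Lemma nonneg_cst c : nonneg (cst c).
Proof. by move=> w /supp_cst ->. Qed.

Lemma nonneg1 : nonneg 1.
Proof. by rewrite -(mon0 A); exact: nonneg_mon. Qed.

Lemma nonnegX f n : nonneg f -> nonneg (f ^+ n).
Proof.
move=> f0; elim: n => [|n IH]; first exact: nonneg1.
by rewrite exprS; apply: nonnegM.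
Qed.

Lemma nonneg_sum I (r : seq I) (E : I -> A) :
  (forall i, nonneg (E i)) -> nonneg (\sum_(i <- r) E i).
Proof.
by move=> E0; apply: (big_ind nonneg nonneg0 nonnegD) => i _.
Qed.

Lemma nonneg_subst p q f : nonneg p -> nonneg q -> nonneg (subst p q f).
Proof.
move=> p0 q0; apply: nonneg_sum => w; apply: nonnegM; first exact: nonneg_cst.
by apply: nonnegM; apply: nonnegX.
Qed.

Lemma subst1 p q : subst p q 1 = 1.
Proof. by rewrite -(mon0 A) subst_mon !expr0 mulr1 mon0. Qed.

Lemma subst_cst p q c : subst p q (cst c) = cst c.
Proof. by rewrite -[cst c]mulr1 -(mon0 A) subst_gmono !expr0 mulr1 mon0. Qed.

Lemma substX p q f n : nonneg f -> subst p q (f ^+ n) = subst p q f ^+ n.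
Proof.
move=> f0; elim: n => [|n IH].
  by rewrite !expr0 subst1.
by rewrite !exprS substM ?IH //; apply: nonnegX.
Qed.

Definition gX : A := mon (1, 0).
Definition gY : A := mon (0, 1).
Local Notation X := gX.
Local Notation Y := gY.

Definition in_mp (m : nat) f :=
  exists g : 'I_m.+1 -> A,
    f = \sum_(i < m.+1) g i * ((X - 1) ^+ i * (Y - 1) ^+ (m - i)).

Definition mult_eq f (m : nat) := in_mp m f /\ ~ in_mp m.+1 f.

Lemma nonnegN f : nonneg f -> nonneg (- f).
Proof. by move=> f0 w; rewrite suppN; apply: f0. Qed.

Lemma nonnegX1 : nonneg X. Proof. exact: nonneg_mon. Qed.
Lemma nonnegY1 : nonneg Y. Proof. exact: nonneg_mon. Qed.
Hint Resolve nonnegX1 nonnegY1 nonneg1 : core.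

Lemma substN p q f : subst p q (- f) = - subst p q f.
Proof.
by apply/eqP; rewrite -addr_eq0 -substD addNr subst0.
Qed.
Lemma subst_gX p q : subst p q X = p.
Proof. by rewrite subst_mon expr0 expr1 mulr1. Qed.
Lemma subst_gY p q : subst p q Y = q.
Proof. by rewrite subst_mon expr0 expr1 mul1r. Qed.

Definition taylor f := subst (1 + X) (1 + Y) f.
Definition untaylor f := subst (X - 1) (Y - 1) f.

Lemma nonneg_1X : nonneg (1 + X). Proof. exact: nonnegD. Qed.
Lemma nonneg_1Y : nonneg (1 + Y). Proof. exact: nonnegD. Qed.
Lemma nonneg_X1 : nonneg (X - 1). Proof. by apply: nonnegD => //; apply: nonnegN. Qed.
Lemma nonneg_Y1 : nonneg (Y - 1). Proof. by apply: nonnegD => //; apply: nonnegN. Qed.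
Hint Resolve nonneg_1X nonneg_1Y nonneg_X1 nonneg_Y1 : core.

Lemma mon_nonneg u : 0 <= u.1 -> 0 <= u.2 -> mon u = X ^+ `|u.1| * Y ^+ `|u.2|.
Proof.
move=> u1 u2.
have XE n : X ^+ n = mon (n%:Z, 0).
  elim: n => [|n IH]; first by rewrite expr0 mon0.
  by rewrite exprS IH -monD; congr mon; apply/eqP; rewrite xpair_eqE /= -intS !eqxx.
have YE n : Y ^+ n = mon (0, n%:Z).
  elim: n => [|n IH]; first by rewrite expr0 mon0.
  by rewrite exprS IH -monD; congr mon; apply/eqP; rewrite xpair_eqE /= -intS !eqxx.
rewrite XE YE -monD; congr mon; case: u u1 u2 => a b /= a0 b0.
by apply/eqP; rewrite xpair_eqE /= addr0 add0r !gez0_abs ?eqxx.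
Qed.

Lemma subst_comp p q p' q' f : nonneg p' -> nonneg q' ->
  subst p q p' = X -> subst p q q' = Y -> nonneg f ->
  subst p q (subst p' q' f) = f.
Proof.
move=> p0 q0 pX qY f0; rewrite /subst -/(subst p q _) [RHS]gmE subst_sum.
rewrite big_seq [RHS]big_seq; apply: eq_bigr => w /f0 [w1 w2].
have p1 : nonneg (p' ^+ `|w.1| * q' ^+ `|w.2|) by apply: nonnegM; apply: nonnegX.
rewrite substM //; last exact: nonneg_cst.
rewrite subst_cst.
rewrite substM; try exact: nonnegX.
by rewrite !substX // pX qY mon_nonneg.
Qed.

Lemma taylorK f : nonneg f -> untaylor (taylor f) = f.
Proof.
move=> f0; apply: subst_comp => //; rewrite substD ?subst1 ?subst_gX ?subst_gY.
all: by rewrite addrC subrK.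
Qed.

Lemma nonneg_taylor f : nonneg (taylor f).
Proof. exact: nonneg_subst. Qed.

Lemma taylorM f g : nonneg f -> nonneg g -> taylor (f * g) = taylor f * taylor g.
Proof. exact: substM. Qed.

Lemma taylor_eq0 f : nonneg f -> taylor f = 0 -> f = 0.
Proof. by move=> f0 e; rewrite -(taylorK f0) e /untaylor subst0. Qed.

Definition diag : lattice := (1, 1).

Lemma diag_neq0 : diag != 0. Proof. by []. Qed.

Lemma lowest_1X : lowest diag (1 + X) 0.
Proof.
have E : cf (1 + X) (0 : lattice) = 1.
  by rewrite cfD -(mon0 A) !cf_mon addr0.
split; first by rewrite supp_cf E oner_eq0.
move=> w /suppD; rewrite -(mon0 A) !supp_mon; case=> /eqP ->; rewrite /lexle !dotE /=; lia.
Qed.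

Lemma lowest_1Y : lowest diag (1 + Y) 0.
Proof.
have E : cf (1 + Y) (0 : lattice) = 1.
  by rewrite cfD -(mon0 A) !cf_mon addr0.
split; first by rewrite supp_cf E oner_eq0.
move=> w /suppD; rewrite -(mon0 A) !supp_mon; case=> /eqP ->; rewrite /lexle !dotE /=; lia.
Qed.

Lemma lowestX0 v f n : v != 0 -> lowest v f 0 -> lowest v (f ^+ n) 0.
Proof.
move=> v0 f0; elim: n => [|n IH].
  rewrite expr0 -(mon0 A); split; first by rewrite supp_mon.
  by move=> w; rewrite supp_mon => /eqP ->; exact: lexle_refl.
by rewrite exprS -[0]addr0; apply: lowestM.
Qed.

Lemma lowest_taylor_mon u : lowest diag (taylor (mon u)) 0.
Proof.
rewrite /taylor subst_mon -[0]addr0.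
by apply: (lowestM diag_neq0); apply: (lowestX0 _ diag_neq0);
  [exact: lowest_1X | exact: lowest_1Y].
Qed.

(** All larger shifts work too, so that one monomial can clear the denominators of several Laurent
    polynomials at once. *)
Lemma shift_nonneg_ge f : exists u, [/\ 0 <= u.1, 0 <= u.2 &
  forall u', u.1 <= u'.1 -> u.2 <= u'.2 -> nonneg (mon u' * f)].
Proof.
have [u [u1 u2 ub]] : exists u : lattice, [/\ 0 <= u.1, 0 <= u.2 &
    forall w, w \in enum_fset (supp f) -> - u.1 <= w.1 /\ - u.2 <= w.2].
  elim: (enum_fset _) => [|a s [u [u1 u2 ub]]]; first by exists 0.
  exists (u.1 + `|a.1|%N, u.2 + `|a.2|%N); split=> /= [||w]; try lia.
  rewrite inE => /orP[/eqP ->|/ub [w1 w2]]; lia.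
exists u; split=> // u' h1 h2 w; rewrite supp_monM => /ub[] /=; lia.
Qed.

Lemma in_mp0 f : in_mp 0 f.
Proof. by exists (fun=> f); rewrite big_ord1 !expr0 !mulr1. Qed.

Lemma in_mpD t f g : in_mp t f -> in_mp t g -> in_mp t (f + g).
Proof.
move=> [a ->] [b ->]; exists (fun i => a i + b i).
by rewrite -big_split /=; apply: eq_bigr => i _; rewrite mulrDl.
Qed.

Lemma in_mpMl t f g : in_mp t g -> in_mp t (f * g).
Proof.
move=> [a ->]; exists (fun i => f * a i).
by rewrite mulr_sumr; apply: eq_bigr => i _; rewrite mulrA.
Qed.

Lemma in_mp_zero t : in_mp t (0 : A).
Proof. by exists (fun=> 0); rewrite big1 // => i _; rewrite mul0r. Qed.

Lemma in_mp_sum t I (r : seq I) (P : pred I) (E : I -> A) :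
  (forall i, P i -> in_mp t (E i)) -> in_mp t (\sum_(i <- r | P i) E i).
Proof.
by move=> E0; apply: (big_ind (in_mp t)) => //; [exact: in_mp_zero|exact: in_mpD].
Qed.

Lemma in_mp_XY t i j : (t <= i + j)%N ->
  in_mp t ((X - 1) ^+ i * (Y - 1) ^+ j).
Proof.
move=> tij; set a := minn i t.
have at' : (a < t.+1)%N by rewrite ltnS geq_minr.
exists (fun l : 'I_t.+1 => if l == Ordinal at' then (X - 1) ^+ (i - a) * (Y - 1) ^+ (j - (t - a)) else 0).
rewrite (bigD1 (Ordinal at')) //= eqxx big1 => [|l /negbTE ->]; last by rewrite mul0r.
rewrite addr0 mulrACA -!exprD subnK ?geq_minl // subnK //.
by rewrite /a; lia.
Qed.

Lemma ord_ge_sum v I (r : seq I) (P : pred I) (E : I -> A) c :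
  (forall i, P i -> ord_ge v (E i) c) ->
  ord_ge v (\sum_(i <- r | P i) E i) c.
Proof.
move=> E0; apply: (big_ind (fun f => ord_ge v f c)) => // [w|f g].
  by rewrite supp0.
exact: ord_geD.
Qed.

(** The substitution moves [e] to the origin, where powers of the maximal ideal are conditions on
    the total degree. The coefficients of a membership may be Laurent polynomials, so a common
    monomial is cleared first; its Taylor expansion has lowest exponent [0] and does not change
    orders. *)
Lemma me_taylor t f : nonneg f ->
  in_mp t f <-> ord_ge diag (taylor f) t%:Z.
Proof.
move=> f0; split=> [[a fE]|tf]; last first.
  rewrite -(taylorK f0) /untaylor /subst big_seq.
  apply: in_mp_sum => w wF; apply: in_mpMl; apply: in_mp_XY.
  have [w1 w2] := nonneg_taylor wF; move: (tf _ wF); rewrite dotE /=; lia.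
have [u [u1 u2 au]] : exists u, [/\ 0 <= u.1, 0 <= u.2 &
    forall i, nonneg (mon u * a i)].
  have : forall i, exists u, [/\ 0 <= u.1, 0 <= u.2 &
    forall u', u.1 <= u'.1 -> u.2 <= u'.2 -> nonneg (mon u' * a i)].
    by move=> i; apply: shift_nonneg_ge.
  case/choice => s sP.
  exists (\sum_i (s i).1, \sum_i (s i).2); split=> /=.
  - by apply: sumr_ge0 => i _; case: (sP i).
  - by apply: sumr_ge0 => i _; case: (sP i).
  move=> i; case: (sP i) => _ _; apply=> /=; rewrite (bigD1 i) //= lerDl.
    by apply: sumr_ge0 => j _; case: (sP j).
  by apply: sumr_ge0 => j _; case: (sP j).
apply: (@ord_ge_divl _ _ _ (taylor (mon u)) _ 0) => //.
  by have := lowest_ord_eq (lowest_taylor_mon u); rewrite dotE.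
have u0 : nonneg (mon u) by apply: nonneg_mon.
rewrite -taylorM // fE mulr_sumr /taylor subst_sum add0r; apply: ord_ge_sum => i _.
rewrite mulrA substM //; last by apply: nonnegM; apply: nonnegX.
rewrite (@substM _ _ ((X - 1) ^+ i)); try exact: nonnegX.
rewrite !substX // !substD !substN !subst1 subst_gX subst_gY.
have e1 : 1 + X - 1 = X by rewrite addrC addKr.
have e2 : 1 + Y - 1 = Y by rewrite addrC addKr.
rewrite e1 e2 -[t%:Z]add0r; apply: ord_geM.
  move=> w wf; have [] := @nonneg_subst (1 + X) (1 + Y) (mon u * a i) _ _ w wf => //.
  by rewrite dotE /=; lia.
have -> : X ^+ i * Y ^+ (t - i) = mon (i%:Z, (t - i)%N%:Z) by rewrite mon_nonneg.
have := @ord_ge_mon k A diag (i%:Z, (t - i)%N%:Z); congr (ord_ge _ _ _).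
by rewrite dotE /=; have := ltn_ord i; lia.
Qed.

(** The lowest exponent of the expansion at [e], by total degree first. It is independent of the
    monomial clearing the denominators, see [taylor_lowest_shift]. *)
Definition taylor_lowest f w := exists2 u, nonneg (mon u * f) &
  lowest diag (taylor (mon u * f)) w.

Lemma taylor_lowest_ex f : f <> 0 -> exists w, taylor_lowest f w.
Proof.
move=> f0; have [u [u1 u2 uf]] := shift_nonneg_ge f.
have nn := uf u (lexx _) (lexx _).
have : taylor (mon u * f) != 0.
  apply/eqP => /(taylor_eq0 nn) e; apply: f0.
  by rewrite -[f]mul1r -(monNK A u) -mulrA e mulr0.
by case/(lowest_ex diag) => w wl; exists w, u.
Qed.

(** Both shifts are completed to the common shift [a] by monomials, whose Taylor expansions have
    lowest exponent [0]. *)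
Lemma taylor_lowest_shift f u w : nonneg (mon u * f) -> taylor_lowest f w ->
  lowest diag (taylor (mon u * f)) w.
Proof.
move=> uf [u' u'f wl].
have f0 : f <> 0.
  move=> e; have := lowest_neq0 wl.
  by rewrite e mulr0 /taylor subst0 eqxx.
have tf : taylor (mon u * f) != 0.
  apply/eqP => /(taylor_eq0 uf) e; apply: f0.
  by rewrite -[f]mul1r -(monNK A u) -mulrA e mulr0.
have [w' wl'] := lowest_ex diag tf.
pose a : lattice := (`|u'.1|%N%:Z + `|u.1|%N%:Z, `|u'.2|%N%:Z + `|u.2|%N%:Z).
pose s u : lattice := a - u.
have sn u0 : (u0 = u) \/ (u0 = u') -> nonneg (mon (s u0)).
  by case=> ->; apply: nonneg_mon; rewrite /s /a /=; lia.
have h u0 : (u0 = u) \/ (u0 = u') -> nonneg (mon u0 * f) ->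
    taylor (mon (s u0)) * taylor (mon u0 * f) = taylor (mon a * f).
  by move=> e u0f; rewrite -taylorM ?mulrA -?monD ?subrK //; apply: sn.
have := lowestM diag_neq0 (lowest_taylor_mon (s u)) wl'.
rewrite h; [|by left|by []]; rewrite add0r => l1.
have := lowestM diag_neq0 (lowest_taylor_mon (s u')) wl.
rewrite h; [|by right|by []]; rewrite add0r => l2.
by rewrite (lowest_uniq diag_neq0 l2 l1).
Qed.

Lemma taylor_lowestM f g w w' : taylor_lowest f w -> taylor_lowest g w' ->
  taylor_lowest (f * g) (w + w').
Proof.
move=> [u uf fw] [u' ug gw].
have E : mon (u + u') * (f * g) = (mon u * f) * (mon u' * g).
  by rewrite monD mulrACA.
exists (u + u'); rewrite E; first exact: nonnegM.
by rewrite taylorM //; apply: lowestM.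
Qed.

Lemma taylor_lowest_nonneg f w : taylor_lowest f w -> 0 <= w.1 /\ 0 <= w.2.
Proof. by case=> u _ [/nonneg_taylor]. Qed.

Lemma me_mon t u f : in_mp t (mon u * f) <-> in_mp t f.
Proof.
split=> h; last exact: in_mpMl.
by rewrite -[f]mul1r -(monNK A u) -mulrA; apply: in_mpMl.
Qed.

Lemma me_lowest t f w : taylor_lowest f w ->
  in_mp t f <-> t%:Z <= dot w diag.
Proof.
case=> u uf wl; split=> [/(me_mon t u f)/(me_taylor t uf) h|h].
  by apply: h; case: wl.
apply/(me_mon t u)/(me_taylor t uf) => a /(proj2 wl); rewrite /lexle; lia.
Qed.

Lemma mult_lowest f m w : taylor_lowest f w -> mult_eq f m ->
  dot w diag = m%:Z.
Proof.
move=> fw [/(me_lowest _ fw) h1 h2].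
have := contra_not (proj2 (me_lowest m.+1 fw)) h2; lia.
Qed.

Lemma in_mpM s t f g : in_mp s f -> in_mp t g ->
  in_mp (s + t) (f * g).
Proof.
have [-> |/eqP f0] := eqVneq f 0; first by rewrite mul0r => *; apply: in_mp_zero.
have [-> |/eqP g0] := eqVneq g 0; first by rewrite mulr0 => *; apply: in_mp_zero.
have [w fw] := taylor_lowest_ex f0; have [w' gw] := taylor_lowest_ex g0.
move=> /(me_lowest s fw) h /(me_lowest t gw) h'.
by apply/(me_lowest _ (taylor_lowestM fw gw)); rewrite dotDl; lia.
Qed.

Lemma in_mpX s n f : in_mp s f -> in_mp (n * s) (f ^+ n).
Proof.
move=> fs; elim: n => [|n IH]; first exact: in_mp0.
by rewrite exprS mulSn; apply: in_mpM.
Qed.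

Lemma in_mp_le s t f : (s <= t)%N -> in_mp t f -> in_mp s f.
Proof.
move=> st; have [-> |/eqP f0] := eqVneq f 0; first by move=> *; apply: in_mp_zero.
have [w fw] := taylor_lowest_ex f0.
by move=> /(me_lowest t fw) h; apply/(me_lowest s fw); lia.
Qed.

Lemma in_mp_div f m t g : mult_eq f m ->
  in_mp t (f * g) -> in_mp (t - m) g.
Proof.
move=> fm; have [-> _|/eqP g0] := eqVneq g 0; first exact: in_mp_zero.
have f0 : f <> 0 by move=> e; case: fm => _; rewrite e; case; exact: in_mp_zero.
have [w fw] := taylor_lowest_ex f0; have [w' gw] := taylor_lowest_ex g0.
move=> /(me_lowest t (taylor_lowestM fw gw)); rewrite dotDl (mult_lowest fw fm) => h.
have [w1 w2] := taylor_lowest_nonneg gw.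
by apply/(me_lowest _ gw); move: h; rewrite dotE /=; lia.
Qed.

End Taylor.

(** * Irreducible Laurent polynomials are prime *)

Section Bivariate.
Variable k : closedFieldType.
Implicit Types (c : {poly k}) (P Q F W H : {poly {poly k}}) (a : k).

Definition lin a : {poly {poly k}} := ('X - a%:P)%:P.

Definition evl a P : {poly k} := map_poly (horner_eval a) P.

Lemma evl_lin a P : evl a P = 0 -> exists Q, P = lin a * Q.
Proof.
move=> P0; exists (map_poly (fun c => c %/ ('X - a%:P)) P); apply/polyP => i.
rewrite coefCM coef_map_id0 ?div0p //.
have : (evl a P)`_i = 0 by rewrite P0 coef0.
rewrite coef_map /= /horner_eval => /eqP; rewrite -/(root _ _) root_factor_theorem.
by move=> /divpK; rewrite mulrC.
Qed.

Lemma evlM a P Q : evl a (P * Q) = evl a P * evl a Q.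
Proof. exact: rmorphM. Qed.

Lemma evl_linl a Q : evl a (lin a * Q) = 0.
Proof.
rewrite evlM /evl map_polyC /= /horner_eval hornerD hornerX hornerN hornerC subrr.
by rewrite polyC0 mul0r.
Qed.

Lemma lin_neq0 a : lin a != 0.
Proof. by rewrite polyC_eq0 polyXsubC_eq0. Qed.

Lemma lin_prime a P Q W : P * Q = lin a * W ->
  (exists H, P = lin a * H) \/ (exists H, Q = lin a * H).
Proof.
move=> /(congr1 (evl a)); rewrite evlM evl_linl => /eqP.
by rewrite mulf_eq0 => /orP[] /eqP /evl_lin; [left|right].
Qed.

(* Gauss's lemma only needs linear factors, the field being algebraically closed. *)
Definition xprimitive P := forall a Q, P <> lin a * Q.

Lemma polyC_ind_root (S : {poly k} -> Prop) :
  (forall c, c != 0 -> size c = 1 -> S c) ->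
  (forall a c, c != 0 -> S c -> S (('X - a%:P) * c)) ->
  forall c, c != 0 -> S c.
Proof.
move=> S1 Sl c; have [n] := ubnP (size c); elim: n c => // n IH c cn c0.
have [sc|sc] := eqVneq (size c) 1; first exact: S1.
have [a] := closed_rootP c sc; rewrite root_factor_theorem => /dvdpP[d dE].
have d0 : d != 0 by apply: contraNneq c0 => d0; rewrite dE d0 mul0r.
rewrite dE mulrC; apply: Sl => //; apply: IH => //.
by move: cn; rewrite dE size_mul ?polyXsubC_eq0 // size_XsubC addn2 /= ltnS.
Qed.

(** The linear factors of [c] are prime and do not divide [P], so they can be removed from [W] one
    at a time. *)
Lemma xprimitive_cancel P c : c != 0 -> xprimitive P ->
  forall W H, P * W = c%:P * H -> exists W', H = P * W'.
Proof.
move=> c0 Px; move: c c0; apply: polyC_ind_root => [c c0 /eqP/size_poly1P[e e0 cE]|a c c0 IH] W H E.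
  exists ((e^-1)%:P%:P * W); rewrite mulrCA E mulrA -!polyCM cE -polyCM.
  by rewrite mulVf // polyC1 mul1r.
have E' : P * W = lin a * (c%:P * H) by rewrite E polyCM mulrA.
have [[Q /Px //]|[Q QE]] := lin_prime E'.
apply: (IH Q); apply: (mulfI (lin_neq0 a)).
by rewrite -E' QE mulrCA.
Qed.

(** Turns a factorization over [k(x)] into one over [k[x]]: each linear factor of [c] divides [D] or
    [H] and is removed from it. *)
Lemma split_factor P c : c != 0 -> forall D H, c%:P * P = D * H ->
  exists D' H' d1 d2, [/\ P = D' * H', D = d1%:P * D', H = d2%:P * H' & d1 != 0].
Proof.
move: c; apply: polyC_ind_root => [c c0 /eqP/size_poly1P[e e0 cE]|a c c0 IH] D H E.
  exists D, ((e^-1)%:P%:P * H), 1, e%:P; split; rewrite ?oner_eq0 ?polyC1 ?mul1r //.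
    rewrite mulrCA -E mulrA cE -!polyCM mulVf // !polyC1 mul1r //.
  by rewrite mulrA -!polyCM mulfV // !polyC1 mul1r.
have E' : D * H = lin a * (c%:P * P) by rewrite -E polyCM mulrA.
have [[Q QE]|[Q QE]] := lin_prime E'.
  have [|D' [H' [d1 [d2 [h1 h2 h3 h4]]]]] := IH Q H.
    by apply: (mulfI (lin_neq0 a)); rewrite -E' QE mulrA.
  exists D', H', (('X - a%:P) * d1), d2; split => //.
    by rewrite QE h2 polyCM mulrA.
  by rewrite mulf_neq0 ?polyXsubC_eq0.
have [|D' [H' [d1 [d2 [h1 h2 h3 h4]]]]] := IH D Q.
  by apply: (mulfI (lin_neq0 a)); rewrite -E' QE mulrCA.
exists D', H', d1, (('X - a%:P) * d2); split => //.
by rewrite QE h3 polyCM mulrA.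
Qed.

(** The gcd is taken by pseudo-division, so it is a gcd over [k(x)]; [c] and [d] are the
    denominators. *)
Lemma coprime_or_common P F : 
  (exists U V c, c != 0 /\ U * P + V * F = c%:P) \/
  (exists D H E : {poly {poly k}}, exists c d : {poly k},
    [/\ (1 < size D)%N, c != 0, d != 0, c%:P * P = D * H &
     d%:P * F = D * E]) \/ P = 0 /\ F = 0.
Proof.
have [g0|g0] := eqVneq (gcdp P F) 0.
  by move/eqP: g0; rewrite gcdp_eq0 => /andP[/eqP -> /eqP ->]; right; right.
have [s1|s1] := leqP (size (gcdp P F)) 1.
  have /Bezout_coprimepP[[U V] /= UV] : coprimep P F.
    by rewrite coprimep_def eqn_leq s1 lt0n size_poly_eq0.
  move/eqpP: UV => [[c1 c2] /= /andP[c10 c20]]; rewrite alg_polyC => E.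
  by left; exists (c1 *: U), (c1 *: V), c2; rewrite -!scalerAl -scalerDr.
right; left; have /Pdiv.Idomain.dvdpP[[c H] /= c0 cE] := dvdp_gcdl P F.
have /Pdiv.Idomain.dvdpP[[d E] /= d0 dE] := dvdp_gcdr P F.
exists (gcdp P F), H, E, c, d; split; rewrite // mul_polyC 1?mulrC //.
Qed.

End Bivariate.

Section Prime.
Variables (k : closedFieldType) (A : gmodel k lattice).
Implicit Types (f g h : A) (u v w : lattice) (P Q F W H : {poly {poly k}}).
Local Notation mon := (@gmon k _ A).
Local Notation cst := (@gcst k _ A).
Local Notation X := (gX A).
Local Notation Y := (gY A).

Definition gunit f := exists g, f * g = 1.

Definition girreducible f :=
  [/\ f <> 0, ~ gunit f & forall g h, f = g * h -> gunit g \/ gunit h].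

Definition gdvd f g := exists h, g = f * h.

Let evx_comm : commr_rmorph cst X := fun a => mulrC _ _.
Definition evx : {rmorphism {poly k} -> A} := horner_morph evx_comm.
Let ev_comm : commr_rmorph evx Y := fun a => mulrC _ _.
Definition ev : {rmorphism {poly {poly k}} -> A} := horner_morph ev_comm.

Lemma monXY i j : mon (i%:Z, j%:Z) = X ^+ i * Y ^+ j.
Proof. by rewrite mon_nonneg. Qed.

Lemma evE P : ev P = \sum_(j < size P) \sum_(i < size P`_j)
  cst P`_j`_i * mon (i%:Z, j%:Z).
Proof.
rewrite /ev /= /horner_morph horner_coef.
have szm (R S : nzRingType) (m : R -> S) (p : {poly R}) (y : S) : m 0 = 0 ->
  \sum_(i < size (map_poly m p)) (map_poly m p)`_i * y ^+ i =
  \sum_(i < size p) m p`_i * y ^+ i.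
  move=> m0; rewrite (big_ord_widen _ (fun i => (map_poly m p)`_i * y ^+ i) (size_poly _ _)).
  rewrite big_mkcond /=; apply: eq_bigr => i _; rewrite coef_map_id0 //.
  case: ifPn => //; rewrite -leqNgt => /(nth_default 0).
  by rewrite coef_map_id0 // => ->; rewrite mul0r.
rewrite szm; last by rewrite map_poly0 horner0.
apply: eq_bigr => j _.
rewrite horner_coef szm ?rmorph0 //.
by rewrite mulr_suml; apply: eq_bigr => i _; rewrite monXY mulrA.
Qed.

Lemma cf_ev P i j : cf (ev P) (i%:Z, j%:Z) = P`_j`_i.
Proof.
rewrite evE cf_sum.
under eq_bigr => j' _.
  rewrite cf_sum; under eq_bigr => i' _ do rewrite cf_gmono.
  over.
have [jP|jP] := ltnP j (size P); last first.
  have -> : P`_j = 0 by rewrite nth_default.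
  rewrite coef0 big1 // => j' _; rewrite big1 // => i' _.
  case: eqP => // -[_ E]; by exfalso; move: (leq_trans (ltn_ord j') jP); rewrite E ltnn.
rewrite (bigD1 (Ordinal jP)) //= [X in _ + X]big1 ?addr0 => [|j' jj']; last first.
  rewrite big1 // => i' _; case: eqP => // -[_ E]; case/negP: jj'.
  by apply/eqP/val_inj.
have [iP|iP] := ltnP i (size P`_j); last first.
  rewrite [in RHS]nth_default // big1 // => i' _.
  case: eqP => // -[E]; by exfalso; move: (leq_trans (ltn_ord i') iP); rewrite E ltnn.
rewrite (bigD1 (Ordinal iP)) //= eqxx mulr1n big1 ?addr0 // => i' ii'.
case: eqP => // -[E]; case/negP: ii'; by apply/eqP/val_inj.
Qed.

Lemma nonneg_ev P : nonneg (ev P).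
Proof.
rewrite evE; apply: nonneg_sum => j; apply: nonneg_sum => i; apply: nonnegM.
  exact: nonneg_cst.
exact: nonneg_mon.
Qed.

Lemma ev_inj P : ev P = 0 -> P = 0.
Proof.
by move=> E; apply/polyP => j; apply/polyP => i; rewrite -cf_ev E cf0 !coef0.
Qed.

Lemma ev_injective P Q : ev P = ev Q -> P = Q.
Proof.
by move=> E; apply/eqP; rewrite -subr_eq0; apply/eqP/ev_inj; rewrite rmorphB E subrr.
Qed.

Lemma ev_surj f : nonneg f -> exists P, ev P = f.
Proof.
move=> f0; exists (\sum_(w <- supp f) (cf f w)%:P%:P * 'X%:P ^+ `|w.1| * 'X ^+ `|w.2|).
rewrite [RHS]gmE rmorph_sum big_seq [RHS]big_seq; apply: eq_bigr => w /f0[w1 w2].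
rewrite !rmorphM !rmorphXn /= !horner_morphC !horner_morphX /=.
rewrite horner_morphC horner_morphX.
by rewrite mon_nonneg // mulrA.
Qed.

Lemma ev_lin a : ev (lin a) = X - cst a.
Proof. by rewrite /= horner_morphC rmorphB /= horner_morphX horner_morphC. Qed.

Lemma gdvdMl f g h : gdvd f g -> gdvd f (h * g).
Proof. by case=> q ->; exists (h * q); rewrite mulrCA. Qed.

Lemma gdvdMr f g h : gdvd f g -> gdvd f (g * h).
Proof. by rewrite mulrC; apply: gdvdMl. Qed.

Lemma gdvdD f g h : gdvd f g -> gdvd f h -> gdvd f (g + h).
Proof. by move=> [a ->] [b ->]; exists (a + b); rewrite mulrDr. Qed.

Lemma gdvd0 f : gdvd f 0. Proof. by exists 0; rewrite mulr0. Qed.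

Lemma gdvd_mon f u g : gdvd f (mon u * g) -> gdvd f g.
Proof.
by move=> /(gdvdMl (mon (- u))); rewrite mulrA monNK mul1r.
Qed.

Lemma gunitMl f g : gunit (f * g) -> gunit f.
Proof. by move=> [h]; rewrite -mulrA => e; exists (g * h). Qed.

(** The lowest exponents of a unit and of its inverse add up to [0], both for [v] and for [- v].
    This leaves no room for two values of [dot _ v] on the support. *)
Lemma gunit_dot f v a b : v != 0 -> gunit f -> a \in supp f -> b \in supp f ->
  dot a v = dot b v.
Proof.
move=> v0 [g fg].
have v0' : - v != 0 by rewrite oppr_eq0.
have f0 : f != 0 by apply/eqP => e; move/eqP: fg; rewrite e mul0r eq_sym oner_eq0.
have g0 : g != 0 by apply/eqP => e; move/eqP: fg; rewrite e mulr0 eq_sym oner_eq0.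
have dotN w : dot w (- v) = - dot w v by rewrite !dotE /=; ring.
have [c cf] := lowest_ex v f0; have [d dg] := lowest_ex v g0.
have [c' cf'] := lowest_ex (- v) f0; have [d' dg'] := lowest_ex (- v) g0.
have s1 u : u \in supp (f * g) -> u = 0.
  by rewrite fg -(mon0 A) supp_mon => /eqP.
have E : c + d = 0 by apply: s1; case: (lowestM v0 cf dg).
have E' : c' + d' = 0 by apply: s1; case: (lowestM v0' cf' dg').
have := proj2 cf _ (proj1 cf'); have := proj2 dg _ (proj1 dg').
have : dot (c + d) v = dot (c' + d') v by rewrite E E'.
rewrite !dotDl => e1 l1 l2 af bf.
have := proj2 cf _ af; have := proj2 cf' _ af.
have := proj2 cf _ bf; have := proj2 cf' _ bf.
by move: l1 l2; rewrite /lexle !dotN; lia.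
Qed.

(** After clearing denominators the claim is about [{poly {poly k}}]. If some [x - a] divides the
    polynomial of [xi], it equals it up to a unit; otherwise the gcd with [F] over [k(x)] decides,
    by Gauss's lemma. *)
Lemma girreducible_prime xi f g : girreducible xi -> gdvd xi (f * g) ->
  gdvd xi f \/ gdvd xi g.
Proof.
move=> [xi0 xin xii] [q fgE].
have x0 : ((1, 0) : lattice) != 0 by [].
have y0 : ((0, 1) : lattice) != 0 by [].
have [c1 l1] := lowest_ex (1, 0) (introN eqP xi0).
have [c2 l2] := lowest_ex (0, 1) (introN eqP xi0).
(* This shift makes [xi] a polynomial with exponents on both axes, hence divisible neither by [x]
   nor by [y], which are units among Laurent polynomials. *)
pose u : lattice := (- c1.1, - c2.2).
have nnx : nonneg (mon u * xi).
  move=> w; rewrite supp_monM => wx.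
  move: (proj2 l1 _ wx) (proj2 l2 _ wx); rewrite /lexle !dotE /=; lia.
have [P PE] := ev_surj nnx.
have [wx wxP wx0] : exists2 w', w' \in supp (ev P) & w'.1 = 0.
  exists (u + c1); last by rewrite /=; lia.
  by rewrite PE supp_monM addrC addKr; case: l1.
have [wy wyP wy0] : exists2 w', w' \in supp (ev P) & w'.2 = 0.
  exists (u + c2); last by rewrite /=; lia.
  by rewrite PE supp_monM addrC addKr; case: l2.
have [F [H [W [u1 [u2 [FE HE FH]]]]]] : exists F H W u1 u2,
    [/\ ev F = mon u1 * f, ev H = mon u2 * g & P * W = F * H].
  have [a [a1 a2 af]] := shift_nonneg_ge f; have [b [b1 b2 bg]] := shift_nonneg_ge g.
  have [c [d1 d2 cq]] := shift_nonneg_ge q.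
  (* The shift of [q] is forced to be that of [f * g] minus [u]; [z] makes it large enough to clear
     the denominators of [q] as well. *)
  pose z : lattice := (`|c.1|%N%:Z + `|u.1|%N%:Z, `|c.2|%N%:Z + `|u.2|%N%:Z).
  have [F FE] := ev_surj (af (a + z) ltac:(rewrite /z /=; lia) ltac:(rewrite /z /=; lia)).
  have [H HE] := ev_surj (bg b (lexx _) (lexx _)).
  have [W WE] := ev_surj (cq (a + z + b - u) ltac:(rewrite /z /=; lia) ltac:(rewrite /z /=; lia)).
  exists F, H, W, (a + z), b; split=> //.
  apply: ev_injective; rewrite !rmorphM PE WE FE HE [LHS]mulrACA [RHS]mulrACA -!monD fgE.
  by rewrite [u + _]addrC subrK.
have xiP : xi = mon (- u) * ev P by rewrite PE mulrA monNK mul1r.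
have dvdf Q V : P = Q * V -> gunit (ev V) -> forall h a T, ev T = mon a * h ->
    (exists S, T = Q * S) -> gdvd xi h.
  move=> PQ [e Ve] h a T TE [S TS]; apply: (@gdvd_mon _ a).
  rewrite -TE TS rmorphM; apply: gdvdMr; exists (mon u * e).
  by rewrite mulrCA mulrA -PE PQ rmorphM -mulrA Ve mulr1.
have [Pprim|] := pselect (xprimitive P); last first.
  move=> /existsNP[a /existsNP[Q /contrapT PQ]].
  have a0 : a != 0.
    apply/eqP => a0; move: (wxP); rewrite PQ rmorphM ev_lin a0 rmorph0 subr0.
    by rewrite supp_monM => /(@nonneg_ev Q) [] /=; rewrite wx0.
  have Elin : xi = (mon (- u) * ev (lin a)) * ev Q.
    by rewrite xiP PQ rmorphM mulrA.
  have nlin : ~ gunit (ev (lin a)).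
    move=> ul; have : dot ((1, 0) : lattice) (1, 0) = dot (0 : lattice) (1, 0).
      apply: (gunit_dot x0 ul); rewrite ev_lin supp_cf cfD cfN cf_mon cf_cst.
        by rewrite eqxx subr0 oner_eq0.
      by rewrite eqxx sub0r oppr_eq0.
    by rewrite !dotE.
  have Qu : gunit (ev Q).
    by case: (xii _ _ Elin) => //; rewrite mulrC => /gunitMl /nlin.
  have FH' : F * H = lin a * (Q * W) by rewrite -FH {1}PQ mulrA.
  have := lin_prime FH'.
  by case=> h; [left; apply: (dvdf _ _ PQ Qu) FE h|right; apply: (dvdf _ _ PQ Qu) HE h].
have P1 : P = P * 1 by rewrite mulr1.
have u1' : gunit (ev 1) by rewrite rmorph1; exists 1; rewrite mulr1.
have Pn0 : P != 0.
  by apply/eqP => p0; move: wxP; rewrite p0 rmorph0 supp0.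
case: (coprime_or_common P F) => [[U [V [c [c0 UV]]]]|]; last case; last first.
- by case=> p0; move: Pn0; rewrite p0 eqxx.
- move=> [D [H' [E [c [d [sD c0 d0 cP dF]]]]]].
  have [D' [H2 [d1 [d2 [PD DD _ d10]]]]] := split_factor c0 cP.
  have sD' : (1 < size D')%N.
    by move: sD; rewrite DD mul_polyC size_scale.
  have Dx : xprimitive D'.
    by move=> a Q DQ; apply: (Pprim a (Q * H2)); rewrite PD DQ mulrA.
  have [S FS] : exists S, F = D' * S.
    by apply: (xprimitive_cancel d0 Dx (W := d1%:P * E)); rewrite dF DD mulrCA mulrA.
  have Exi : xi = (mon (- u) * ev D') * ev H2 by rewrite xiP PD rmorphM mulrA.
  case: (xii _ _ Exi) => [|uH]; last first.
    by left; apply: (dvdf _ _ PD uH) FE _; exists S.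
  rewrite mulrC => /gunitMl uD.
  (* [D'] is not a unit: it has an exponent of positive second coordinate and, because [P] has an
     exponent with second coordinate [0], another one with coordinate [0]. *)
  have [w wD w2] : exists2 w, w \in supp (ev D') & 0 < w.2.
    have : lead_coef (lead_coef D') != 0.
      by rewrite !lead_coef_eq0; apply: contraTneq sD' => ->; rewrite size_poly0.
    rewrite {1}lead_coefE {1}lead_coefE -cf_ev -supp_cf => wD.
    exists ((size (lead_coef D')).-1%:Z, (size D').-1%:Z); first exact: wD.
    by rewrite /= ltz_nat -subn1 subn_gt0.
  have [a [b [aD bH Ew]]] := suppM (eq_rect _ (fun z => wy \in supp z) wyP _ ltac:(by rewrite PD rmorphM)).
  have := gunit_dot y0 uD wD aD; rewrite !dotE /= !mulr0 !mulr1 !add0r => e.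
  have key (x y z : int) : 0 < x -> x = y -> 0 <= y -> 0 <= z -> y + z <> 0 by lia.
  by case: (key _ _ _ w2 e (proj2 (nonneg_ev aD)) (proj2 (nonneg_ev bH))); rewrite -wy0 Ew.
have [S HS] : exists S, H = P * S.
  apply: (xprimitive_cancel c0 Pprim (W := U * H + V * W)).
  by rewrite -UV mulrDl mulrDr; congr (_ + _); rewrite ?[P * (V * _)]mulrCA ?FH; ring.
by right; apply: (dvdf _ _ P1 u1') HE _; exists S.
Qed.

End Prime.

(** * Independence modulo an ideal *)

Section Independence.
Variables (k : fieldType) (A : comNzRingType) (c : {rmorphism k -> A}).
Implicit Types (f g : A) (S : A -> Prop).

Definition is_ideal S :=
  [/\ S 0, forall f g, S f -> S g -> S (f + g) & forall f g, S g -> S (f * g)].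

Definition lincomb (I : finType) (z : I -> A) (l : I -> k) : A :=
  \sum_i c (l i) * z i.

Definition indep S (I : finType) (z : I -> A) :=
  forall l : I -> k, S (lincomb z l) -> forall i, l i = 0.

Lemma ideal_sum S I (r : seq I) (P : pred I) (F : I -> A) : is_ideal S ->
  (forall i, P i -> S (F i)) -> S (\sum_(i <- r | P i) F i).
Proof. by move=> [S0 SD _] SF; apply: (big_ind S). Qed.

Lemma left_kernel m n (M : 'M[k]_(m, n)) : (n < m)%N ->
  exists2 v : 'rV[k]_m, v != 0 & v *m M = 0.
Proof.
move=> nm; have : kermx M != 0.
  rewrite kermx_eq0 /row_free; apply/eqP => e.
  by have := rank_leq_col M; rewrite e leqNgt nm.
case/rowV0Pn => v /sub_kermxP vM v0; exists v => //.
Qed.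

Lemma steinitz S (I J : finType) (z : I -> A) (w : J -> A) : is_ideal S ->
  indep S z -> (forall i, exists l : J -> k, S (z i - lincomb w l)) ->
  (#|I| <= #|J|)%N.
Proof.
move=> Sid zS /choice[mu muP]; rewrite leqNgt; apply/negP => lt.
pose M : 'M[k]_(#|I|, #|J|) := \matrix_(i, j) mu (enum_val i) (enum_val j).
have [v v0 vM] := left_kernel M lt.
pose l i := v 0 (enum_rank i).
have l0 : forall i, l i = 0.
  apply: zS; have -> : lincomb z l = \sum_i c (l i) * (z i - lincomb w (mu i)).
    have E : \sum_i c (l i) * lincomb w (mu i) = 0.
      under eq_bigr => i _ do rewrite /lincomb mulr_sumr.
      rewrite exchange_big big1 //= => j _.
      under eq_bigr => i _ do rewrite mulrA -rmorphM.
      rewrite -mulr_suml -rmorph_sum.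
      have -> : \sum_i l i * mu i j = (v *m M) 0 (enum_rank j).
        rewrite mxE (reindex_onto enum_rank enum_val) /=; last by move=> i _; rewrite enum_valK.
        by apply: eq_big => i; rewrite ?enum_rankK ?eqxx // mxE !enum_rankK.
      by rewrite vM mxE rmorph0 mul0r.
    rewrite -[LHS]subr0 -[X in _ - X]E -sumrB.
    by apply: eq_bigr => i _; rewrite mulrBr.
  by apply: ideal_sum => // i _; case: Sid => _ _; apply.
case/negP: v0; apply/eqP/rowP => i.
by rewrite mxE -(l0 (enum_val i)) /l enum_valK.
Qed.

Lemma max_indep S (B : nat) : is_ideal S ->
  (forall n (z : 'I_n -> A), indep S z -> (n <= B)%N) ->
  exists n (z : 'I_n -> A), indep S z /\
    forall f, exists l : 'I_n -> k, S (f - lincomb z l).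
Proof.
move=> Sid bound; pose P n := `[< exists z : 'I_n -> A, indep S z >].
have P0 : exists n, P n.
  by exists 0%N; apply/asboolP; exists (fun=> 0) => l _ [].
have PB n : P n -> (n <= B)%N by move=> /asboolP[z /bound].
case: (ex_maxnP P0 PB) => n /asboolP[z zi] nmax.
exists n, z; split=> // f; apply: contrapT => no.
suff /nmax : P n.+1 by rewrite ltnn.
apply/asboolP; exists (fun i => oapp z f (unlift ord0 i)) => l.
rewrite /lincomb big_ord_recl unlift_none /=.
under eq_bigr => i _ do rewrite liftK /=.
move=> Sl; have l0 : l ord0 = 0.
  apply/eqP; apply: contra_notT no => l0.
  exists (fun i => - (l ord0)^-1 * l (lift ord0 i)).
  have -> : f - lincomb z (fun i => - (l ord0)^-1 * l (lift ord0 i)) =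
    c (l ord0)^-1 * (c (l ord0) * f + \sum_i c (l (lift ord0 i)) * z i).
    rewrite mulrDr mulrA -rmorphM mulVf // rmorph1 mul1r; congr (_ + _).
    rewrite mulr_sumr -sumrN; apply: eq_bigr => i _.
    by rewrite mulNr rmorphN mulNr opprK rmorphM mulrA.
  by case: Sid => _ _; apply.
move: Sl; rewrite l0 rmorph0 mul0r add0r => /zi ll i.
by case: (unliftP ord0 i) => [j ->|->].
Qed.

Lemma indep_sub S S' (I : finType) (z : I -> A) :
  (forall f, S f -> S' f) -> indep S' z -> indep S z.
Proof. by move=> SS zi l /SS /zi. Qed.

End Independence.

(** * Lattice points on a line *)

Lemma card_fset_seq (T : choiceType) (L : {fset T}) (s : seq T) : uniq s ->
  (forall x, (x \in L) = (x \in s)) -> #|` L| = size s.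
Proof.
by move=> us Ls; apply: perm_size; apply: uniq_perm.
Qed.

Lemma line_param (x : lattice) : coprimez x.1 x.2 -> exists g : lattice,
  dot g x = 1 /\ forall u : lattice, dot u x = 0 ->
    u = (- x.2 * (g.1 * u.2 - g.2 * u.1), x.1 * (g.1 * u.2 - g.2 * u.1)).
Proof.
rewrite /coprimez => /eqP cx; have [a [b E]] := Bezoutz x.1 x.2.
rewrite cx in E; exists (a, b); split=> [|u]; first by rewrite dotE.
rewrite dotE /= => e; rewrite [LHS]surjective_pairing.
apply/eqP; rewrite xpair_eqE; apply/andP; split; apply/eqP.
  rewrite -[LHS]mul1r -E.
  transitivity (a * (u.1 * x.1 + u.2 * x.2) + (b * x.2 * u.1 - a * x.2 * u.2)).
    by ring.
  by rewrite e; ring.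
rewrite -[LHS]mul1r -E.
transitivity (b * (u.1 * x.1 + u.2 * x.2) + (a * x.1 * u.2 - b * x.1 * u.1)).
  by ring.
by rewrite e; ring.
Qed.

(** [L] consists of the points gained when the side normal to [x] of a triangle is pushed out by
    one. They are the integers of an interval of length [(s + qx) / (qy * qz)], with [s] the size
    [qx * ax + qy * ay + qz * az], and rounding its ends costs a bounded amount. *)
Lemma line_count (x y z : lattice) (sg qx qy qz : int) :
  sg * sg = 1 -> coprimez x.1 x.2 -> det2 x y = sg * qz -> det2 y z = sg * qx ->
  det2 z x = sg * qy -> 0 < qx -> 0 < qy -> 0 < qz ->
  forall (ax ay az : int) (L : {fset lattice}),
    (forall u, u \in L = [&& dot u x == - (ax + 1), - ay <= dot u y & - az <= dot u z]) ->
    0 <= qx * ax + qy * ay + qz * az ->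
    `|qy * qz * #|` L|%:Z - (qx * ax + qy * ay + qz * az)| <= qy * qz + qx.
Proof.
move=> sg2 cx dxy dyz dzx qx0 qy0 qz0 ax ay az L LP s0.
have [g [gx gP]] := line_param cx.
pose N := - (ax + 1); pose w : lattice := (- sg * x.2, sg * x.1).
have wx : dot w x = 0 by rewrite dotE /=; ring.
have wy : dot w y = qz.
  transitivity (sg * det2 x y); first by rewrite dotE /det2 /=; ring.
  by rewrite dxy mulrA sg2 mul1r.
have wz : dot w z = - qy.
  transitivity (- (sg * det2 z x)); first by rewrite dotE /det2 /=; ring.
  by rewrite dzx mulrA sg2 mul1r.
pose f (n : int) : lattice := (N * g.1 + n * w.1, N * g.2 + n * w.2).
have fdot n t : dot (f n) t = N * dot g t + n * dot w t.
  by rewrite !dotE /f /=; ring.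
pose lo := - ((ay + N * dot g y) %/ qz)%Z; pose hi := ((az + N * dot g z) %/ qy)%Z.
have rel : qy * dot g y + qz * dot g z = - qx.
  have : sg * (qx * dot g x + qy * dot g y + qz * dot g z) = 0.
    transitivity (det2 y z * dot g x + det2 z x * dot g y + det2 x y * dot g z).
      by rewrite dxy dyz dzx; ring.
    by rewrite !dotE /det2; ring.
  move/(congr1 (fun t => sg * t)); rewrite mulrA sg2 mul1r mulr0 gx; lia.
have fL n : (f n \in L) = (lo <= n <= hi).
  rewrite LP !fdot gx wx wy wz mulr1 mulr0 addr0 eqxx /=.
  congr (_ && _); last by rewrite /hi lez_divRL //; apply/idP/idP; lia.
  by rewrite /lo [RHS]lerNl lez_divRL //; apply/idP/idP; lia.
have Lf u : u \in L -> exists n, u = f n.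
  rewrite LP => /and3P[/eqP ux _ _].
  pose u0 : lattice := (u.1 - N * g.1, u.2 - N * g.2).
  have /gP : dot u0 x = 0.
    transitivity (dot u x - N * dot g x); first by rewrite !dotE /u0 /=; ring.
    by rewrite ux gx mulr1 subrr.
  set n := _ - _ => E; exists (sg * n); rewrite /f /w /=.
  have e1 : u.1 = N * g.1 + - x.2 * n by move: (congr1 fst E); rewrite /u0 /=; lia.
  have e2 : u.2 = N * g.2 + x.1 * n by move: (congr1 snd E); rewrite /u0 /=; lia.
  rewrite [LHS]surjective_pairing e1 e2; apply/eqP; rewrite xpair_eqE.
  apply/andP; split; apply/eqP; congr (_ + _).
    transitivity (sg * sg * (- x.2 * n)); last by ring.
    by rewrite sg2 mul1r.
  transitivity (sg * sg * (x.1 * n)); last by ring.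
  by rewrite sg2 mul1r.
have finj : injective f.
  move=> n n' /(congr1 (fun u => dot u y)); rewrite !fdot wy => /addrI.
  by apply: mulIf; rewrite gt_eqF.
pose m := if lo <= hi then absz (hi - lo + 1) else 0%N.
have cL : #|` L| = m.
  rewrite (card_fset_seq (s := [seq f (lo + i%:Z) | i <- iota 0 m])).
  - by rewrite size_map size_iota.
  - rewrite map_inj_uniq ?iota_uniq // => i j /finj; lia.
  move=> u; apply/idP/mapP => [uL|[i]].
    have [n un] := Lf u uL; move: uL; rewrite un fL => /andP[ln nh].
    exists (absz (n - lo)); last by congr f; lia.
    by rewrite mem_iota /m (le_trans ln nh); lia.
  rewrite mem_iota /m => im ->; rewrite fL; case: ifP im; lia.
have hB : (az + N * dot g z) - qy + 1 <= hi * qy <= az + N * dot g z.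
  rewrite /hi; have := divz_eq (az + N * dot g z) qy.
  have := modz_ge0 (az + N * dot g z) (lt0r_neq0 qy0).
  have := ltz_pmod (az + N * dot g z) qy0; lia.
have lB : (ay + N * dot g y) - qz + 1 <= - lo * qz <= ay + N * dot g y.
  rewrite /lo opprK; have := divz_eq (ay + N * dot g y) qz.
  have := modz_ge0 (ay + N * dot g y) (lt0r_neq0 qz0).
  have := ltz_pmod (ay + N * dot g y) qz0; lia.
have mE : (m%:Z = hi - lo + 1 /\ 0 <= hi - lo + 1) \/ (m%:Z = 0 /\ hi - lo + 1 <= 0).
  by rewrite /m; case: ifP; lia.
have sE : qz * (az + N * dot g z) + qy * (ay + N * dot g y) = 
    qx * ax + qy * ay + qz * az + qx.
  transitivity (qz * az + qy * ay + N * (qy * dot g y + qz * dot g z)); first by ring.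
  by rewrite rel /N; ring.
rewrite cL; move: hB lB sE mE s0; move: (az + _) (ay + _) (m%:Z) (qx * ax + qy * ay + qz * az).
clear - qx0 qy0 qz0; move: lo hi => lo hi B A M s /andP[hB1 hB2] /andP[lB1 lB2] sE mE s0.
have h1 : qz * (B - qy + 1) <= qz * (hi * qy) by rewrite ler_pM2l.
have h2 : qz * (hi * qy) <= qz * B by rewrite ler_pM2l.
have h3 : qy * (A - qz + 1) <= qy * (- lo * qz) by rewrite ler_pM2l.
have h4 : qy * (- lo * qz) <= qy * A by rewrite ler_pM2l.
case: mE => -[-> mm]; first by rewrite ler_norml; apply/andP; split; lia.
have h5 : qy * qz * (hi - lo + 1) <= 0.
  by rewrite pmulr_rle0 ?mulr_gt0.
rewrite mulr0 sub0r normrN ger0_norm //; lia.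
Qed.

Lemma ord3_ind (P : 'I_3 -> Prop) : P 0 -> P 1 -> P 2 -> forall i, P i.
Proof.
move=> P0 P1 P2 i; have : [|| i == 0, i == 1 | i == 2] by case: i => [[|[|[|]]]].
by case/or3P => /eqP ->.
Qed.

Lemma ord3_11 : 1 + 1 = 2 :> 'I_3. Proof. exact/val_inj. Qed.
Lemma ord3_12 : 1 + 2 = 0 :> 'I_3. Proof. exact/val_inj. Qed.
Lemma ord3_21 : 2 + 1 = 0 :> 'I_3. Proof. exact/val_inj. Qed.
Lemma ord3_22 : 2 + 2 = 1 :> 'I_3. Proof. exact/val_inj. Qed.
Definition ord3E := (add0r, ord3_11, ord3_12, ord3_21, ord3_22).

Lemma sum_cycle3 (V : nmodType) (F : 'I_3 -> V) i :
  \sum_j F j = F i + F (i + 1) + F (i + 2).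
Proof.
by move: i; apply: ord3_ind; rewrite sum_ord3 ?ord3E //;
  [rewrite -addrA addrC | rewrite addrC addrA].
Qed.

(** * Lattice points of triangles *)

Section Fan.
Variable v : fan3.
Implicit Types (a d : {ffun 'I_3 -> int}) (u : lattice) (i j : 'I_3).

Definition good_fan := (forall i, coprimez (v i).1 (v i).2) /\
  exists2 sg : int, sg * sg = 1 & forall i, 0 < sg * det2 (v (i + 1)) (v (i + 2)).

(** In a good fan these are the coefficients of the linear relation [\sum_i wt i * v i = 0] between
    the rays, so that [size_div] vanishes on divisors of characters. *)
Definition wt i : int := `|det2 (v (i + 1)) (v (i + 2))|.

(* The toric intersection number of [\sum_i a_i D_i] and [\sum_i b_i D_i] is
   [size_div a * size_div b / wprod]. *)
Definition size_div a : int := \sum_i wt i * a i.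

Definition wprod : int := wt 0 * wt 1 * wt 2.

Lemma size_divD a d : size_div (a + d) = size_div a + size_div d.
Proof.
by rewrite /size_div -big_split; apply: eq_bigr => i _; rewrite ffunE mulrDr.
Qed.

Lemma size_div0 : size_div 0 = 0.
Proof. by rewrite /size_div big1 // => i _; rewrite ffunE mulr0. Qed.

Lemma size_divN a : size_div (- a) = - size_div a.
Proof. by apply: (addrI (size_div a)); rewrite -size_divD !subrr size_div0. Qed.

Lemma size_divB a d : size_div (a - d) = size_div a - size_div d.
Proof. by rewrite size_divD size_divN. Qed.

Lemma size_divMn a n : size_div (a *+ n) = size_div a *+ n.
Proof. by elim: n => [|n IH]; rewrite ?mulr0n ?size_div0 // !mulrS size_divD IH. Qed.

Definition vecp u : {ffun 'I_3 -> int} := [ffun i => dot u (v i)].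

Hypothesis vok : good_fan.

Lemma wt_sign : exists2 sg : int, sg * sg = 1 &
  forall i, det2 (v (i + 1)) (v (i + 2)) = sg * wt i /\ 0 < wt i.
Proof.
case: vok => _ [sg sg2 dv]; exists sg => // i; have := dv i.
rewrite /wt; have [->|->] : sg = 1 \/ sg = -1 by nia.
  by rewrite !mul1r => h; rewrite gtr0_norm.
by rewrite !mulN1r oppr_gt0 => h; rewrite ltr0_norm // opprK oppr_gt0.
Qed.

Lemma wt_gt0 i : 0 < wt i.
Proof. by case: wt_sign => sg _ h; case: (h i). Qed.

Lemma wprod_gt0 : 0 < wprod.
Proof. by rewrite /wprod !mulr_gt0 ?wt_gt0. Qed.

Lemma wprodE i : wprod = wt i * wt (i + 1) * wt (i + 2).
Proof. by move: i; apply: ord3_ind; rewrite /wprod ?ord3E //; ring. Qed.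

Lemma fan_neq0 i : v i != 0.
Proof.
case: vok => + _ => /(_ i); apply: contraTneq => ->.
by rewrite /coprimez gcd0z.
Qed.

Lemma det2_sum i u : det2 (v (i + 1)) (v (i + 2)) * dot u (v i) +
  det2 (v (i + 2)) (v i) * dot u (v (i + 1)) +
  det2 (v i) (v (i + 1)) * dot u (v (i + 2)) = 0.
Proof. by rewrite !dotE /det2; ring. Qed.

Lemma size_vecp u : size_div (vecp u) = 0.
Proof.
case: wt_sign => sg sg2 dv; rewrite /size_div sum_ord3 !ffunE.
have := det2_sum 0 u; have := dv 0; have := dv 1; have := dv 2; rewrite !ord3E.
move=> [-> _] [-> _] [-> _] => /(congr1 (fun t => sg * t)); rewrite mulr0 => h.
rewrite -[RHS]h !mulrDr !mulrA sg2 !mul1r; ring.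
Qed.

Definition box n : seq lattice :=
  [seq (m%:Z - n%:Z, l%:Z - n%:Z) | m <- iota 0 n.*2.+1, l <- iota 0 n.*2.+1].

Lemma mem_box n u : `|u.1| <= n%:Z -> `|u.2| <= n%:Z -> u \in box n.
Proof.
move=> u1 u2; apply/allpairsP.
exists (absz (u.1 + n%:Z), absz (u.2 + n%:Z)); rewrite !mem_iota /=; split; try lia.
by rewrite [LHS]surjective_pairing; apply/eqP; rewrite xpair_eqE; apply/andP; split; apply/eqP; lia.
Qed.

Definition rad a : nat := absz ((\sum_j wt j * `|a j|) *
  (`|(v 0).1| + `|(v 0).2| + `|(v 1).1| + `|(v 1).2|)).

(** The lattice points of the polygon of [\sum_i a_i D_i]. The box serves finiteness only; by
    [mem_lat] it cuts nothing off. *)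
Definition lat a : {fset lattice} :=
  locked [fset u in box (rad a) | [forall i, - a i <= dot u (v i)]]%fset.

(** Because of [\sum_i wt i * dot u (v i) = 0], lower bounds on two of the products bound the third
    from above. *)
Lemma lat_bound a u : (forall i, - a i <= dot u (v i)) ->
  forall i, `|dot u (v i)| <= \sum_j wt j * `|a j|.
Proof.
move=> au i; have h j : `|a j| <= wt j * `|a j|.
  by rewrite ler_peMl //; have := wt_gt0 j; lia.
have h0 j : 0 <= wt j * `|a j| by have := wt_gt0 j; nia.
have := size_vecp u; rewrite /size_div (sum_cycle3 _ i) !ffunE => E.
rewrite (sum_cycle3 _ i).
have := au i; have := au (i + 1); have := au (i + 2).
have := h i; have := h0 (i + 1); have := h0 (i + 2).
have := wt_gt0 i; have := wt_gt0 (i + 1); have := wt_gt0 (i + 2).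
move: E; move: (wt i) (wt (i + 1)) (wt (i + 2)) (a i) (a (i + 1)) (a (i + 2)).
move: (dot u (v i)) (dot u (v (i + 1))) (dot u (v (i + 2))).
move=> x y z p q r A B C E r0 q0 p0 h1 h2 h3 hC hB hA.
have e1 : - (q * `|B|) <= q * y by rewrite -mulrN ler_pM2l //; lia.
have e2 : - (r * `|C|) <= r * z by rewrite -mulrN ler_pM2l //; lia.
have e3 : p * x <= q * `|B| + r * `|C| by lia.
have e4 : x <= q * `|B| + r * `|C|.
  have [x0|x0] := leP x 0; first by lia.
  by apply: le_trans e3; rewrite ler_peMl //; lia.
rewrite ler_norml; apply/andP; split; lia.
Qed.

Lemma mem_lat a u : (u \in lat a) = [forall i, - a i <= dot u (v i)].
Proof.
rewrite /lat -lock !inE andbC; case: forallP => //= au; apply: mem_box; rewrite /rad.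
  have b0 := lat_bound au 0; have b1 := lat_bound au 1.
  have d0 := wt_gt0 2; move: (wt_sign) => [sg sg2 /(_ 2)[dE _]].
  move: d0 dE b0 b1; rewrite !ord3E => d0 dE.
  set M := \sum_j _ => b0 b1.
  have E : sg * (wt 2 * u.1) = dot u (v 0) * (v 1).2 - dot u (v 1) * (v 0).2.
    by rewrite mulrA -dE !dotE /det2; ring.
  have E1 : `|u.1| <= `|dot u (v 0)| * `|(v 1).2| + `|dot u (v 1)| * `|(v 0).2|.
    rewrite -!normrM; apply: le_trans (ler_normB _ _); rewrite -E !normrM.
    have -> : `|sg| = 1 by have [->|->] : sg = 1 \/ sg = -1 by nia.
    by rewrite mul1r ler_peMl //; lia.
  apply: (le_trans E1); rewrite gez0_abs; last by rewrite mulr_ge0 //; lia.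
  have M0 : 0 <= M by lia.
  have f1 : `|dot u (v 0)| * `|(v 1).2| <= M * `|(v 1).2| by rewrite ler_wpM2r.
  have f2 : `|dot u (v 1)| * `|(v 0).2| <= M * `|(v 0).2| by rewrite ler_wpM2r.
  have f3 : 0 <= M * `|(v 0).1| by rewrite mulr_ge0.
  have f4 : 0 <= M * `|(v 1).1| by rewrite mulr_ge0.
  rewrite !mulrDr; lia.
have b0 := lat_bound au 0; have b1 := lat_bound au 1.
have d0 := wt_gt0 2; move: (wt_sign) => [sg sg2 /(_ 2)[dE _]].
move: d0 dE b0 b1; rewrite !ord3E => d0 dE.
set M := \sum_j _ => b0 b1.
have E : sg * (wt 2 * u.2) = dot u (v 1) * (v 0).1 - dot u (v 0) * (v 1).1.
  by rewrite mulrA -dE !dotE /det2; ring.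
have E1 : `|u.2| <= `|dot u (v 1)| * `|(v 0).1| + `|dot u (v 0)| * `|(v 1).1|.
  rewrite -!normrM; apply: le_trans (ler_normB _ _); rewrite -E !normrM.
  have -> : `|sg| = 1 by have [->|->] : sg = 1 \/ sg = -1 by nia.
  by rewrite mul1r ler_peMl //; lia.
apply: (le_trans E1); rewrite gez0_abs; last by rewrite mulr_ge0 //; lia.
have M0 : 0 <= M by lia.
have f1 : `|dot u (v 0)| * `|(v 1).1| <= M * `|(v 1).1| by rewrite ler_wpM2r.
have f2 : `|dot u (v 1)| * `|(v 0).1| <= M * `|(v 0).1| by rewrite ler_wpM2r.
have f3 : 0 <= M * `|(v 0).2| by rewrite mulr_ge0.
have f4 : 0 <= M * `|(v 1).2| by rewrite mulr_ge0.
rewrite !mulrDr; lia.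
Qed.

Lemma mem_latP a u : reflect (forall i, - a i <= dot u (v i)) (u \in lat a).
Proof. rewrite mem_lat; exact: forallP. Qed.

Lemma lat_size_ge0 a u : u \in lat a -> 0 <= size_div a.
Proof.
move=> /mem_latP au.
have -> : size_div a = size_div (a + vecp u) by rewrite size_divD size_vecp addr0.
rewrite /size_div; apply: sumr_ge0 => i _; apply: mulr_ge0; first exact/ltW/wt_gt0.
by rewrite !ffunE -lerBlDl sub0r.
Qed.

Definition eps i : {ffun 'I_3 -> int} := [ffun j => (j == i)%:R].

Lemma size_eps i : size_div (eps i) = wt i.
Proof.
rewrite /size_div (bigD1 i) //= ffunE eqxx mulr1 big1 ?addr0 // => j /negbTE ji.
by rewrite ffunE ji mulr0.
Qed.

Lemma step_ineq (p q r s N M : int) : 0 < p -> `|q * r * M - s| <= q * r + p ->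
  `|p * q * r * (N + M) - p * q * r * N - p * s| <= p * q * r + p * p.
Proof.
move=> p0 h.
have -> : p * q * r * (N + M) - p * q * r * N - p * s = p * (q * r * M - s) by ring.
rewrite normrM (gtr0_norm p0); apply: (le_trans (y := p * (q * r + p))).
  by rewrite ler_pM2l.
by rewrite le_eqVlt; apply/orP; left; apply/eqP; ring.
Qed.

Lemma lat_step a i : 0 <= size_div a ->
  `|wprod * #|` lat (a + eps i)|%:Z - wprod * #|` lat a|%:Z - wt i * size_div a|
    <= wprod + wt i * wt i.
Proof.
move=> s0; pose L := [fset u in lat (a + eps i)%R | dot u (v i) == - (a i + 1)]%fset.
have epsE j : (a + eps i) j = a j + (j == i)%:R by rewrite !ffunE.
have split_lat : lat (a + eps i) = (lat a `|` L)%fset.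
  apply/fsetP => u; rewrite !inE /=.
  apply/idP/orP => [ua|[/mem_latP ua|/andP[] //]]; last first.
    by apply/mem_latP => j; rewrite epsE; have := ua j; lia.
  have [e|e] := eqVneq (dot u (v i)) (- (a i + 1)); first by right; rewrite ua.
  left; move/mem_latP: ua => ua; apply/mem_latP => j; have := ua j; rewrite epsE.
  case: (eqVneq j i) => [->|_]; move: e; lia.
have dis : (lat a `&` L)%fset = fset0.
  apply/fsetP => u; rewrite in_fsetI in_fset0; apply/negbTE/andP => -[/mem_latP/(_ i) h].
  by rewrite !inE /= => /andP[_ /eqP e]; move: h; rewrite e; lia.
have cE : #|` lat (a + eps i)| = (#|` lat a| + #|` L|)%N.
  by rewrite split_lat -(cardfsUI (lat a) L) dis cardfs0 addn0.
have [sg sg2 dv] := wt_sign.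
have [cop _] := vok.
have i12 : i + 1 + 1 = i + 2 by rewrite -addrA ord3_11.
have i21 : i + 2 + 1 = i by rewrite -addrA ord3_21 addr0.
have i22 : i + 2 + 2 = i + 1 by rewrite -addrA ord3_22.
have i112 : i + 1 + 2 = i by rewrite -addrA ord3_12 addr0.
have h1 := dv (i + 1); have h2 := dv (i + 2); have h0 := dv i.
rewrite i12 i112 in h1; rewrite i21 i22 in h2.
have ij : i + 1 == i = false by rewrite -subr_eq0 addrC addKr.
have il : i + 2 == i = false by rewrite -subr_eq0 addrC addKr.
have LP u : u \in L = [&& dot u (v i) == - (a i + 1), - a (i + 1) <= dot u (v (i + 1))
    & - a (i + 2) <= dot u (v (i + 2))].
  rewrite !inE /= andbC; case: eqP => //= e.
  apply/mem_latP/andP => [h|[h1' h2'] j].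
    have := h (i + 1); have := h (i + 2); rewrite !epsE ij il; lia.
  have : [|| j == i, j == i + 1 | j == i + 2].
    by move: i j {h1 h2 h0 ij il s0 L epsE split_lat dis cE i12 i21 i22 i112 e h1' h2'};
       do 2 (apply: ord3_ind); rewrite ?ord3E.
  case/or3P => /eqP ->; rewrite epsE ?eqxx ?ij ?il ?e; lia.
have := line_count sg2 (cop i) (proj1 h2) (proj1 h0) (proj1 h1) (proj2 h0)
  (proj2 h1) (proj2 h2) LP.
have -> : wt i * a i + wt (i + 1) * a (i + 1) + wt (i + 2) * a (i + 2) = size_div a.
  by rewrite /size_div (sum_cycle3 _ i).
move=> /(_ s0); rewrite cE (wprodE i) PoszD.
exact: step_ineq (wt_gt0 i).
Qed.

End Fan.

Section Asymptotics.
Variables (v : fan3) (vok : good_fan v).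
Implicit Types (a d : {ffun 'I_3 -> int}).
Local Notation sz := (size_div v).
Local Notation npts a := (wprod v * #|` lat v a|%:Z).

(** A Riemann-Roch estimate for adding [d]. One constant is both the error bound and the size from
    which the estimate holds; composing estimates shifts the size of [a] and enlarges it. *)
Definition lat_asymp d := exists2 K : int, 0 <= K & forall a, K <= sz a ->
  `|npts (a + d) - npts a - sz d * sz a| <= K.

Lemma lat_asymp0 : lat_asymp 0.
Proof. by exists 0 => // a _; rewrite addr0 size_div0 mul0r subrr subr0. Qed.

Lemma lat_asymp_eps i : lat_asymp (eps i).
Proof.
exists (wprod v + wt v i * wt v i) => [|a sa].
  by rewrite addr_ge0 ?mulr_ge0 ?ltW ?wprod_gt0 ?wt_gt0.
rewrite size_eps; apply: lat_step => //; apply: le_trans sa.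
by rewrite addr_ge0 ?mulr_ge0 ?ltW ?wprod_gt0 ?wt_gt0.
Qed.

Lemma lat_asympD d d' : lat_asymp d -> lat_asymp d' -> lat_asymp (d + d').
Proof.
move=> [K K0 dK] [K' K0' dK']; exists (K + K' + `|sz d| + `|sz d' * sz d|).
  by rewrite !addr_ge0.
move=> a sa; have sd : sz (a + d) = sz a + sz d by rewrite size_divD.
have n3 := ler_norm (- sz d); rewrite normrN in n3.
have n1 := normr_ge0 (sz d' * sz d); have n2 := normr_ge0 (sz d).
have h := dK a ltac:(lia); have h' := dK' (a + d) ltac:(rewrite sd; lia).
have key (p q r x y z D : int) : `|p - q - x| <= K -> `|r - p - (y + z)| <= K' ->
  0 <= D -> `|r - q - (x + y)| <= K + K' + D + `|z| by lia.
rewrite addrA size_divD mulrDl; apply: key h _ n2.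
by rewrite -mulrDr -sd.
Qed.

Lemma lat_asympN d : lat_asymp d -> lat_asymp (- d).
Proof.
move=> [K K0 dK]; exists (K + `|sz d| + `|sz d * sz d|); first by rewrite !addr_ge0.
move=> a sa; have sd : sz (a - d) = sz a - sz d by rewrite size_divB.
have n1 := normr_ge0 (sz d * sz d); have n2 := ler_norm (sz d).
have h := dK (a - d) ltac:(rewrite sd; lia).
have key (p q x z D : int) : `|q - p - (x - z)| <= K -> 0 <= D ->
  `|p - q - (- x)| <= K + D + `|z| by lia.
rewrite subrK sd mulrBr in h; rewrite size_divN mulNr.
exact: key h (normr_ge0 (sz d)).
Qed.

Lemma lat_asymp_all d : lat_asymp d.
Proof.
have h i n : lat_asymp (eps i *+ n).
  elim: n => [|n IH]; first by rewrite mulr0n; exact: lat_asymp0.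
  by rewrite mulrS; apply: lat_asympD IH; exact: lat_asymp_eps.
have hz i (z : int) : lat_asymp (eps i *~ z).
  case: z => n; first by rewrite -pmulrn; exact: h.
  by rewrite NegzE mulrNz -pmulrn; apply: lat_asympN; exact: h.
have -> : d = \sum_i eps i *~ d i.
  apply/ffunP => j; rewrite sum_ffunE (bigD1 j) //= big1 => [|i ij].
    by rewrite ffunMzE ffunE eqxx addr0 intz.
  by rewrite ffunMzE ffunE eq_sym (negbTE ij) mul0rz.
by apply: big_ind => // [|*]; [exact: lat_asymp0|exact: lat_asympD].
Qed.

End Asymptotics.

(** * Sections modulo the curve *)

Section Sections.
Variables (k : closedFieldType) (A : gmodel k lattice) (v : fan3).
Hypothesis vok : good_fan v.
Implicit Types (f g h : A) (u w : lattice) (a b d : {ffun 'I_3 -> int}).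
Local Notation mon := (@gmon k _ A).
Local Notation cst := (@gcst k _ A).
Local Notation sz := (size_div v).

(* [f] is a section of [\sum_i a_i D_i] on the toric surface. *)
Definition insec a f := forall i, ord_ge (v i) f (- a i).

Lemma insec_mon a u : insec a (mon u) <-> u \in lat v a.
Proof.
split=> [h|/(mem_latP vok) h i]; last by move=> w; rewrite supp_mon => /eqP ->.
by apply/(mem_latP vok) => i; apply: h; rewrite supp_mon.
Qed.

Lemma insec_supp a f u : insec a f -> u \in supp f -> u \in lat v a.
Proof. by move=> af uf; apply/(mem_latP vok) => i; apply: af. Qed.

Lemma insecD a f g : insec a f -> insec a g -> insec a (f + g).
Proof. by move=> af ag i; apply: ord_geD. Qed.

Lemma insec0 a : insec a 0.
Proof. by move=> i u; rewrite supp0. Qed.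

Lemma insecM a b f g : insec a f -> insec b g -> insec (a + b) (f * g).
Proof. by move=> af bg i; rewrite ffunE opprD; apply: ord_geM. Qed.

Lemma insec_cst c : insec 0 (cst c).
Proof. by move=> i; rewrite ffunE oppr0; apply: ord_ge_cst. Qed.

Lemma insec_cstM a c f : insec a f -> insec a (cst c * f).
Proof. by move=> af; rewrite -[a]add0r; apply: insecM => //; apply: insec_cst. Qed.

Lemma insec1 : insec 0 1.
Proof. by rewrite -(rmorph1 cst); exact: insec_cst. Qed.

Lemma insecX a f n : insec a f -> insec (a *+ n) (f ^+ n).
Proof.
move=> af; elim: n => [|n IH]; first by rewrite mulr0n expr0; exact: insec1.
by rewrite mulrS exprS; apply: insecM.
Qed.

Lemma insec_size a f : insec a f -> f <> 0 -> 0 <= sz a.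
Proof.
move=> af /eqP f0; have [u [uf _]] := lowest_ex (1, 0) f0.
by apply: (lat_size_ge0 vok (u := u)); apply: insec_supp uf.
Qed.

(** Places a finite family in one divisor, large enough for the lattice point asymptotics. *)
Lemma insec_large n (z : 'I_n -> A) (K : int) :
  exists a, K <= sz a /\ forall i, insec a (z i).
Proof.
have [N [N0 NP]] : exists N : int, 0 <= N /\ forall i j u, u \in supp (z i) ->
    - N <= dot u (v j).
  pose s := [seq `|dot u (v j)| | j <- enum 'I_3, u <- flatten [seq enum_fset (supp (z i)) | i <- enum 'I_n]].
  exists (\sum_(x <- s) x).
  have s0 x : x \in s -> 0 <= x by case/allpairsP => -[j u] [_ _ ->].
  split=> [|i j u uz]; first by rewrite big_seq sumr_ge0.
  suff : `|dot u (v j)| <= \sum_(x <- s) x.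
    have := ler_norm (- dot u (v j)); rewrite normrN; lia.
  have us : `|dot u (v j)| \in s.
    apply/allpairsP; exists (j, u); rewrite mem_enum; split=> //.
    apply/flattenP; exists (enum_fset (supp (z i))) => //.
    by apply/mapP; exists i => //; rewrite mem_enum.
  rewrite (big_rem _ us) /= lerDl big_seq sumr_ge0 // => x /mem_rem; exact: s0.
exists [ffun=> N + `|K|]; split; last first.
  by move=> i j u /NP h; rewrite ffunE; have := h j; have := normr_ge0 K; lia.
rewrite /size_div (bigD1 (0 : 'I_3)) //= ffunE.
have h : N + `|K| <= wt v 0 * (N + `|K|).
  by rewrite ler_peMl ?addr_ge0 //; have := wt_gt0 vok 0; lia.
have h2 : 0 <= \sum_(i < 3 | i != 0) wt v i * [ffun=> N + `|K|] i.
  apply: sumr_ge0 => i _; rewrite ffunE; apply: mulr_ge0; last by rewrite addr_ge0.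
  exact: ltW (wt_gt0 vok i).
apply: (le_trans (ler_norm K)); apply: (le_trans _ (lerD h h2)).
by rewrite addr0 lerDr.
Qed.

Lemma mon_indep (S : {fset lattice}) (l : S -> k) :
  lincomb cst (fun x : S => mon (val x)) l = 0 -> forall x, l x = 0.
Proof.
move=> E x; have := congr1 (fun f => cf f (val x)) E.
rewrite /lincomb cf_sum cf0 (bigD1 x) //= cf_gmono eqxx mulr1n big1 ?addr0 //.
by move=> y /negbTE yx; rewrite cf_gmono val_eqE yx.
Qed.

Lemma supp_lincomb_mon (S : {fset lattice}) (l : S -> k) u :
  u \in supp (lincomb cst (fun x : S => mon (val x)) l) -> u \in S.
Proof.
rewrite supp_cf cf_sum; apply: contraR => uS; apply/eqP.
rewrite big1 // => x _; rewrite cf_gmono; case: eqP => // E.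
by case/negP: uS; rewrite -E; apply: valP.
Qed.

Lemma insec_lincomb a (I : finType) (z : I -> A) l :
  (forall i, insec a (z i)) -> insec a (lincomb cst z l).
Proof.
move=> az; apply: (big_ind (insec a)) => [|*|i _]; first exact: insec0.
  exact: insecD.
exact: insec_cstM.
Qed.

Lemma insec_span a f : insec a f ->
  exists l : lat v a -> k, f = lincomb cst (fun x : lat v a => mon (val x)) l.
Proof.
move=> af; exists (fun x => cf f (val x)); rewrite /lincomb.
have le : (supp f `<=` lat v a)%fset by apply/fsubsetP => u; apply: insec_supp.
by rewrite [LHS](gmEw le) big_seq_fsetE.
Qed.

Variables (xi : A) (c : {ffun 'I_3 -> int}) (m : nat).
Hypothesis xi_irr : girreducible xi.
Hypothesis xi_ord : forall i, ord_eq (v i) xi (c i).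
Hypothesis xi_mult : mult_eq xi m.

Lemma xi_neq0 : xi <> 0. Proof. by case: xi_irr. Qed.

(* As [\sum_i - c i D_i] is linearly equivalent to the image of the curve,
   [C.C = kappa ^ 2 / wprod - m ^ 2]. *)
Definition kappa : int := - sz c.

Lemma insec_xi : insec (- c) xi.
Proof. by move=> i; rewrite ffunE opprK; case: (xi_ord i). Qed.

Lemma insec_div a q : insec a (xi * q) -> insec (a + c) q.
Proof.
move=> h i; apply: (ord_ge_divl (fan_neq0 vok i) (xi_ord i)).
by rewrite ffunE opprD addrCA subrr addr0.
Qed.

(** If [kappa] vanished, every exponent of [xi] would have product [c i] with each ray. Then [xi]
    would be a monomial up to a scalar, hence a unit. *)
Lemma kap_gt0 : 0 < kappa.
Proof.
have xi0 := xi_neq0; have := insec_size insec_xi xi0; rewrite size_divN -/kappa.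
rewrite le_eqVlt => /orP[/eqP k0|//].
have key u : u \in supp xi -> forall i, dot u (v i) = c i.
  move=> uxi; have h : forall i, 0 <= wt v i * (dot u (v i) - c i).
    move=> i; apply: mulr_ge0; first exact: ltW (wt_gt0 vok i).
    by rewrite subr_ge0; case: (xi_ord i) => + _; apply.
  have s0 : \sum_i wt v i * (dot u (v i) - c i) = 0.
    transitivity (sz (vecp v u) - sz c).
      by rewrite /size_div -sumrB; apply: eq_bigr => i _; rewrite ffunE mulrBr.
    by rewrite size_vecp // sub0r -/kappa -k0.
  move=> i; have := psumr_eq0P (fun j _ => h j) s0 => /(_ i isT) /eqP.
  by rewrite mulf_eq0 subr_eq0 => /orP[/eqP w0|/eqP //]; have := wt_gt0 vok i; lia.
move/eqP: xi0 => /(lowest_ex (1, 0))[u [uxi _]].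
have sub w : w \in supp xi -> w = u.
  move=> wxi; have e0 : dot w (v 0) = dot u (v 0) by rewrite !key.
  have e1 : dot w (v 1) = dot u (v 1) by rewrite !key.
  have [sg sg2 /(_ 2)[dE d0]] := wt_sign vok; rewrite !ord3E in dE.
  have d1 : det2 (v 0) (v 1) != 0.
    rewrite dE mulf_neq0 //; last by rewrite gt_eqF.
    by apply: contraTneq isT => s0; move: sg2; rewrite s0 mul0r.
  move: e0 e1; rewrite !dotE => e0 e1.
  rewrite [w]surjective_pairing [RHS]surjective_pairing; apply/eqP; rewrite xpair_eqE.
  apply/andP; split; apply/eqP/(mulfI d1); rewrite /det2.
    transitivity ((w.1 * (v 0).1 + w.2 * (v 0).2) * (v 1).2 -
      (w.1 * (v 1).1 + w.2 * (v 1).2) * (v 0).2); first by ring.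
    by rewrite e0 e1; ring.
  transitivity ((w.1 * (v 1).1 + w.2 * (v 1).2) * (v 0).1 -
    (w.1 * (v 0).1 + w.2 * (v 0).2) * (v 1).1); first by ring.
  by rewrite e0 e1; ring.
case: xi_irr => _ nu _; case: nu.
have E : xi = cst (cf xi u) * mon u.
  have le : (supp xi `<=` [fset u])%fset.
    by apply/fsubsetP => w /sub ->; rewrite inE.
  by rewrite [LHS](gmEw le) big_seq_fset1.
exists (cst (cf xi u)^-1 * mon (- u)).
by rewrite {1}E mulrACA -rmorphM -monD subrr mon0 mulr1 mulfV ?rmorph1 // -supp_cf.
Qed.

Lemma insec_not_div a f : insec a f -> sz a < 0 -> f = 0.
Proof.
move=> af s0; apply/eqP; apply: contraTT s0 => /eqP f0.
by rewrite -leNgt; apply: insec_size f0.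
Qed.

Definition idl f g := exists x y, g = f * x + xi * y.

Lemma idl_ideal f : is_ideal (idl f).
Proof.
split=> [|_ _ [x [y ->]] [x' [y' ->]]|g _ [x [y ->]]].
- by exists 0, 0; rewrite !mulr0 addr0.
- by exists (x + x'), (y + y'); rewrite !mulrDr addrACA.
by exists (g * x), (g * y); rewrite mulrDr !(mulrCA g).
Qed.

Lemma prime_cancel f g : ~ gdvd xi f -> gdvd xi (f * g) -> gdvd xi g.
Proof. by move=> nf /(girreducible_prime xi_irr)[]. Qed.

(* A family completed by [f x^u] and [xi x^u]; dropping the [u] in the shift by
   the lowest monomial [mu] of [xi] makes the [x^u] independent modulo [xi]. *)
Lemma indep_count a b f n (z : 'I_n -> A) : ~ gdvd xi f -> insec b f ->
  indep cst (idl f) z -> (forall i, insec a (z i)) ->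
  (n + #|` lat v (a - b)%R| + #|` lat v (a + c)%R| <=
   #|` lat v a| + #|` lat v (a - b + c)%R|)%N.
Proof.
move=> nf bf zi az.
have [mu mul] := lowest_ex (1, 0) (introN eqP xi_neq0).
pose sh : {fset lattice} := [fset (mu + u)%R | u in lat v (a - b + c)%R]%fset.
pose B : {fset lattice} := (lat v (a - b)%R `\` sh)%fset.
have shs : (sh `<=` lat v (a - b)%R)%fset.
  apply/fsubsetP => _ /imfsetP[u /= /(mem_latP vok) h ->].
  apply/(mem_latP vok) => i; rewrite dotDl; have := h i.
  have : c i <= dot mu (v i) by case: (xi_ord i) => + _; apply; case: mul.
  have key (x y t p q : int) : t <= p -> - (x - y + t) <= q -> - (x - y) <= p + q by lia.
  rewrite !ffunE; exact: key.
have cB : (#|` B| + #|` lat v (a - b + c)%R| = #|` lat v (a - b)%R|)%N.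
  have csh : #|` sh| = #|` lat v (a - b + c)%R| by rewrite card_imfset //; apply: addrI.
  by rewrite -csh addnC -(cardfsID sh (lat v (a - b)%R)); move/fsetIidPr: shs => ->.
pose F (x : 'I_n + (B + lat v (a + c)%R)) : A := match x with
  | inl i => z i
  | inr y => match y with inl x => f * mon (val x) | inr x => xi * mon (val x) end end.
pose w (x : lat v a) := mon (val x).
have Fa x : insec a (F x).
  case: x => [i|[x|x]]; first exact: az.
    have xa : insec (a - b) (mon (val x)).
      by apply/insec_mon; have := valP x; rewrite /B in_fsetD => /andP[].
    by have := insecM bf xa; rewrite addrC subrK.
  have xa : insec (a + c) (mon (val x)) by apply/insec_mon; apply: valP.
  by have := insecM insec_xi xa; rewrite addrC addrK.
have Fi : indep cst (fun g => g = 0) F.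
  move=> l; pose l1 i := l (inl i); pose l2 x := l (inr (inl x)).
  pose l3 x := l (inr (inr x)).
  pose g := lincomb cst (fun x : B => mon (val x)) l2.
  pose q := lincomb cst (fun x : lat v (a + c)%R => mon (val x)) l3.
  have -> : lincomb cst F l = lincomb cst z l1 + (f * g + xi * q).
    rewrite /lincomb !big_sumType /= /g /q /lincomb !mulr_sumr.
    by congr (_ + (_ + _)); apply: eq_bigr => x _; rewrite mulrCA.
  move=> E.
  have l10 : forall i, l1 i = 0.
    apply: zi; exists (- g), (- q); rewrite !mulrN -opprD.
    by apply/eqP; rewrite -addr_eq0 E.
  have z0 : lincomb cst z l1 = 0.
    by rewrite /lincomb big1 // => i _; rewrite l10 rmorph0 mul0r.
  move: E; rewrite z0 add0r => E.
  have [g' gE] : gdvd xi g.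
    apply: (prime_cancel nf); exists (- q); rewrite mulrN.
    by apply/eqP; rewrite -addr_eq0 E.
  have ga : insec (a - b) g.
    apply: insec_lincomb => x; apply/insec_mon.
    by have := valP x; rewrite /B in_fsetD => /andP[].
  have g0 : g = 0.
    apply: contrapT => g0; have g'0 : g' != 0.
      by apply/eqP => e; apply: g0; rewrite gE e mulr0.
    have [w' wl] := lowest_ex (1, 0) g'0.
    have n0 : ((1, 0) : lattice) != 0 by [].
    have [wg _] := lowestM n0 mul wl; rewrite -gE in wg.
    have := supp_lincomb_mon wg; rewrite /B in_fsetD => /andP[+ _].
    apply/negP; rewrite negbK; apply/imfsetP; exists w' => //=.
    have := ga; rewrite gE => /insec_div /insec_supp; apply; by case: wl.
  have q0 : q = 0.
    by move: E; rewrite g0 mulr0 add0r => /laurent_mulf_eq0[/xi_neq0|].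
  case=> [i|[x|x]]; first exact: l10.
    exact: (mon_indep g0 x).
  exact: (mon_indep q0 x).
have id0 : is_ideal (fun g : A => g = 0).
  by split=> // [? ? -> ->|? ? ->]; rewrite ?addr0 ?mulr0.
have := @steinitz k A cst (fun g => g = 0) _ _ F w id0 Fi.
have Fw x : exists l, F x - lincomb cst w l = 0.
  by have [l ->] := insec_span (Fa x); exists l; rewrite subrr.
move=> /(_ Fw); rewrite !card_sum card_ord -!cardfE; lia.
Qed.

End Sections.

Lemma indep_reindex (k : fieldType) (A : comNzRingType) (c : {rmorphism k -> A})
    (S : A -> Prop) (I : finType) (z : I -> A) :
  indep c S z -> indep c S (fun i : 'I_#|I| => z (enum_val i)).
Proof.
move=> zi l; have -> : lincomb c (fun i : 'I_#|I| => z (enum_val i)) l =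
    lincomb c z (fun x => l (enum_rank x)).
  rewrite /lincomb (reindex_onto enum_rank enum_val) /=; last first.
    by move=> i _; rewrite enum_valK.
  by apply: eq_big => x; rewrite ?enum_rankK ?eqxx.
by move=> /zi h i; rewrite -(enum_valK i).
Qed.

(** * Jets at the identity of the torus *)

Section Jets.
Variables (k : closedFieldType) (A : gmodel k lattice).
Implicit Types (f g h : A) (u w : lattice).
Local Notation mon := (@gmon k _ A).
Local Notation cst := (@gcst k _ A).
Local Notation X := (gX A).
Local Notation Y := (gY A).

Lemma in_mp_ideal r : is_ideal (@in_mp k A r).
Proof.
split; [exact: in_mp_zero | exact: in_mpD | exact: in_mpMl].
Qed.

Definition jmon (p : nat * nat) : A := (X - 1) ^+ p.1 * (Y - 1) ^+ p.2.

Lemma nonneg_jmon p : nonneg (jmon p).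
Proof. by apply: nonnegM; apply: nonnegX; [exact: nonneg_X1|exact: nonneg_Y1]. Qed.

Lemma taylor_jmon p : taylor (jmon p) = mon (p.1%:Z, p.2%:Z).
Proof.
rewrite /taylor /jmon substM; try by apply: nonnegX; [exact: nonneg_X1|exact: nonneg_Y1].
- rewrite !substX; [|exact: nonneg_Y1|exact: nonneg_X1].
  rewrite !substD !substN !subst1 subst_gX subst_gY.
  by rewrite ![1 + _]addrC !addrK mon_nonneg.
- by apply: nonnegX; exact: nonneg_X1.
by apply: nonnegX; exact: nonneg_Y1.
Qed.

Lemma taylorD f g : taylor (f + g) = taylor f + taylor g.
Proof. exact: substD. Qed.

Lemma taylor_lincomb (I : finType) (e : I -> nat * nat) (l : I -> k) :
  taylor (lincomb cst (fun x => jmon (e x)) l) =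
  \sum_x cst (l x) * mon ((e x).1%:Z, (e x).2%:Z).
Proof.
rewrite /lincomb /taylor subst_sum; apply: eq_bigr => x _.
rewrite substM; [|exact: nonneg_cst|exact: nonneg_jmon].
by rewrite subst_cst; congr (_ * _); exact: taylor_jmon.
Qed.

Lemma nonneg_lincomb (I : finType) (e : I -> nat * nat) (l : I -> k) :
  nonneg (lincomb cst (fun x => jmon (e x)) l).
Proof.
apply: nonneg_sum => x; apply: nonnegM; [exact: nonneg_cst|exact: nonneg_jmon].
Qed.

Lemma jet_indep (I : finType) (e : I -> nat * nat) r : injective e ->
  (forall x, ((e x).1 + (e x).2 < r)%N) ->
  indep cst (@in_mp k A r) (fun x => jmon (e x)).
Proof.
move=> einj er l /(me_taylor _ (@nonneg_lincomb _ e l)); rewrite taylor_lincomb => h x.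
have cE : cf (\sum_x cst (l x) * mon ((e x).1%:Z, (e x).2%:Z)) ((e x).1%:Z, (e x).2%:Z) = l x.
  rewrite cf_sum (bigD1 x) //= cf_gmono eqxx big1 ?addr0 ?mulr1n // => y yx.
  rewrite cf_gmono; case: eqP => // -[E1 E2]; case/negP: yx; apply/eqP/einj.
  by rewrite [LHS]surjective_pairing E1 E2 -surjective_pairing.
apply/eqP; apply: contraT => lx; have := h ((e x).1%:Z, (e x).2%:Z).
rewrite supp_cf cE lx => /(_ isT); rewrite dotE /= !mulr1 -PoszD lez_nat.
by rewrite leqNgt er.
Qed.

(** Indexes the standard basis of the functions modulo the [n]-th power of the maximal ideal of
    [e]. *)
Definition tri n : finType := {p : 'I_n * 'I_n | (p.1 + p.2 < n)%N}.

Definition tri_exp n (p : tri n) : nat * nat := ((val p).1 : nat, (val p).2 : nat).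

Lemma jet_nonneg n g : nonneg g -> exists l : tri n -> k,
  in_mp n (g - lincomb cst (fun p => jmon (tri_exp p)) l).
Proof.
move=> g0; exists (fun p => cf (taylor g) ((tri_exp p).1%:Z, (tri_exp p).2%:Z)).
set L := lincomb _ _ _.
have L0 : nonneg L by apply: nonneg_lincomb.
have gL0 : nonneg (g - L) by apply: nonnegD => //; apply: nonnegN.
apply/(me_taylor n gL0); rewrite taylorD /taylor substN -!/(taylor _) => w wF.
have w0 : 0 <= w.1 /\ 0 <= w.2.
  case: (suppD wF); first exact: nonneg_taylor.
  by rewrite suppN; apply: nonneg_taylor.
rewrite leNgt; apply/negP; rewrite dotE /= !mulr1 => wn; case: w0 => w1 w2.
move: wF; rewrite supp_cf cfD cfN taylor_lincomb; apply/negP; rewrite negbK subr_eq0.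
have l1 : (`|w.1| < n)%N by lia.
have l2 : (`|w.2| < n)%N by lia.
have l3 : ((Ordinal l1, Ordinal l2).1 + (Ordinal l1, Ordinal l2).2 < n)%N by rewrite /=; lia.
pose p : tri n := exist _ (Ordinal l1, Ordinal l2) l3.
have pw : ((tri_exp p).1%:Z, (tri_exp p).2%:Z) = w.
  by rewrite [RHS]surjective_pairing /= !gez0_abs.
apply/eqP; symmetry; rewrite cf_sum (bigD1 p) // cf_gmono pw eqxx mulr1n big1 => [|q qp]; first exact: addr0.
rewrite cf_gmono -pw; case: eqP => // -[E1 E2]; case/negP: qp; apply/eqP/val_inj.
rewrite [LHS]surjective_pairing; congr (_, _); exact/val_inj.
Qed.

Lemma in_mp1 u : 0 <= u.1 -> 0 <= u.2 -> in_mp 1 (1 - mon u).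
Proof.
move=> u1 u2; have u0 : nonneg (mon u) by apply: nonneg_mon.
have n1 : nonneg (1 - mon u) by apply: nonnegD; [exact: nonneg1|exact: nonnegN].
apply/(me_taylor 1 n1) => w wF.
have [w1 w2] := nonneg_taylor wF; rewrite dotE /= !mulr1.
suff : w <> 0.
  move=> wn0; have : w.1 <> 0 \/ w.2 <> 0.
    apply: contrapT => /not_orP[/contrapT e1 /contrapT e2]; apply: wn0.
    by rewrite [LHS]surjective_pairing e1 e2.
  by case; lia.
move=> w0; move: wF; rewrite w0 supp_cf taylorD {2}/taylor substN /taylor subst1 -/(taylor _).
rewrite cfD cfN -(mon0 A) cf_mon eqxx.
have tn : nonneg (taylor (mon u)) by apply: nonneg_taylor.
suff -> : cf (taylor (mon u)) 0 = 1 by rewrite subrr eqxx.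
have cM f g : nonneg f -> nonneg g -> cf f 0 = 1 -> cf g 0 = 1 -> cf (f * g) 0 = 1.
  move=> f0 g0 cf1 cg1; rewrite cfM.
  have sf : (0 : lattice) \in supp f by rewrite supp_cf cf1 oner_eq0.
  have sg : (0 : lattice) \in supp g by rewrite supp_cf cg1 oner_eq0.
  rewrite (big_fsetD1 _ sf) (big_fsetD1 _ sg) /= cf1 cg1 mulr1 mulr1n.
  rewrite [X in _ + X + _]big_seq big1 ?addr0 => [|b]; last first.
    by rewrite !inE add0r => /andP[/negbTE -> _].
  rewrite big_seq big1 ?addr0 // => a; rewrite !inE => /andP[a0 /f0[a1 a2]].
  rewrite big_seq big1 // => b /g0[b1 b2]; case: eqP => // E; case/negP: a0.
  have e1 : a.1 + b.1 = 0 by rewrite -[LHS]/((a + b).1) E.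
  have e2 : a.2 + b.2 = 0 by rewrite -[LHS]/((a + b).2) E.
  have key (x y : int) : 0 <= x -> 0 <= y -> x + y = 0 -> x = 0 by lia.
  by rewrite [a]surjective_pairing (key _ _ a1 b1 e1) (key _ _ a2 b2 e2).
have cX f n : nonneg f -> cf f 0 = 1 -> cf (f ^+ n) 0 = 1.
  move=> f0 cf1; elim: n => [|n IH]; first by rewrite expr0 -(mon0 A) cf_mon eqxx.
  by rewrite exprS; apply: cM => //; apply: nonnegX.
rewrite /taylor subst_mon; apply: cM; try by apply: nonnegX; [exact: nonneg_1X|exact: nonneg_1Y].
- by apply: nonnegX; exact: nonneg_1X.
- by apply: nonnegX; exact: nonneg_1Y.
- apply: cX; first exact: nonneg_1X.
  by rewrite cfD -(mon0 A) !cf_mon eqxx addr0.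
apply: cX; first exact: nonneg_1Y.
by rewrite cfD -(mon0 A) !cf_mon eqxx addr0.
Qed.

(** A monomial [x^u] clearing the denominators of [f] is invertible modulo the [n]-th power of the
    maximal ideal, the truncated geometric series [e] in [1 - x^u] being an inverse. So [f] may be
    replaced by the polynomial [e * (x^u * f)]. *)
Lemma jet_ex n f : exists l : tri n -> k,
  in_mp n (f - lincomb cst (fun p => jmon (tri_exp p)) l).
Proof.
have [u [u1 u2 uf]] := shift_nonneg_ge f.
have nf := uf u (lexx _) (lexx _).
pose e := \sum_(j < n) (1 - mon u) ^+ j.
have n1 : nonneg (1 - mon u).
  by apply: nonnegD; [exact: nonneg1|apply: nonnegN; apply: nonneg_mon].
have ne : nonneg e by apply: nonneg_sum => j; apply: nonnegX.
have [l lP] := jet_nonneg n (nonnegM ne nf); exists l.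
rewrite -[f](subrK (e * (mon u * f))) -addrA; apply: in_mpD lP.
have eE : mon u * e = 1 - (1 - mon u) ^+ n.
  by rewrite -[X in X - _](expr1n _ n) subrXX opprB addrC subrK; congr (_ * _);
     apply: eq_bigr => j _; rewrite expr1n mul1r.
have -> : f - e * (mon u * f) = f * (1 - mon u) ^+ n.
  by rewrite mulrCA mulrA eE mulrBl mul1r opprB addrC subrK mulrC.
apply: in_mpMl; have := in_mpX n (in_mp1 u1 u2); by rewrite muln1.
Qed.

End Jets.

(** * Powers of a section modulo the curve *)

Section Powers.
Variables (k : closedFieldType) (A : gmodel k lattice) (v : fan3).
Hypothesis vok : good_fan v.
Variables (xi : A) (c : {ffun 'I_3 -> int}) (m : nat).
Hypothesis xi_irr : girreducible xi.
Hypothesis xi_ord : forall i, ord_eq (v i) xi (c i).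
Hypothesis xi_mult : mult_eq xi m.
Hypothesis m_gt0 : (0 < m)%N.
Implicit Types (f g : A) (u w : lattice) (a b d : {ffun 'I_3 -> int}).
Local Notation mon := (@gmon k _ A).
Local Notation cst := (@gcst k _ A).
Local Notation sz := (size_div v).
Local Notation kap := (kappa v c).
Local Notation idl := (idl xi).

(** A Bezout bound on the dimension of [k[T] / (xi, f)]. The four counts in [indep_count] are
    compared by the asymptotics for [c] at [a] and at [a - b]; the terms in [sz a] cancel, and the
    error depends on [c] alone. *)
Lemma indep_bound : exists2 K : int, 0 <= K &
  forall b f (I : finType) (z : I -> A), ~ gdvd xi f -> insec v b f ->
    indep cst (idl f) z -> wprod v * #|I|%:Z <= kap * sz b + K.
Proof.
have [K K0 KP] := lat_asymp_all vok c; exists (K + K); first exact: addr_ge0.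
move=> b f I z nf bf zi; pose z' (i : 'I_#|I|) := z (enum_val i).
have zi' : indep cst (idl f) z' by apply: indep_reindex.
have [a [aK za]] := insec_large vok z' (K + `|sz b|).
have nb := ler_norm (sz b); have nb0 := normr_ge0 (sz b).
have := indep_count vok xi_irr xi_ord nf bf zi' za.
have h1 := KP a ltac:(lia); have sab : sz (a - b) = sz a - sz b by rewrite size_divB.
have h2 := KP (a - b) ltac:(rewrite sab; lia).
move=> cnt; have {}cnt : #|I|%:Z + #|` lat v (a - b)%R|%:Z + #|` lat v (a + c)%R|%:Z <=
    #|` lat v a|%:Z + #|` lat v (a - b + c)%R|%:Z by lia.
have := ler_wpM2l (ltW (wprod_gt0 vok)) cnt; rewrite !mulrDr => {}cnt.
have kE x : kap * x = - (sz c * x) by rewrite /kappa mulNr.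
move: h1 h2; rewrite sab mulrBr kE; move: cnt.
move: (wprod v * _) (wprod v * _) (wprod v * _) (wprod v * _) (wprod v * _).
move=> p q r s t; move: (sz c * sz a) (sz c * sz b) => x y; lia.
Qed.

Lemma gdvd_powN p n : ~ gdvd xi p -> ~ gdvd xi (p ^+ n).
Proof.
move=> np; elim: n => [[q e]|n IH]; last first.
  by rewrite exprS => /(prime_cancel xi_irr np).
by case: xi_irr => _ + _; apply; exists q.
Qed.

Lemma idl_cancel p n g : ~ gdvd xi p -> idl (p ^+ n.+1) (p * g) -> idl (p ^+ n) g.
Proof.
move=> np [x [y E]].
have [y' yE] : gdvd xi (g - p ^+ n * x).
  apply: (prime_cancel xi_irr np); exists y.
  by rewrite mulrBr E exprS -mulrA addrAC subrr add0r.
by exists x, y'; rewrite -yE addrC subrK.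
Qed.

(** Modulo [p] only the coefficients of [p ^+ 0] survive, so they vanish; [p] then cancels modulo
    [xi], which is prime, and the next power follows. *)
Lemma indep_pow p (I : finType) (z : I -> A) N : ~ gdvd xi p ->
  indep cst (idl p) z ->
  indep cst (idl (p ^+ N)) (fun x : I * 'I_N => z x.1 * p ^+ x.2).
Proof.
move=> np zi; suff key (l : I -> nat -> k) :
    idl (p ^+ N) (\sum_i \sum_(j < N) cst (l i j) * (z i * p ^+ j)) ->
    forall i j, (j < N)%N -> l i j = 0.
  move=> l h [i j]; pose l' i j := if insub j is Some o then l (i, o) else 0.
  have lE (i' : I) (o : 'I_N) : l (i', o) = l' i' o by rewrite /l' valK.
  rewrite lE; apply: key (ltn_ord j); move: h; rewrite /lincomb.
  rewrite [X in _ (X)](_ : _ = \sum_i \sum_(j < N) cst (l' i j) * (z i * p ^+ j)) //.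
  by rewrite pair_bigA /=; apply: eq_bigr => -[i' o] _; rewrite lE.
elim: N l => [//|N IH] l.
have -> : \sum_i \sum_(j < N.+1) cst (l i j) * (z i * p ^+ j) =
    lincomb cst z (fun i => l i 0%N) +
    p * (\sum_i \sum_(j < N) cst (l i j.+1) * (z i * p ^+ j)).
  rewrite mulr_sumr -big_split /=; apply: eq_bigr => i _.
  rewrite big_ord_recl expr0 mulr1 mulr_sumr; congr (_ + _); apply: eq_bigr => j _.
  by rewrite exprS !(mulrCA p).
set Z := \sum_i _ => -[x [y E]].
have l0 : forall i, l i 0%N = 0.
  apply: zi; exists (p ^+ N * x - Z), y; apply: (addIr (p * Z)).
  by rewrite E mulrBr mulrA -exprS [RHS]addrAC subrK.
move=> i [_|j]; first exact: l0.
rewrite ltnS; move: i j; apply: (IH (fun i j => l i j.+1)).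
have z0 : lincomb cst z (fun i => l i 0%N) = 0.
  by rewrite /lincomb big1 // => i _; rewrite l0 rmorph0 mul0r.
by apply: (idl_cancel np); exists x, y; rewrite -E z0 add0r.
Qed.

Variables (h : A) (bh : {ffun 'I_3 -> int}) (t : nat).
Hypothesis h_nd : ~ gdvd xi h.
Hypothesis h_sec : insec v bh h.
Hypothesis h_me : in_mp t h.
Hypothesis t_gt0 : (0 < t)%N.
Hypothesis h_neg : kap * sz bh <= wprod v * (m * t)%N%:Z.

(** Replacing [h ^+ n] by [h ^+ (n * N)] multiplies the family and the main term of [indep_bound] by
    [N] but leaves [K] unchanged; any [N > K] removes it. *)
Lemma indep_pow_card n (I : finType) (z : I -> A) :
  indep cst (idl (h ^+ n)) z -> (#|I| <= n * (m * t))%N.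
Proof.
move=> zi; have [K K0 KP] := indep_bound.
have nd := gdvd_powN (n := n) h_nd.
have bound (N : nat) : wprod v * (#|I| * N)%N%:Z <= wprod v * (m * t)%N%:Z * (n * N)%N%:Z + K.
  have zN := indep_pow (N := N) nd zi; rewrite -exprM in zN.
  have := KP _ _ _ _ (gdvd_powN (n := (n * N)%N) h_nd) (insecX (n := (n * N)%N) h_sec) zN.
  rewrite card_prod card_ord => le; apply: (le_trans le); rewrite lerD2r size_divMn.
  by rewrite -mulr_natr mulrA natz ler_wpM2r.
rewrite leqNgt; apply/negP => lt.
have := bound (absz K).+1; apply/negP; rewrite -ltNge.
have w1 : 1 <= wprod v by have := wprod_gt0 vok; lia.
set N := (absz K).+1.
have : wprod v * ((n * (m * t)).+1 * N)%N%:Z <= wprod v * (#|I| * N)%N%:Z.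
  by rewrite ler_pM2l ?wprod_gt0 // lez_nat leq_mul2r lt orbT.
apply: lt_le_trans.
have -> : wprod v * ((n * (m * t)).+1 * N)%N%:Z =
    wprod v * (m * t)%N%:Z * (n * N)%N%:Z + wprod v * N%:Z.
  by rewrite mulSn PoszD !PoszM; ring.
rewrite ltrD2l; apply: (lt_le_trans (y := N%:Z)); first by rewrite /N; lia.
by rewrite ler_peMl.
Qed.

(** The local intersection multiplicity of [h ^+ n] and [xi] at [e] is at least the product of their
    orders. Modulo order [(n * t + m).-1] this is a count of jets: the cofactor of [h ^+ n] matters
    only up to order [m.-1], that of [xi] only up to order [(n * t).-1]. *)
Lemma pow_family n : (0 < n)%N -> exists D (z : 'I_D -> A), (m * (n * t) <= D)%N /\
  indep cst (fun g => exists x y (w : A),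
    g = h ^+ n * x + xi * y + w /\ in_mp (n * t + m).-1 w) z.
Proof.
move=> n0; set r := (n * t + m).-1; pose p := h ^+ n; set T := (n * t)%N.
have T0 : (0 < T)%N by rewrite muln_gt0 n0.
pose S g := exists x y (w : A), g = p * x + xi * y + w /\ in_mp r w.
have Sid : is_ideal S.
  split.
  - by exists 0, 0, 0; rewrite !mulr0 !addr0; split=> //; apply: in_mp_zero.
  - move=> _ _ [x [y [w [-> wr]]]] [x' [y' [w' [-> wr']]]].
    by exists (x + x'), (y + y'), (w + w'); split; [ring|exact: in_mpD].
  move=> g _ [x [y [w [-> wr]]]]; exists (g * x), (g * y), (g * w).
  by split; [ring|exact: in_mpMl].
have [D [z [zi zspan]]] : exists n' (z : 'I_n' -> A), indep cst S z /\
    forall f, exists l : 'I_n' -> k, S (f - lincomb cst z l).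
  apply: (max_indep (B := (n * (m * t))%N) Sid) => n' z zi.
  rewrite -[n']card_ord; apply: indep_pow_card; apply: indep_sub zi => g [x [y E]].
  by exists x, y, 0; rewrite addr0; split=> //; apply: in_mp_zero.
have pT : in_mp T p by rewrite /p /T; apply: in_mpX.
have D_ge : (m * T <= D)%N.
  (* The exponents of degree below [r] are split into a rectangle of [m * T] exponents and two
     triangles. The triangles have the same sizes as the two families of multiples of [xi] and [p]
     in [w] below, so the rectangle is left for [z]. *)
  pose e (x : ('I_m * 'I_T) + (tri T.-1 + tri m.-1)) : nat * nat := match x with
    | inl (i, j) => (i : nat, j : nat)
    | inr (inl p) => ((m + (tri_exp p).1)%N, (tri_exp p).2)
    | inr (inr p) => ((tri_exp p).1, (T + (tri_exp p).2)%N) end.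
  have triP n' (p' : tri n') : ((tri_exp p').1 + (tri_exp p').2 < n')%N by apply: (valP p').
  have tri_inj n' (p1 p2 : tri n') : tri_exp p1 = tri_exp p2 -> p1 = p2.
    move=> [e1 e2]; apply: val_inj; rewrite [LHS]surjective_pairing [RHS]surjective_pairing.
    by congr (_, _); apply: val_inj.
  have einj : injective e.
    move=> [[i j]|[p1|p1]] [[i' j']|[p2|p2]] //= [E1 E2].
    - by congr (inl (_, _)); apply: val_inj.
    - by have := ltn_ord i; rewrite E1; lia.
    - by have := ltn_ord j; rewrite E2; lia.
    - by have := ltn_ord i'; rewrite -E1; lia.
    - by congr (inr (inl _)); apply: tri_inj; rewrite /tri_exp (addnI E1) E2.
    - by have := triP _ p2; rewrite /tri_exp /= -E1; lia.
    - by have := ltn_ord j'; rewrite -E2; lia.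
    - by have := triP _ p1; rewrite /tri_exp /= E1; lia.
    by congr (inr (inr _)); apply: tri_inj; rewrite /tri_exp E1 (addnI E2).
  have er x : ((e x).1 + (e x).2 < r)%N.
    rewrite /r; case: x => [[i j]|[p1|p1]] /=.
    - by have := ltn_ord i; have := ltn_ord j; lia.
    - by have := triP _ p1; rewrite /tri_exp /=; lia.
    by have := triP _ p1; rewrite /tri_exp /=; lia.
  have ei := jet_indep (A := A) einj er.
  pose w (x : 'I_D + (tri m.-1 + tri T.-1)) : A := match x with
    | inl i => z i
    | inr (inl q) => p * jmon A (tri_exp q)
    | inr (inr q) => xi * jmon A (tri_exp q) end.
  have sp x : exists l, in_mp r (jmon A (e x) - lincomb cst w l).
    have [l1 [x1 [y1 [w1 [E w1r]]]]] := zspan (jmon A (e x)).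
    have [l2 l2P] := jet_ex m.-1 x1; have [l3 l3P] := jet_ex T.-1 y1.
    exists (fun x => match x with inl i => l1 i | inr (inl q) => l2 q | inr (inr q) => l3 q end).
    have -> : lincomb cst w (fun x => match x with
        inl i => l1 i | inr (inl q) => l2 q | inr (inr q) => l3 q end) =
      lincomb cst z l1 + (p * lincomb cst (fun q => jmon A (tri_exp q)) l2 +
        xi * lincomb cst (fun q => jmon A (tri_exp q)) l3).
      rewrite /lincomb !big_sumType /= !mulr_sumr.
      by congr (_ + (_ + _)); apply: eq_bigr => q _; rewrite mulrCA.
    rewrite opprD addrA E.
    move: l2P l3P; set L2 := lincomb _ _ l2; set L3 := lincomb _ _ l3 => l2P l3P.
    have -> : p * x1 + xi * y1 + w1 - (p * L2 + xi * L3) =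
      p * (x1 - L2) + xi * (y1 - L3) + w1 by ring.
    apply: in_mpD w1r; apply: in_mpD.
      by have := in_mpM pT l2P; congr (in_mp _ _); rewrite /r; lia.
    by have := in_mpM (proj1 xi_mult) l3P; congr (in_mp _ _); rewrite /r; lia.
  have := steinitz (in_mp_ideal A r) ei sp.
  by rewrite !card_sum card_prod !card_ord; lia.
by exists D, z.
Qed.

(** Otherwise [f] could be added to the family of [pow_family], which already has the largest size
    allowed by [indep_pow_card]. *)
Lemma me_idl n f : (0 < n)%N -> in_mp (n * t + m).-1 f -> idl (h ^+ n) f.
Proof.
move=> n0 fr; have [D [z [D_ge zi]]] := pow_family n0.
apply: contrapT => nf.
pose z' (x : 'I_D + 'I_1) : A := if x is inl i then z i else f.
suff zi' : indep cst (idl (h ^+ n)) z'.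
  by have := indep_pow_card zi'; rewrite card_sum !card_ord; lia.
move=> l; rewrite /lincomb big_sumType big_ord1 /= => -[x [y E]].
have l0 i : l (inl i) = 0.
  move: i; apply: zi; exists x, y, (- (cst (l (inr ord0)) * f)); split.
    by rewrite -E addrK.
  by rewrite -mulNr; apply: in_mpMl.
have lN : l (inr ord0) = 0.
  apply/eqP; apply: contra_notT nf => lN.
  exists (cst (l (inr ord0))^-1 * x), (cst (l (inr ord0))^-1 * y).
  have s0 : \sum_i cst (l (inl i)) * z i = 0.
    by rewrite big1 // => i _; rewrite l0 rmorph0 mul0r.
  rewrite !(mulrCA _ (cst _)) -mulrDr -E s0 add0r.
  by rewrite mulrA -rmorphM mulVf // rmorph1 mul1r.
by case=> [i|i]; rewrite ?l0 ?(ord1 i).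
Qed.

(** The ideal [(f, xi)] is contained in [(h ^+ n, xi)], so the family of [pow_family] stays
    independent modulo it and [indep_bound] applies to [f]. *)
Lemma idl_pow_size : exists2 K : int, 0 <= K & forall b f n, ~ gdvd xi f ->
  insec v b f -> idl (h ^+ n) f -> wprod v * (m * (n * t))%N%:Z <= kap * sz b + K.
Proof.
have [K K0 KP] := indep_bound; exists K => // b f n nf bf [x [y E]].
have [->|n0] := posnP n.
  rewrite muln0 mulr0; apply: addr_ge0 => //; apply: mulr_ge0.
    exact: ltW (kap_gt0 vok xi_irr xi_ord).
  apply: (insec_size vok bf) => f0; apply: nf; rewrite f0; exact: gdvd0.
have [D [z [D_ge zi]]] := pow_family n0.
have zf : indep cst (idl f) z.
  apply: indep_sub zi => g [x' [y' ->]]; exists (x * x'), (y * x' + y'), 0.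
  by rewrite E addr0; split; [ring|exact: in_mp_zero].
apply: le_trans (KP _ _ _ _ nf bf zf).
by rewrite card_ord ler_pM2l ?wprod_gt0 // lez_nat.
Qed.

End Powers.

(** * Dickson's lemma *)

Definition finite_basis (T : eqType) (le : T -> T -> Prop) :=
  forall P : T -> Prop, exists2 s : seq T, (forall x, x \in s -> P x) &
    forall x, P x -> exists2 y, y \in s & le y x.

Lemma finite_basis_fin (I : finType) : finite_basis (T := I) eq.
Proof.
move=> P; exists [seq x <- enum I | `[< P x >]] => x.
  by rewrite mem_filter => /andP[/asboolP].
by move=> Px; exists x => //; rewrite mem_filter mem_enum andbT; apply/asboolP.
Qed.

(* Dickson's lemma, one coordinate at a time. *)
Lemma finite_basis_nat (T : eqType) (le : T -> T -> Prop) : finite_basis le ->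
  finite_basis (T := (T * nat)%type) (fun p q => le p.1 q.1 /\ (p.2 <= q.2)%N).
Proof.
move=> fb P.
have [s sP sB] := fb (fun x => exists n, P (x, n)).
have [nn nnP] : exists nn : T -> nat, forall x, x \in s -> P (x, nn x).
  suff /choice[nn nnP] : forall x : T, exists n : nat, x \in s -> P (x, n) by exists nn.
  move=> x; case: (boolP (x \in s)) => [/sP[n Pn]|]; first by exists n.
  by exists 0%N.
have /choice[sn snP] : forall n : nat, exists s : seq T, (forall x, x \in s -> P (x, n)) /\
    forall x, P (x, n) -> exists2 y, y \in s & le y x.
  by move=> n; have [s' h1 h2] := fb (fun x => P (x, n)); exists s'.
pose N := \max_(x <- s) nn x.
exists ([seq (x, nn x) | x <- s] ++ [seq (x, n) | n <- iota 0 N, x <- sn n]) => x.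
  rewrite mem_cat => /orP[/mapP[y ys ->]|/allpairsPdep[n [y [_ yn ->]]]].
    exact: nnP.
  by case: (snP n) => + _; apply.
case: x => x n Pxn; have [nN|Nn] := ltnP n N.
  have [y ysn yx] := (proj2 (snP n)) _ Pxn; exists (y, n) => //.
  rewrite mem_cat; apply/orP; right; apply/allpairsPdep; exists n, y.
  by rewrite mem_iota.
have [|y ys yx] := sB x; first by exists n.
exists (y, nn y); first by rewrite mem_cat map_f.
by split=> //=; apply: leq_trans Nn; rewrite /N (big_rem y) //= leq_maxl.
Qed.

Lemma lattice_muln (x y : int) n : ((x, y) : lattice) *+ n = (x * n%:Z, y * n%:Z).
Proof.
elim: n => [|n IH]; first by rewrite mulr0n !mulr0.
by rewrite mulrS IH; apply/eqP; rewrite xpair_eqE /= !intS !mulrDr !mulr1 !eqxx.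
Qed.

(** * Existence of a witness implies finite generation *)

Section Cox.
Variables (k : closedFieldType) (A : gmodel k lattice) (v : fan3).
Variable B : gmodel A bdiv.
Implicit Types (f g : A) (u w : lattice) (D E : bdiv) (F : B).
Local Notation mon := (@gmon k _ A).
Local Notation cst := (@gcst k _ A).

Definition ord_exc f (c : int) := if c is Posz m then in_mp m f else True.

Definition gsection D f :=
  (forall i, ord_ge (v i) f (- D.1 i)) /\ ord_exc f (- D.2).

Definition gin_div F := forall D, gsection D (cf F D).

Definition gchar u : B := gcst B (mon u) * gmon B (- div_char v u).

Definition gin_cox_ideal F :=
  exists2 s : seq (B * lattice), (forall p, p \in s -> gin_div p.1) &
    F = \sum_(p <- s) p.1 * (1 - gchar p.2).

Inductive gsubalg (G : seq B) : B -> Prop :=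
| GScalar (c : k) : gsubalg G (gcst B (cst c))
| GGen F of F \in G : gsubalg G F
| GAdd F F' of gsubalg G F & gsubalg G F' : gsubalg G (F + F')
| GMul F F' of gsubalg G F & gsubalg G F' : gsubalg G (F * F').

Definition gmds := exists2 G : seq B,
  (forall F, F \in G -> gin_div F) &
  forall F, gin_div F -> exists2 F', gsubalg G F' & gin_cox_ideal (F - F').

(* the section [f] of [D], placed in degree [D] of the divisorial algebra *)
Definition tD f D : B := gcst B f * gmon B D.

Lemma tDM f g D E : tD f D * tD g E = tD (f * g) (D + E).
Proof. by rewrite /tD rmorphM monD mulrACA. Qed.

Lemma tDD f g D : tD (f + g) D = tD f D + tD g D.
Proof. by rewrite /tD rmorphD mulrDl. Qed.

Lemma tD0 D : tD 0 D = 0.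
Proof. by rewrite /tD rmorph0 mul0r. Qed.

Lemma tD_cstM c f D : tD (cst c * f) D = gcst B (cst c) * tD f D.
Proof. by rewrite /tD rmorphM mulrA. Qed.

Lemma tDX f D n : tD f D ^+ n = tD (f ^+ n) (D *+ n).
Proof.
elim: n => [|n IH]; last by rewrite !exprS IH tDM mulrS.
by rewrite !expr0 mulr0n /tD rmorph1 mon0 mul1r.
Qed.

Lemma gsection0 D : gsection D 0.
Proof.
split; first by move=> i u; rewrite supp0.
by rewrite /ord_exc; case: (- D.2) => // n; apply: in_mp_zero.
Qed.

Lemma gsection_insec D f : gsection D f -> insec v D.1 f.
Proof. by case. Qed.

Lemma ord_excD f g c : ord_exc f c -> ord_exc g c -> ord_exc (f + g) c.
Proof. by case: c => // n; apply: in_mpD. Qed.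

Lemma ord_excM f g c d : ord_exc f c -> ord_exc g d -> ord_exc (f * g) (c + d).
Proof.
case: c d => [m|m] [n|n] //=; first exact: in_mpM.
- move=> fm _; rewrite /ord_exc; case E : (_ + _) => [r|//].
  by rewrite mulrC; apply: in_mpMl; apply: in_mp_le fm; lia.
move=> _ gn; rewrite /ord_exc; case E : (_ + _) => [r|//].
by apply: in_mpMl; apply: in_mp_le gn; lia.
Qed.

Lemma gsectionM D E f g : gsection D f -> gsection E g ->
  gsection (D + E) (f * g).
Proof.
move=> [f1 f2] [g1 g2]; split=> [i|].
  by rewrite ffunE opprD; apply: ord_geM.
by rewrite /= opprD; apply: ord_excM.
Qed.

Lemma gsectionD D f g : gsection D f -> gsection D g -> gsection D (f + g).
Proof.
move=> [f1 f2] [g1 g2]; split=> [i|]; first exact: ord_geD.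
exact: ord_excD.
Qed.

Lemma gsection_cst c : gsection 0 (cst c).
Proof.
split=> [i|]; first by rewrite ffunE oppr0; apply: ord_ge_cst.
by rewrite /= ?oppr0; apply: in_mp0.
Qed.

Lemma gsection_cstM c D f : gsection D f -> gsection D (cst c * f).
Proof. by move=> h; have := gsectionM (gsection_cst c) h; rewrite add0r. Qed.

Lemma gsection_mon u : gsection (- div_char v u) (mon u).
Proof.
split=> [i|]; first by rewrite !ffunE opprK; apply: ord_ge_mon.
by rewrite /= ?oppr0; apply: in_mp0.
Qed.

Lemma gsectionX D f n : gsection D f -> gsection (D *+ n) (f ^+ n).
Proof.
move=> Df; elim: n => [|n IH].
  by rewrite mulr0n expr0 -(rmorph1 cst); exact: gsection_cst.
by rewrite mulrS exprS; apply: gsectionM.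
Qed.

Lemma gsection_tD D f : gsection D f -> gin_div (tD f D).
Proof.
move=> Df E; rewrite /tD cf_gmono; case: eqP => [<- //|_].
by rewrite mulr0n; apply: gsection0.
Qed.

Lemma gsubalg_sum G I (r : seq I) (P : pred I) (F : I -> B) :
  (forall i, P i -> gsubalg G (F i)) -> gsubalg G (\sum_(i <- r | P i) F i).
Proof.
move=> GF; apply: (big_ind (gsubalg G)) => //; last exact: GAdd.
by have := GScalar G 0; rewrite !rmorph0.
Qed.

Lemma gsubalgX G F n : gsubalg G F -> gsubalg G (F ^+ n).
Proof.
move=> GF; elim: n => [|n IH]; last by rewrite exprS; apply: GMul.
by rewrite expr0; have := GScalar G 1; rewrite !rmorph1.
Qed.

(** Every element is a sum of homogeneous ones, so the divisorial algebra itself is generated and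
    the remainder in the Cox ideal can be taken to be zero. *)
Lemma gmds_of_sections (G : seq B) : (forall F, F \in G -> gin_div F) ->
  (forall D f, gsection D f -> gsubalg G (tD f D)) -> gmds.
Proof.
move=> Gdiv GP; exists G => // F Fd; exists F.
  by rewrite [F]gmE; apply: gsubalg_sum => D _; apply: GP; apply: Fd.
by exists [::] => //; rewrite big_nil subrr.
Qed.

Lemma div_charD u w : div_char v (u + w) = div_char v u + div_char v w.
Proof.
apply/eqP; rewrite xpair_eqE /= addr0 eqxx andbT; apply/eqP/ffunP => i.
by rewrite !ffunE dotDl.
Qed.

Lemma div_charN u : div_char v (- u) = - div_char v u.
Proof.
apply/eqP; rewrite xpair_eqE /= oppr0 eqxx andbT; apply/eqP/ffunP => i.
by rewrite !ffunE dotNl.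
Qed.

Lemma gcharD u w : gchar (u + w) = gchar u * gchar w.
Proof. by rewrite /gchar -!/(tD _ _) tDM -monD div_charD opprD. Qed.

Definition char_gens : seq B :=
  [:: gchar (1, 0); gchar (-1, 0); gchar (0, 1); gchar (0, -1)].

Lemma char_gens_gen G u : (forall F, F \in char_gens -> gsubalg G F) ->
  gsubalg G (gchar u).
Proof.
move=> GF.
have gN w n : gsubalg G (gchar w) -> gsubalg G (gchar (w *+ n)).
  move=> Gw; elim: n => [|n IH]; last by rewrite mulrS gcharD; apply: GMul.
  rewrite mulr0n /gchar -/(tD _ _).
  have -> : div_char v 0 = 0.
    by apply: (addrI (div_char v 0)); rewrite -div_charD !addr0.
  by rewrite oppr0 /tD !mon0 mulr1 rmorph1; have := GScalar G 1; rewrite !rmorph1.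
have gx (z : int) : gsubalg G (gchar (z, 0)).
  have [zp|zn] := lerP 0 z.
    have -> : (z, 0) = (1, 0) *+ absz z :> lattice.
      by rewrite lattice_muln mul0r; apply/eqP; rewrite xpair_eqE eqxx ?andbT; lia.
    by apply: gN; apply: GF; rewrite !inE eqxx.
  have -> : (z, 0) = (-1, 0) *+ absz z :> lattice.
    by rewrite lattice_muln mul0r; apply/eqP; rewrite xpair_eqE eqxx ?andbT; lia.
  by apply: gN; apply: GF; rewrite !inE eqxx ?orbT.
have gy (z : int) : gsubalg G (gchar (0, z)).
  have [zp|zn] := lerP 0 z.
    have -> : (0, z) = (0, 1) *+ absz z :> lattice.
      by rewrite lattice_muln mul0r; apply/eqP; rewrite xpair_eqE eqxx ?andbT; lia.
    by apply: gN; apply: GF; rewrite !inE eqxx ?orbT.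
  have -> : (0, z) = (0, -1) *+ absz z :> lattice.
    by rewrite lattice_muln mul0r; apply/eqP; rewrite xpair_eqE eqxx ?andbT; lia.
  by apply: gN; apply: GF; rewrite !inE eqxx ?orbT.
have -> : u = (u.1, 0) + (0, u.2).
  by rewrite [LHS]surjective_pairing; apply/eqP; rewrite xpair_eqE /= addr0 add0r !eqxx.
by rewrite gcharD; apply: GMul.
Qed.

End Cox.

Section Generation.
Variables (k : closedFieldType) (A : gmodel k lattice) (v : fan3).
Variable B : gmodel A bdiv.
Hypothesis vok : good_fan v.
Variables (xi : A) (c : {ffun 'I_3 -> int}) (m : nat).
Hypothesis xi_irr : girreducible xi.
Hypothesis xi_ord : forall i, ord_eq (v i) xi (c i).
Hypothesis xi_mult : mult_eq xi m.
Hypothesis m_gt0 : (0 < m)%N.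
Implicit Types (f g : A) (u w : lattice) (a b d : {ffun 'I_3 -> int}) (D E : bdiv).
Local Notation mon := (@gmon k _ A).
Local Notation cst := (@gcst k _ A).
Local Notation sz := (size_div v).
Local Notation kap := (kappa v c).
Local Notation idl := (idl xi).

Lemma bdiv_ext D E : D.1 = E.1 -> D.2 = E.2 -> D = E.
Proof. by case: D E => [? ?] [? ?] /= -> ->. Qed.

(* The last condition is [D.C <= 0] for [D = \sum_i a_i D_i - t E]. *)
Definition witness f a t := [/\ ~ gdvd xi f, insec v a f, in_mp t f, (0 < t)%N &
  kap * sz a <= wprod v * (m * t)%N%:Z].

Lemma insec_shift a f u : insec v a f -> insec v (a - vecp v u) (mon u * f).
Proof.
move=> af; rewrite addrC; apply: insecM => // i.
by rewrite !ffunE opprK; apply: ord_ge_mon.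
Qed.

Lemma dot_solve (n1 n2 : int) : exists u, dot u (v 1) = wt v 0 * n1 /\
  dot u (v 2) = wt v 0 * n2.
Proof.
have [sg sg2 /(_ 0)[dE _]] := wt_sign vok; rewrite !ord3E in dE.
have wE : wt v 0 = sg * det2 (v 1) (v 2) by rewrite dE mulrA sg2 mul1r.
exists (sg * (n1 * (v 2).2 - n2 * (v 1).2), sg * (n2 * (v 1).1 - n1 * (v 2).1)).
by rewrite wE !dotE /det2 /=; split; ring.
Qed.

Lemma witness_normal f a t : witness f a t -> exists h b t', [/\ witness h b t',
  b 1 = 0 & b 2 = 0].
Proof.
move=> [nf af ft t0 neg]; set q := absz (wt v 0).
have q0 : wt v 0 = q%:Z by rewrite /q gez0_abs // ltW // wt_gt0.
have q1 : (0 < q)%N by have := wt_gt0 vok 0; rewrite q0.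
have [u [u1 u2]] := dot_solve (a 1) (a 2).
exists (mon u * f ^+ q), (a *+ q - vecp v u), (q * t)%N.
have E i : (a *+ q) i = wt v 0 * a i by rewrite ffunMnE -mulr_natl natz q0.
split; [split | |].
- by move=> /gdvd_mon; apply: gdvd_powN.
- by apply: insec_shift; apply: insecX.
- by apply: in_mpMl; apply: in_mpX.
- by rewrite muln_gt0 q1.
- rewrite size_divB size_vecp // subr0 size_divMn.
  have -> : (m * (q * t))%N%:Z = (m * t)%N%:Z * q%:Z by lia.
  by rewrite -mulr_natr natz !mulrA ler_wpM2r.
- by rewrite !ffunE E u1 subrr.
by rewrite !ffunE E u2 subrr.
Qed.

Variables (h : A) (bh : {ffun 'I_3 -> int}) (t : nat).
Hypothesis h_wit : witness h bh t.
Hypothesis bh1 : bh 1 = 0.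
Hypothesis bh2 : bh 2 = 0.

Let h_nd : ~ gdvd xi h. Proof. by case: h_wit. Qed.
Let h_sec : insec v bh h. Proof. by case: h_wit. Qed.
Let h_me : in_mp t h. Proof. by case: h_wit. Qed.
Let t_gt0 : (0 < t)%N. Proof. by case: h_wit. Qed.
Let h_neg : kap * sz bh <= wprod v * (m * t)%N%:Z. Proof. by case: h_wit. Qed.

Variables (nz : nat) (z : 'I_nz -> A).
Hypothesis z_span : forall f, exists l : 'I_nz -> k, idl h (f - lincomb cst z l).

(* The powers of [h] modulo [xi], refined by the span of [z], which is all of
   the ring modulo [(h, xi)]. *)
Definition level n l f := exists mu : 'I_nz -> k, (forall i : 'I_nz, (i < l)%N -> mu i = 0) /\
  exists x y, f = h ^+ n * (lincomb cst z mu + h * x) + xi * y.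

Lemma level0 f : level 0 0 f.
Proof.
have [mu [x [y E]]] := z_span f; exists mu; split=> //; exists x, y.
by rewrite expr0 mul1r -addrA -E addrC subrK.
Qed.

Lemma level_idl n l f : level n l f -> idl (h ^+ n) f.
Proof. by move=> [mu [_ [x [y ->]]]]; exists (lincomb cst z mu + h * x), y. Qed.

Lemma idl_level n l f : idl (h ^+ n.+1) f -> level n l f.
Proof.
move=> [x [y ->]]; exists (fun=> 0); split=> //; exists x, y.
rewrite /lincomb big1 ?add0r; first by rewrite mulrA -exprSr.
by move=> i _; rewrite rmorph0 mul0r.
Qed.

Lemma level_next n f : level n nz f -> level n.+1 0 f.
Proof.
move=> [mu [mu0 [x [y E]]]].
have z0 : lincomb cst z mu = 0.
  by rewrite /lincomb big1 // => i _; rewrite mu0 // rmorph0 mul0r.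
have [mu' [x' [y' E']]] := z_span x; exists mu'; split=> //.
exists x', (h ^+ n.+1 * y' + y); rewrite E z0 add0r mulrA -exprSr.
have -> : x = lincomb cst z mu' + (h * x' + xi * y') by rewrite -E' addrC subrK.
by ring.
Qed.

(** Each step of the filtration is at most one-dimensional: only the coefficient at [z] number [l]
    has to be cancelled, and that of [g] is nonzero. *)
Lemma level_leaf n l f g : (l < nz)%N -> level n l f -> level n l g ->
  ~ level n l.+1 g -> exists e, level n l.+1 (f - cst e * g).
Proof.
move=> ln [mu [mu0 [x [y E]]]] [mu' [mu0' [x' [y' E']]]] ng.
pose o := Ordinal ln.
have [e0|e0] := eqVneq (mu' o) 0.
  case: ng; exists mu'; split; last by exists x', y'.
  move=> i; rewrite ltnS leq_eqVlt => /orP[/eqP il|/mu0' //].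
  by have -> : i = o by apply: val_inj.
pose e := mu o / mu' o; exists e; exists (fun i => mu i - e * mu' i); split.
  move=> i; rewrite ltnS leq_eqVlt => /orP[/eqP il|il].
    by have -> : i = o; [exact: val_inj|rewrite /e divfK ?subrr].
  by rewrite mu0 ?mu0' // mulr0 subrr.
exists (x - cst e * x'), (y - cst e * y').
have -> : lincomb cst z (fun i => mu i - e * mu' i) =
    lincomb cst z mu - cst e * lincomb cst z mu'.
  rewrite /lincomb mulr_sumr -sumrB; apply: eq_bigr => i _.
  by rewrite rmorphB rmorphM mulrBl mulrA.
rewrite E E'; ring.
Qed.

Lemma level_shift n l j g : level n l g -> level (j + n) l (h ^+ j * g).
Proof.
move=> [mu [mu0 [x [y ->]]]]; exists mu; split=> //; exists x, (h ^+ j * y).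
by rewrite exprD; ring.
Qed.

Lemma level_unshift n l j g : level (j + n) l (h ^+ j * g) -> level n l g.
Proof.
move=> [mu [mu0 [x [y E]]]]; exists mu; split=> //; exists x.
have [q qE] : gdvd xi (g - h ^+ n * (lincomb cst z mu + h * x)).
  apply: (prime_cancel xi_irr (gdvd_powN xi_irr (n := j) h_nd)).
  by exists y; rewrite mulrBr E exprD -mulrA addrAC subrr add0r.
by exists q; rewrite -qE addrC subrK.
Qed.

Variable K : int.
Hypothesis K_ge0 : 0 <= K.
Hypothesis pow_size_le : forall b f n, ~ gdvd xi f -> insec v b f ->
  idl (h ^+ n) f -> wprod v * (m * (n * t))%N%:Z <= kap * sz b + K.

Let kap_pos : 0 < kap. Proof. exact (kap_gt0 vok xi_irr xi_ord). Qed.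

Lemma pow_le b f n : ~ gdvd xi f -> insec v b f -> idl (h ^+ n) f ->
  (n <= absz (kap * sz b + K)%R)%N.
Proof.
move=> nf bf hf; have := pow_size_le nf bf hf.
have w1 : 1 <= wprod v by have := wprod_gt0 vok; lia.
have : n%:Z <= wprod v * (m * (n * t))%N%:Z.
  apply: (le_trans (y := (m * (n * t))%N%:Z)); last by rewrite ler_peMl.
  by rewrite lez_nat mulnCA leq_pmulr // muln_gt0 m_gt0.
lia.
Qed.

Let C0 := absz (K + kap * (wt v 0 * (wt v 1 + wt v 2))).

(** By [idl_pow_size] and the witness inequality, lying in [(h ^+ n, xi)] requires a size of about
    [n * sz bh]. With [bh] supported on [D_0] and with [a 1], [a 2] reduced, this is a lower bound
    on [a 0]; [C0] collects [K] and the greatest possible share of [a 1] and [a 2]. *)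
Lemma slack0_ge0 a f n : ~ gdvd xi f -> insec v a f -> idl (h ^+ n) f ->
  0 <= a 1 < wt v 0 -> 0 <= a 2 < wt v 0 -> 0 <= a 0 - n%:Z * bh 0 + C0%:Z.
Proof.
move=> nf af hf /andP[a1 a1'] /andP[a2 a2'].
have w0 := wt_gt0 vok 0; have w1 := wt_gt0 vok 1; have w2 := wt_gt0 vok 2.
have h1 : n%:Z * (kap * (wt v 0 * bh 0)) <= kap * sz a + K.
  apply: le_trans (pow_size_le nf af hf).
  have -> : (m * (n * t))%N%:Z = n%:Z * (m * t)%N%:Z by lia.
  rewrite [X in _ <= X]mulrCA ler_wpM2l //; move: h_neg.
  by rewrite /size_div sum_ord3 bh1 bh2 !mulr0 !addr0.
have h2 : sz a <= wt v 0 * a 0 + wt v 0 * (wt v 1 + wt v 2).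
  rewrite /size_div sum_ord3 -addrA lerD2l mulrDr lerD //.
    by rewrite mulrC ler_pM2r // ltW.
  by rewrite mulrC ler_pM2r // ltW.
have h3 : kap * sz a <= kap * (wt v 0 * a 0 + wt v 0 * (wt v 1 + wt v 2)).
  by rewrite ler_pM2l.
have h4 : 0 <= (kap * wt v 0) * (a 0 - n%:Z * bh 0) +
    (K + kap * (wt v 0 * (wt v 1 + wt v 2))).
  rewrite mulrDr in h3; lia.
have q0 : 1 <= kap * wt v 0 by have : 0 < kap * wt v 0 by rewrite mulr_gt0.
have C0E : C0%:Z = K + kap * (wt v 0 * (wt v 1 + wt v 2)).
  rewrite /C0 gez0_abs //; apply: addr_ge0; first exact: K_ge0.
  by rewrite !mulr_ge0 // ?ltW // addr_gt0.
rewrite C0E; move: h4 q0; have := K_ge0.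
have : 0 <= kap * (wt v 0 * (wt v 1 + wt v 2)).
  by rewrite !mulr_ge0 // ?ltW // addr_gt0.
move: (kap * wt v 0) (a 0 - _) (kap * _) => p x r r0 k0 h4 p1.
have [x0|x0] := leP 0 x; first by lia.
have : p * x <= x by rewrite ler_neMl // ltW.
lia.
Qed.

(** By [me_idl], a greater order at [e] would put [f] into the next power of [h] modulo [xi]. *)
Lemma slack1_ge0 D f n : gsection v D f -> ~ idl (h ^+ n.+1) f ->
  0 <= (n.+1 * t + m)%N%:Z + D.2.
Proof.
move=> [_ De] nf; rewrite leNgt; apply/negP => lt; apply: nf.
apply: (me_idl vok xi_irr xi_ord xi_mult m_gt0 h_nd h_sec h_me t_gt0 h_neg) => //.
move: De; rewrite /ord_exc; case E : (- D.2) => [s|s]; last by lia.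
by apply: in_mp_le; lia.
Qed.

(** Induction on the size is well founded because a divisor with a nonzero section has nonnegative
    size. *)
Lemma size_ind (P : bdiv -> A -> Prop) :
  (forall D f, gsection v D f -> (forall E g, gsection v E g -> g <> 0 ->
     sz E.1 < sz D.1 -> P E g) -> P D f) ->
  forall D f, gsection v D f -> P D f.
Proof.
move=> IH D f Df; have [n] := ubnP (absz (sz D.1)).
have [s0|s0] := leP 0 (sz D.1); last first.
  move=> _; apply: IH => // E g Eg g0 lt.
  by have := insec_size vok (gsection_insec Eg) g0; lia.
elim: n D f Df s0 => // n IHn D f Df s0 lt; apply: IH => // E g Eg g0 lE.
have sE := insec_size vok (gsection_insec Eg) g0.
by apply: IHn => //; lia.
Qed.

Lemma gsection_div D g : gsection v D (xi * g) -> gsection v (D + (c, m%:Z)) g.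
Proof.
move=> [D1 D2]; split.
  by apply: (insec_div vok xi_ord); exact: D1.
rewrite /= opprD; move: D2; rewrite /ord_exc.
case: (- D.2) => [s|s] /=; last by case E : (_ + _) => [r|//]; lia.
move=> /(in_mp_div xi_mult) gm; case E : (_ + _) => [r|//].
by apply: in_mp_le gm; lia.
Qed.

Lemma gsection_xi : gsection v (- c, - m%:Z) xi.
Proof.
split; first exact: insec_xi xi_ord.
by rewrite /= opprK; case: xi_mult.
Qed.

Lemma gsection_h : gsection v (bh, - t%:Z) h.
Proof. by split => //=; rewrite opprK. Qed.

Lemma gsection_one d (n : int) : (forall i, 0 <= d i) -> 0 <= n ->
  gsection v (d, n) (1 : A).
Proof.
move=> d0 n0; split.
  move=> i u; rewrite -(mon0 A) supp_mon => /eqP ->.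
  by rewrite dot0l oppr_le0.
rewrite /ord_exc /=; case E : (- n) => [r|//].
have -> : r = 0%N by lia.
exact: in_mp0.
Qed.

Definition idx := (('I_(absz (wt v 0)) * 'I_(absz (wt v 0))) * 'I_nz * nat * nat * nat)%type.

(* [s] and [r] are slacks: two sections with the same [i, j, l] and comparable
   [n, s, r] differ by a power of [h] and effective boundary divisors. *)
Definition has_idx (x : idx) (fD : A * bdiv) :=
  let: (i, j, l, n, s, r) := x in let: (f, D) := fD in
  [/\ gsection v D f, D.1 1 = i%:Z /\ D.1 2 = j%:Z, level n l f, ~ level n l.+1 f &
    (s%:Z = (n.+1 * t + m)%N%:Z + D.2 /\ r%:Z = D.1 0 - n%:Z * bh 0 + C0%:Z)].

Lemma idx_basis : exists2 s : seq (A * bdiv),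
  (forall p : A * bdiv, p \in s -> gsection (A := A) v p.2 p.1) &
  forall x p, has_idx x p -> exists2 q, q \in s &
    exists n s r, [/\ has_idx (x.1.1.1, n, s, r) q, (n <= x.1.1.2)%N, (s <= x.1.2)%N & (r <= x.2)%N].
Proof.
have := finite_basis_nat (finite_basis_nat (finite_basis_nat
  (@finite_basis_fin (('I_(absz (wt v 0)) * 'I_(absz (wt v 0))) * 'I_nz)%type))).
move=> /(_ (fun x => exists p, has_idx x p)) [s sP sB].
have [F FP] : exists F : idx -> A * bdiv, forall x, x \in s -> has_idx x (F x).
  suff /choice[F FP] : forall x : idx, exists p : A * bdiv, x \in s -> has_idx x p by exists F.
  move=> x; case: (boolP (x \in s)) => [/sP[p Pp]|]; first by exists p.
  by exists (0, 0).
exists [seq F x | x <- s].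
  by move=> _ /mapP[x xs ->]; move: (FP _ xs); case: x {xs} => [[[[[? ?] ?] ?] ?] ?]; case: (F _) => ? ? [].
move=> x p xp; have [|y ys] := sB x; first by exists p.
case: x xp => [[[x n] e] r] _; case: y ys => [[[y n'] e'] r'] ys [[[yx nn] ee] rr].
simpl in yx; subst y.
exists (F (x, n', e', r')); first exact: map_f.
by exists n', e', r'; split=> //; exact: FP ys.
Qed.

(** A section divisible by [xi] is [xi] times one of smaller size. Any other is compared with a
    member of the finite family, multiplied by a power of [h] and by boundary sections so as to have
    the same degree; subtracting a scalar multiple moves it down the filtration, which [pow_le]
    bounds. *)
Theorem gmds_generated : gmds v B.
Proof.
have [s sP sB] := idx_basis.
pose q := absz (wt v 0).
have q0 : wt v 0 = q%:Z by rewrite /q gez0_abs // ltW // wt_gt0.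
pose G : seq B := char_gens v B ++ [:: tD B 1 (0, 1); tD B 1 (eps 0, 0);
  tD B xi (- c, - m%:Z); tD B h (bh, - t%:Z)] ++ [seq tD B p.1 p.2 | p <- s].
have eps_ge0 i : 0 <= (eps 0 : {ffun 'I_3 -> int}) i by rewrite ffunE; case: (_ == _).
apply: (@gmds_of_sections _ _ _ _ G) => [F|].
  rewrite /G mem_cat => /orP[|].
    by rewrite !inE => /or4P[] /eqP ->; apply: gsection_tD; apply: gsection_mon.
  rewrite mem_cat => /orP[|/mapP[p ps ->]]; last by apply: gsection_tD; apply: sP.
  rewrite !inE => /or4P[] /eqP ->; apply: gsection_tD.
  - by apply: gsection_one => // i; rewrite ffunE.
  - by apply: gsection_one.
  - exact: gsection_xi.
  exact: gsection_h.
have Gchar u : gsubalg G (gchar v B u).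
  by apply: char_gens_gen => F FG; apply: GGen; rewrite mem_cat FG.
have Ge : gsubalg G (tD B 1 (0, 1)).
  by apply: GGen; rewrite !mem_cat !inE eqxx !orbT.
have Gy : gsubalg G (tD B 1 (eps 0, 0)).
  by apply: GGen; rewrite !mem_cat !inE eqxx !orbT.
have Gxi : gsubalg G (tD B xi (- c, - m%:Z)).
  by apply: GGen; rewrite !mem_cat !inE eqxx !orbT.
have Gh : gsubalg G (tD B h (bh, - t%:Z)).
  by apply: GGen; rewrite !mem_cat !inE eqxx !orbT.
have Gs p : p \in s -> gsubalg G (tD B p.1 p.2).
  move=> ps; apply: GGen; rewrite !mem_cat; apply/orP; right; apply/orP; right.
  by apply/mapP; exists p.
have G0 D : gsubalg G (tD B 0 D).
  by rewrite tD0; have := GScalar G 0; rewrite !rmorph0.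
have Gcst e f D : gsubalg G (tD B f D) -> gsubalg G (tD B (cst e * f) D).
  by move=> Gf; rewrite tD_cstM; apply: GMul => //; apply: GScalar.
apply: size_ind => D0 f0 Df0 IH.
have IHxi D f : sz D.1 = sz D0.1 -> gsection v D f -> gdvd xi f -> gsubalg G (tD B f D).
  move=> sD Df [g fE]; have [g0|g0] := eqVneq g 0; first by rewrite fE g0 mulr0; apply: G0.
  have -> : D = (- c, - m%:Z) + (D + (c, m%:Z)).
    by apply: bdiv_ext; rewrite /= [_ + (_ + _)]addrCA addNr addr0.
  rewrite fE -tDM; apply: GMul => //; apply: IH.
  - by apply: gsection_div; rewrite -fE.
  - exact/eqP.
  by rewrite size_divD sD /=; have := kap_pos; rewrite /kappa; lia.
(* [N] bounds the number of steps left in the filtration: [pow_le] caps the power of [h] dividing a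
   section modulo [xi], and each power has [nz.+1] steps. Subtractions keep the degree [D], so the
   cap stays the same. *)
have main N : forall D f n l, sz D.1 = sz D0.1 -> gsection v D f ->
    0 <= D.1 1 < wt v 0 -> 0 <= D.1 2 < wt v 0 -> level n l f -> (l <= nz)%N ->
    (((absz (kap * sz D.1 + K)%R).+1 - n) * nz.+1 + (nz - l) < N)%N -> gsubalg G (tD B f D).
  elim: N => [//|N IHN] D f n l sD Df D1 D2 lf lnz.
  have [fx _|fx] := pselect (gdvd xi f); first exact: IHxi.
  have nle := pow_le fx (gsection_insec Df) (level_idl lf); rewrite ltnS => mN.
  move: lnz; rewrite leq_eqVlt => /orP[/eqP lE|lnz].
    rewrite lE in lf; apply: (IHN _ _ n.+1 0%N) => //; first exact: level_next.
    apply: leq_trans mN; move: nle; set M := absz _ => nle.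
    by rewrite subSS (subSn nle) mulSn; lia.
  have [lf'|lf'] := pselect (level n l.+1 f).
    by apply: (IHN _ _ n l.+1) => //; lia.
  have nidl : ~ idl (h ^+ n.+1) f by move=> /(idl_level l.+1).
  have s1 := slack1_ge0 Df nidl.
  have s0 := slack0_ge0 fx (gsection_insec Df) (level_idl lf) D1 D2.
  have i1 : (absz (D.1 1)%R < absz (wt v 0)%R)%N by lia.
  have i2 : (absz (D.1 2)%R < absz (wt v 0)%R)%N by lia.
  pose x : idx := (Ordinal i1, Ordinal i2, Ordinal lnz, n,
    absz ((n.+1 * t + m)%N%:Z + D.2), absz (D.1 0 - n%:Z * bh 0 + C0%:Z)).
  have xf : has_idx x (f, D).
    split=> //; last by split; [exact: (gez0_abs s1)|exact: (gez0_abs s0)].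
    by case/andP: D1 => d1 _; case/andP: D2 => d2 _; split; rewrite /= gez0_abs.
  have [[g E] gs [n' [s' [r' [[gE [E1 E2] lg lg' [ss rr]] nn ss' rr']]]]] := sB x _ xf.
  have Gg := Gs _ gs; rewrite /= in Gg nn ss' rr' E1 E2 lg lg' ss rr.
  have [j nE] : exists j, n = (j + n')%N by exists (n - n')%N; rewrite subnK.
  have nZ : n%:Z = j%:Z + n'%:Z by rewrite nE PoszD.
  have [p pZ] : exists p : nat, p%:Z = (n.+1 * t + m)%N%:Z + D.2 - s'%:Z.
    exists (absz ((n.+1 * t + m)%N%:Z + D.2 - s'%:Z)%R).
    by rewrite gez0_abs // subr_ge0 -(gez0_abs s1) lez_nat.
  have [o oZ] : exists o : nat, o%:Z = D.1 0 - n%:Z * bh 0 + C0%:Z - r'%:Z.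
    exists (absz (D.1 0 - n%:Z * bh 0 + C0%:Z - r'%:Z)%R).
    by rewrite gez0_abs // subr_ge0 -(gez0_abs s0) lez_nat.
  have pE : D.2 = E.2 - j%:Z * t%:Z + p%:Z.
    have tE (r : nat) : (r.+1 * t + m)%N%:Z = (r%:Z + 1) * t%:Z + m%:Z by lia.
    by rewrite pZ ss !tE nZ; ring.
  have oE : D.1 0 = E.1 0 + j%:Z * bh 0 + o%:Z by rewrite oZ rr nZ; ring.
  (* The differences [p] and [o] of the slacks are exactly the multiples of the exceptional curve
     and of [D_0] missing from the degree of [h ^+ j * g]. *)
  have DE : D = (bh, - t%:Z) *+ j + E + ((0, 1) *+ p + (eps 0, 0) *+ o).
    have mulnE (a : {ffun 'I_3 -> int}) (y : int) r : (a, y) *+ r = (a *+ r, y * r%:Z) :> bdiv.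
      elim: r => [|r IHr]; first by rewrite !mulr0n mulr0.
      by rewrite mulrS IHr intS mulrDr mulr1 mulrS.
    apply: bdiv_ext; rewrite !mulnE /=; last by rewrite pE; ring.
    have mulnz (y : int) r : y *+ r = y * r%:Z by rewrite -mulr_natr natz.
    apply/ffunP; apply: ord3_ind; rewrite !ffunE !ffunMnE ?ffunE /=.
    - rewrite oE mul0rn add0r !mulnz [j%:Z * _]mulrC.
      have key (a b d : int) : a + b + d = b + a + 1 * d by ring.
      exact: key.
    - by rewrite E1 bh1 !mul0rn add0r !addr0 gez0_abs //; case/andP: D1.
    by rewrite E2 bh2 !mul0rn add0r !addr0 gez0_abs //; case/andP: D2.
  have one1 : 1 = 1 ^+ p * 1 ^+ o :> A by rewrite !expr1n mulr1.
  have gD : gsection v D (h ^+ j * g).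
    rewrite DE -[h ^+ j * g]mulr1; apply: gsectionM.
      by apply: gsectionM => //; apply: gsectionX; apply: gsection_h.
    rewrite one1; apply: gsectionM; apply: gsectionX; apply: gsection_one => //.
    by move=> i; rewrite ffunE.
  have GgD : gsubalg G (tD B (h ^+ j * g) D).
    rewrite DE -[h ^+ j * g]mulr1 -tDM -tDM -tDX; apply: GMul.
      by apply: GMul => //; apply: gsubalgX.
    rewrite one1 -tDM -!tDX.
    by apply: GMul; apply: gsubalgX.
  have lg1 : level n l (h ^+ j * g) by rewrite nE; apply: level_shift.
  have lg2 : ~ level n l.+1 (h ^+ j * g) by rewrite nE => /level_unshift.
  have [e le] := level_leaf lnz lf lg1 lg2.
  rewrite -[f](subrK (cst e * (h ^+ j * g))) tDD; apply: GAdd; last exact: Gcst.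
  apply: (IHN _ _ n l.+1) => //; last by lia.
  by rewrite -mulNr -rmorphN; apply: gsectionD => //; apply: gsection_cstM.
(* A character reduces the coefficients at [D_1] and [D_2] modulo [wt v 0], leaving finitely many
   residues for [idx]. *)
have [u [u1 u2]] := dot_solve (D0.1 1%R %/ wt v 0%R)%Z (D0.1 2%R %/ wt v 0%R)%Z.
have w0 := wt_gt0 vok 0; pose D := D0 - div_char v u.
have DE i : D.1 i = D0.1 i - dot u (v i) by rewrite !ffunE.
have dE i n : dot u (v i) = wt v 0 * (D0.1 i %/ wt v 0%R)%Z -> n = i -> 0 <= D.1 n < wt v 0.
  move=> ui ->; rewrite DE ui {1 3}(divz_eq (D0.1 i) (wt v 0)) mulrC addrAC subrr add0r.
  by rewrite modz_ge0 ?gt_eqF // ltz_pmod.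
have -> : tD B f0 D0 = tD B (mon u * f0) D * gchar v B (- u).
  rewrite /gchar -/(tD _ _ _) tDM div_charN opprK subrK [mon u * f0]mulrC -mulrA monK.
  by rewrite mulr1.
apply: GMul; last exact: Gchar.
apply: (main _ D (mon u * f0) 0%N 0%N) => //.
- by rewrite size_divB size_vecp // subr0.
- by rewrite /D addrC; apply: gsectionM => //; apply: gsection_mon.
- exact: dE u1 _.
- exact: dE u2 _.
exact: level0.
Qed.

End Generation.

Lemma witness_gmds (k : closedFieldType) (A : gmodel k lattice) (v : fan3)
    (B : gmodel A bdiv) (xi : A) (c : {ffun 'I_3 -> int}) (m : nat) f a t :
  good_fan v -> girreducible xi -> (forall i, ord_eq (v i) xi (c i)) ->
  mult_eq xi m -> (0 < m)%N -> witness v xi c m f a t -> gmds v B.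
Proof.
move=> vok xi_irr xi_ord xi_mult m_gt0 fw.
have [h [b [n [hw b1 b2]]]] := witness_normal vok xi_irr m_gt0 fw.
have [nd hs ht n0 neg] := hw.
have zb nz (z : 'I_nz -> A) : indep (gcst A) (idl xi h) z -> (nz <= 1 * (m * n))%N.
  move=> zi; have := indep_pow_card vok xi_irr xi_ord m_gt0 nd hs n0 neg (n := 1%N) (z := z).
  by rewrite card_ord expr1; apply.
have [nz [z [_ zs]]] := max_indep (idl_ideal xi h) zb.
have [K K0 KP] := idl_pow_size vok xi_irr xi_ord xi_mult m_gt0 nd hs ht n0 neg.
exact: (gmds_generated B vok xi_irr xi_ord xi_mult m_gt0 hw b1 b2 zs K0 KP).
Qed.

Lemma div_char_inj v : good_fan v -> injective (div_char v).
Proof.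
move=> vok u w E; apply/eqP; rewrite -subr_eq0; apply/eqP.
have dE i : dot (u - w) (v i) = 0.
  have /ffunP/(_ i) : (div_char v u).1 = (div_char v w).1 by rewrite E.
  by rewrite !ffunE dotBl => ->; rewrite subrr.
have [sg sg2 /(_ 0)] := wt_sign vok; rewrite !ord3E => -[dE12 w0].
have := wt_gt0 vok 0.
move: (dE 1) (dE 2) dE12; rewrite !dotE /det2; case: (u - w) => a b /= e1 e2 e3 wp.
have key (x y p q r s : int) : x * p + y * q = 0 -> x * r + y * s = 0 ->
  p * s - q * r != 0 -> x = 0 /\ y = 0.
  move=> h1 h2 d; split; apply: (mulIf d); rewrite mul0r.
    have -> : x * (p * s - q * r) = s * (x * p + y * q) - q * (x * r + y * s) by ring.
    by rewrite h1 h2; ring.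
  have -> : y * (p * s - q * r) = p * (x * r + y * s) - r * (x * p + y * q) by ring.
  by rewrite h1 h2; ring.
have [|-> -> //] := key _ _ _ _ _ _ e1 e2.
rewrite e3; apply: mulf_neq0; last by rewrite gt_eqF.
by apply/eqP => sg0; move: sg2; rewrite sg0 mul0r.
Qed.

(** * Finite generation implies the existence of a witness *)

Section Projection.
Variables (k : closedFieldType) (A : gmodel k lattice) (v : fan3).
Variable B : gmodel A bdiv.
Hypothesis vok : good_fan v.
Implicit Types (f g : A) (u w : lattice) (D E : bdiv) (F : B).
Local Notation mon := (@gmon k _ A).
Local Notation cst := (@gcst k _ A).
Variable D0 : bdiv.

(** The monomial that carries sections of [D] to sections of [D0] when the divisors are linearly
    equivalent, unique by [div_char_inj]. The value [0] on other classes makes [class_sum] the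
    projection to one class. *)
Definition class_mon D : A :=
  if pselect (exists w, D = D0 + div_char v w) is left h then mon (projT1 (cid h)) else 0.

Lemma class_monE w : class_mon (D0 + div_char v w) = mon w.
Proof.
rewrite /class_mon; case: pselect => [h|[]]; last by exists w.
by case: (cid h) => w' /= /addrI /(div_char_inj vok) ->.
Qed.

Lemma class_mon_sub D u : class_mon (D - div_char v u) * mon u = class_mon D.
Proof.
have [[w ->]|no] := pselect (exists w, D = D0 + div_char v w).
  by rewrite -addrA -div_charN -div_charD !class_monE -monD subrK.
rewrite [RHS]/class_mon; case: pselect => // _.
rewrite /class_mon; case: pselect => [[w wE]|_]; last by rewrite mul0r.
by case: no; exists (w + u); rewrite div_charD addrA -wE subrK.
Qed.

(* collects the sections of all divisors linearly equivalent to [D0] in degree [D0] *)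
Definition class_sum F : A := \sum_(D <- supp F) class_mon D * cf F D.

Lemma class_sumEw F (d : {fset bdiv}) : (supp F `<=` d)%fset ->
  class_sum F = \sum_(D <- d) class_mon D * cf F D.
Proof.
move=> le; apply: (big_fset_incl _ le) => D _.
by rewrite supp_cf negbK => /eqP ->; rewrite mulr0.
Qed.

Lemma class_sumD F F' : class_sum (F + F') = class_sum F + class_sum F'.
Proof.
have le : (supp (F + F') `<=` supp F `|` supp F')%fset.
  by apply/fsubsetP => w /suppD; rewrite inE => -[->|->]; rewrite ?orbT.
rewrite (class_sumEw le) (class_sumEw (fsubsetUl (supp F) (supp F'))).
rewrite (class_sumEw (fsubsetUr (supp F) (supp F'))) -big_split /=.
by apply: eq_bigr => w _; rewrite cfD mulrDr.
Qed.

Lemma class_sum0 : class_sum 0 = 0.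
Proof. by rewrite /class_sum big_seq big1 // => w; rewrite supp0. Qed.

Lemma class_sum_sum I (r : seq I) (P : pred I) (F : I -> B) :
  class_sum (\sum_(i <- r | P i) F i) = \sum_(i <- r | P i) class_sum (F i).
Proof. exact: (big_morph class_sum class_sumD class_sum0). Qed.

Lemma class_sum_tD f D : class_sum (tD B f D) = class_mon D * f.
Proof.
have le : (supp (tD B f D) `<=` [fset D])%fset.
  apply/fsubsetP => w; rewrite inE supp_cf /tD cf_gmono.
  by have [|_] := eqVneq D w; rewrite ?mulr0n ?eqxx.
by rewrite (class_sumEw le) big_seq_fset1 /tD cf_gmono eqxx.
Qed.

Lemma class_sum_char F u : class_sum (F * gchar v B u) = class_sum F.
Proof.
rewrite [F]gmE mulr_suml !class_sum_sum; apply: eq_bigr => D _.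
rewrite -!/(tD _ _ _) tDM !class_sum_tD -(class_mon_sub D u).
by rewrite mulrAC mulrA.
Qed.

Lemma class_sum_cox F F' : gin_cox_ideal v (F - F') -> class_sum F = class_sum F'.
Proof.
move=> [s _ E]; rewrite -[F](subrK F') class_sumD E class_sum_sum big1 ?add0r //.
move=> p _; rewrite mulrBr mulr1.
apply: (addIr (class_sum (p.1 * gchar v B p.2))).
by rewrite -class_sumD subrK add0r class_sum_char.
Qed.

End Projection.

Section Necessity.
Variables (k : closedFieldType) (A : gmodel k lattice) (v : fan3).
Variable B : gmodel A bdiv.
Hypothesis vok : good_fan v.
Variables (xi : A) (c : {ffun 'I_3 -> int}) (m : nat).
Hypothesis xi_irr : girreducible xi.
Hypothesis xi_ord : forall i, ord_eq (v i) xi (c i).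
Hypothesis xi_mult : mult_eq xi m.
Hypothesis m_gt0 : (0 < m)%N.
Implicit Types (f g : A) (u w : lattice) (a b d : {ffun 'I_3 -> int}) (D E : bdiv) (F : B).
Local Notation mon := (@gmon k _ A).
Local Notation cst := (@gcst k _ A).
Local Notation sz := (size_div v).
Local Notation kap := (kappa v c).

(* Without a witness the generators not divisible by [xi] are not [far] for large [S]:
   their slopes [t / size_div a] stay below the critical value [kappa / (wprod m)]. *)
Definition far (S : int) D := (kap * S - 1) * sz D.1 < - D.2 * (wprod v * m%:Z * S).

Lemma farD S D E : far S (D + E) -> far S D \/ far S E.
Proof. rewrite /far /= size_divD mulrDr opprD mulrDl; lia. Qed.

Lemma far_char S D w : far S (D + div_char v w) = far S D.
Proof. by rewrite /far /= size_divD size_vecp // !addr0. Qed.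

Let kap_pos : 0 < kap. Proof. exact (kap_gt0 vok xi_irr xi_ord). Qed.

(** Being far is a strict linear inequality on degrees: if a sum of two degrees is far, so is one of
    them, and the degree [0] of the scalars is not. *)
Lemma gsubalg_far S G F D :
  (forall (F : B) D, F \in G -> far S D -> gdvd xi (cf F D)) ->
  gsubalg G F -> far S D -> gdvd xi (cf F D).
Proof.
move=> GP GF; elim: GF D => {F} [e|F FG|F F' _ IH _ IH'|F F' _ IH _ IH'] D Dfar.
- rewrite -[gcst B _]mulr1 -(mon0 B) cf_gmono; case: eqP => [D0|_]; last first.
    by rewrite mulr0n; exact: gdvd0.
  by move: Dfar; rewrite /far -D0 /= size_div0 mulr0 oppr0 mul0r ltxx.
- exact: GP.
- by rewrite cfD; apply: gdvdD; [apply: IH|apply: IH'].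
rewrite cfM; apply: (big_ind (gdvd xi)) => [|*|E _]; [exact: gdvd0|exact: gdvdD|].
apply: (big_ind (gdvd xi)) => [|*|E' _]; [exact: gdvd0|exact: gdvdD|].
case: eqP => [EE|_]; last by rewrite mulr0n; exact: gdvd0.
rewrite mulr1n; move: Dfar; rewrite -EE => /farD[h|h].
  by apply: gdvdMr; apply: IH.
by apply: gdvdMl; apply: IH'.
Qed.

(** [S] bounds the sizes of the degrees in which the generators live. The failure of the witness
    inequality is strict between integers, so there is a gap of [1], which is at least the fraction
    [1 / S] of the size; this is the margin in [far]. *)
Lemma gmds_far : gmds v B -> ~ (exists f a t, witness v xi c m f a t) ->
  exists S : int, 0 < S /\ forall D f, gsection v D f -> far S D -> gdvd xi f.
Proof.
move=> [G Gdiv Ggen] nowit.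
have [S [S1 SP]] : exists S : int, 0 < S /\ forall (F : B) D, F \in G -> D \in supp F -> sz D.1 <= S.
  pose s := [seq sz D.1 | D <- flatten [seq enum_fset (supp F) | F <- G]].
  exists (1 + \sum_(x <- s) `|x|); have s0 : 0 <= \sum_(x <- s) `|x| by apply: sumr_ge0.
  split=> [|F D FG DF]; first by lia.
  have xs : sz D.1 \in s.
    by apply: map_f; apply/flattenP; exists (enum_fset (supp F)) => //; apply: map_f.
  have key (x y n : int) : x <= n -> 0 <= y -> x <= 1 + (n + y) by lia.
  rewrite (big_rem _ xs) /=; apply: key; first exact: ler_norm.
  exact: sumr_ge0.
have GP F D : F \in G -> far S D -> gdvd xi (cf F D).
  move=> FG Df; apply: contrapT => nd.
  have F0 : cf F D <> 0 by move=> e; apply: nd; rewrite e; exact: gdvd0.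
  have Ds : D \in supp F by rewrite supp_cf; apply/eqP.
  have [Fi Fe] := Gdiv _ FG D.
  have s0 := insec_size vok Fi F0; have s1 := SP _ _ FG Ds.
  move: Df; rewrite /far => Df.
  have kS : 0 <= kap * S - 1 by have : 0 < kap * S by [rewrite mulr_gt0]; lia.
  have lt0 : 0 < - D.2 * (wprod v * m%:Z * S) by apply: le_lt_trans Df; rewrite mulr_ge0.
  have Q0 : 0 < wprod v * m%:Z * S by have w0 := wprod_gt0 vok; rewrite mulr_gt0 // mulr_gt0 // ltz_nat.
  rewrite pmulr_lgt0 // in lt0.
  have tE : - D.2 = (absz D.2)%:Z by lia.
  have h1 : kap * sz D.1 > wprod v * (m * absz D.2)%N%:Z.
    rewrite ltNge; apply/negP => le; apply: nowit.
    exists (cf F D), D.1, (absz D.2); split=> //; last by lia.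
    by move: Fe; rewrite tE.
  have h2 : (wprod v * (m * absz D.2)%N%:Z + 1) * S <= kap * sz D.1 * S.
    by rewrite ler_pM2r // addrC; lia.
  move: Df; rewrite tE PoszM in h1 h2 *.
  have -> : (absz D.2)%:Z * (wprod v * m%:Z * S) = (wprod v * (m%:Z * (absz D.2)%:Z) + 1) * S - S by ring.
  have -> : (kap * S - 1) * sz D.1 = kap * sz D.1 * S - sz D.1 by ring.
  lia.
exists S; split=> // D f Df Dfar.
have [F' F'G F'E] := Ggen _ (gsection_tD B Df).
have E : f = class_sum v D F'.
  rewrite -(class_sum_cox vok D F'E) class_sum_tD -{2}[D]addr0.
  have -> : 0 = div_char v 0.
    by apply: (addrI (div_char v 0)); rewrite -div_charD !addr0.
  by rewrite class_monE // mon0 mul1r.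
rewrite E /class_sum; apply: (big_ind (gdvd xi)) => [|*|E' _]; [exact: gdvd0|exact: gdvdD|].
have [[w wE]|no] := pselect (exists w, E' = D + div_char v w).
  by apply: gdvdMl; apply: (gsubalg_far GP F'G); rewrite wE far_char.
by rewrite /class_mon; case: pselect => // _; rewrite mul0r; exact: gdvd0.
Qed.

(* Contains the lowest Taylor exponents of the sections of [- J c]: these are divisible by
   [xi], which has lowest exponent [(al, be)], or of order less than [tau J]. *)
Fixpoint nu_list (al be : nat) (tau : nat -> nat) (J : nat) : seq (nat * nat) :=
  if J is J'.+1 then
    [seq ((al + x.1)%N, (be + x.2)%N) | x <- nu_list al be tau J'] ++
    [seq (i, j) | i <- iota 0 al, j <- iota 0 (tau J)] ++
    [seq (i, j) | i <- iota 0 (tau J), j <- iota 0 be]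
  else [:: (0%N, 0%N)].

Lemma size_nu_list al be tau J :
  size (nu_list al be tau J) = (1 + (al + be) * \sum_(1 <= i < J.+1) tau i)%N.
Proof.
elim: J => [|J IH]; first by rewrite big_geq // muln0.
rewrite /= !size_cat size_map IH !size_allpairs !size_iota.
by rewrite [in RHS]big_nat_recr //=; lia.
Qed.

(** An exponent that is at least [(al, be)] in both coordinates comes from the list for the previous
    [J], since [tau] increases by at most [al + be]; the others are listed outright. *)
Lemma mem_nu_list al be tau J x : tau 0 = 1%N ->
  (forall i, tau i.+1 <= tau i + (al + be))%N ->
  (x.1 + x.2 < tau J)%N -> x \in nu_list al be tau J.
Proof.
move=> t0 tS; elim: J x => [|J IH] [i j] /=.
  by rewrite t0 inE xpair_eqE; lia.
move=> lt; rewrite !mem_cat; have := tS J => tJ.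
case: (ltnP i al) => [ia|ai].
  apply/orP; right; apply/orP; left; apply/allpairsP; exists (i, j).
  by rewrite !mem_iota; split=> //=; lia.
case: (ltnP j be) => [jb|bj].
  apply/orP; right; apply/orP; right; apply/allpairsP; exists (i, j).
  by rewrite !mem_iota; split=> //=; lia.
apply/orP; left; apply/mapP; exists ((i - al)%N, (j - be)%N); last by rewrite /= !subnKC.
by apply: IH => /=; lia.
Qed.

Variables (S : nat).
Hypothesis S_gt0 : (0 < S)%N.
Hypothesis far_div : forall D f, gsection v D f -> far S%:Z D -> gdvd xi f.
Hypothesis kap_le : kap * kap <= wprod v * (m * m)%N%:Z.

(** By [far_div], a section of [- J c] whose order at [e] exceeds [P * J / Q] is divisible by [xi],
    and [tau J] is the first such order. *)
Let P := ((absz kap * S - 1) * absz kap)%N.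
Let Q := (absz (wprod v) * m * S)%N.
Let tau J := ((P * J) %/ Q).+1.
Let w0 := wprod_gt0 vok.

Let Q_gt0 : (0 < Q)%N.
Proof.
rewrite /Q muln_gt0 muln_gt0 m_gt0 S_gt0 !andbT absz_gt0.
exact: lt0r_neq0 (wprod_gt0 vok).
Qed.

Lemma lowest_in_nu_list al be : taylor_lowest xi (Posz al, Posz be) ->
  forall J f, insec v (- c *+ J) f -> f <> 0 ->
  exists2 x, x \in nu_list al be tau J & taylor_lowest f (Posz x.1, Posz x.2).
Proof.
move=> xil.
have mE : m = (al + be)%N by have := mult_lowest xil xi_mult; rewrite dotE /=; lia.
(* Here [kap_le], that is [C.C <= 0], enters: it gives [P <= m * Q]. *)
have tS i : (tau i.+1 <= tau i + (al + be))%N.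
  rewrite /tau -mE addSn ltnS mulnS.
  apply: (leq_trans (n := (m * Q + P * i) %/ Q)); last by rewrite divnMDl // addnC.
  apply: leq_div2r; rewrite leq_add2r.
  apply: (leq_trans (n := (absz kap * absz kap * S)%N)).
    have key (x y : nat) : ((x * y - 1) * x <= x * x * y)%N by nia.
    exact: key.
  have key (K W : int) (n s : nat) : 0 < K -> 0 < W -> K * K <= W * (n * n)%N%:Z ->
      (absz K * absz K * s <= n * (absz W * n * s))%N.
    case: K => // K; case: W => // W _ _; rewrite -!PoszM lez_nat /= => le.
    by rewrite mulnA leq_mul2r mulnCA le orbT.
  exact: key.
have nd_tau J f : insec v (- c *+ J) f -> ~ gdvd xi f ->
    exists2 x, (x.1 + x.2 < tau J)%N & taylor_lowest f (Posz x.1, Posz x.2).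
  move=> fs nf; have f0 : f <> 0 by move=> e; apply: nf; rewrite e; exact: gdvd0.
  have [[[i|?] [j|?]] fl] := taylor_lowest_ex f0;
    have [] // := taylor_lowest_nonneg fl => _ _.
  exists (i, j) => //; rewrite /tau ltnS leq_divRL //=.
  have fm : in_mp (i + j) f by apply/(me_lowest _ fl); rewrite dotE /=; lia.
  have nfar : ~ far S%:Z (- c *+ J, - (i + j)%N%:Z).
    by move=> /(far_div (f := f)) h; apply: nf; apply: h; split=> //=; rewrite opprK.
  have key (K W : int) (n r s q : nat) : 0 < K -> 0 < W -> (0 < s)%N ->
      n%:Z * (W * r%:Z * s%:Z) <= (K * s%:Z - 1) * (K *+ q) ->
      (n * (absz W * r * s) <= (absz K * s - 1) * absz K * q)%N.
    case: K => // K; case: W => // W K0 _ s0; rewrite -mulr_natr natz /=.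
    have Ks : (1 <= K * s)%N by rewrite muln_gt0 s0 andbT.
    by rewrite -[1 in X in X -> _]/(1%:Z) -!PoszM subzn // -!PoszM lez_nat !mulnA.
  have := kap_pos; move/negP: nfar; rewrite /far -leNgt /= opprK size_divMn size_divN.
  by move=> h kp; apply: key h.
elim=> [|J IH] f fs f0.
  have [[q fE]|nf] := pselect (gdvd xi f).
    have [] : f <> 0 by []; rewrite fE (insec_not_div vok (a := c) (f := q)) ?mulr0 //.
      by rewrite -[c]add0r; apply: (insec_div vok xi_ord); rewrite -fE.
    by have := kap_pos; rewrite /kappa oppr_gt0.
  have [x xt xl] := nd_tau _ _ fs nf; exists x => //.
  by apply: mem_nu_list => //; rewrite /tau muln0 div0n.
have [[q fE]|nf] := pselect (gdvd xi f).
  have [||x xJ xl] := IH q.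
  - rewrite -[_ *+ J](addrK (- c)) -mulrSr opprK.
    by apply: (insec_div vok xi_ord); rewrite -fE.
  - by move=> q0; apply: f0; rewrite fE q0 mulr0.
  exists ((al + x.1)%N, (be + x.2)%N).
    by rewrite /= mem_cat; apply/orP; left; apply: map_f.
  by rewrite fE; apply: (taylor_lowestM xil xl).
have [x xt xl] := nd_tau _ _ fs nf; exists x => //.
by apply: mem_nu_list => //; rewrite /tau muln0 div0n.
Qed.

Lemma supp_sum_mon (L : {fset lattice}) u : u \in L -> u \in supp (\sum_(x <- L) mon x).
Proof.
move=> uL; rewrite supp_cf cf_sum (bigD1_seq u) ?fset_uniq //=.
rewrite cf_mon eqxx big1 ?addr0 ?oner_eq0 // => x /negbTE xu.
by rewrite cf_mon xu.
Qed.

(** With more monomials than exponents in [s], some nonzero combination of the monomials has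
    vanishing Taylor coefficients at all of [s], although its lowest exponent is in [s]. *)
Lemma lat_le_size (a : {ffun 'I_3 -> int}) (s : seq (nat * nat)) :
  (forall f, insec v a f -> f <> 0 ->
    exists2 x, x \in s & taylor_lowest f (Posz x.1, Posz x.2)) ->
  (#|` lat v a| <= size s)%N.
Proof.
move=> sP; rewrite leqNgt cardfE; apply/negP => lt.
set L := lat v a in lt sP *.
(* The sum of all monomials only serves to find one shift that clears the denominators of each of
   them. *)
have [u [_ _ uP]] := shift_nonneg_ge (\sum_(x <- L) mon x : A).
have {}uP := uP u (lexx _) (lexx _).
have uL x : x \in L -> 0 <= (u + x).1 /\ 0 <= (u + x).2.
  move=> xL; apply: uP; rewrite supp_monM addrC addKr; exact: supp_sum_mon.
pose M : 'M[k]_(#|{: L}|, size s) := \matrix_(i, j)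
  cf (taylor (mon (u + val (enum_val i)))) (Posz (nth (0, 0)%N s j).1, Posz (nth (0, 0)%N s j).2).
have [w wn wM] := left_kernel M lt.
pose l (x : L) := w 0 (enum_rank x).
pose f := lincomb cst (fun x : L => mon (val x)) l.
have fs : insec v a f.
  by apply: insec_lincomb => x; apply/insec_mon => //; apply: valP.
have f0 : f <> 0.
  move=> /mon_indep l0; case/negP: wn; apply/eqP/rowP => i.
  by rewrite mxE -(l0 (enum_val i)) /l enum_valK.
have [[x y] xs xl] := sP _ fs f0.
have fn : nonneg (mon u * f).
  move=> z; rewrite supp_monM => /supp_lincomb_mon /uL.
  by rewrite addrCA subrr addr0.
have [] := taylor_lowest_shift fn xl; rewrite supp_cf => /negP[].
have fE : taylor (mon u * f) = \sum_(x : L) cst (l x) * taylor (mon (u + val x)).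
  rewrite /f /lincomb mulr_sumr /taylor subst_sum; apply: eq_bigr => z _.
  by rewrite mulrCA -monD subst_gmono subst_mon.
have jP : (index (x, y) s < size s)%N by rewrite index_mem.
have := congr1 (fun N : 'rV_(size s) => N 0 (Ordinal jP)) wM.
rewrite !mxE => E; apply/eqP; rewrite fE cf_sum -[RHS]E.
rewrite (reindex_onto enum_val enum_rank) /=; last by move=> i _; rewrite enum_rankK.
apply: eq_big => i; first by rewrite enum_valK eqxx.
by rewrite mxE /= nth_index // cf_cstM /l enum_valK.
Qed.

(** Both bounds on [N J] are quadratic in [J]: [up] has leading term [(m * P / Q) * J ^ 2 / 2] and
    [lowT] has [(kap ^ 2 / wprod) * J ^ 2 / 2]. After multiplication by [S * wprod] the coefficients
    of [J ^ 2 / 2] differ by exactly [kap], so [main] bounds a quadratic function by a linear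
    one. *)
Lemma far_false : False.
Proof.
have [[[al|?] [be|?]] xil] := taylor_lowest_ex (xi_neq0 xi_irr);
  have [] // := taylor_lowest_nonneg xil => _ _.
have mE : m = (al + be)%N by have := mult_lowest xil xi_mult; rewrite dotE /=; lia.
pose N J := #|` lat v (- c *+ J)|.
have up J : (N J <= 1 + m * \sum_(1 <= i < J.+1) tau i)%N.
  by rewrite mE -size_nu_list; apply: lat_le_size; apply: lowest_in_nu_list.
have [K K0 KP] := lat_asymp_all vok c.
have szJ J : sz (- c *+ J) = kap *+ J by rewrite size_divMn size_divN.
have low J : K <= kap *+ J.+1 ->
    wprod v * (N J)%:Z + kap * (kap *+ J.+1) - K <= wprod v * (N J.+1)%:Z.
  move=> KJ; have := KP (- c *+ J.+1); rewrite szJ => /(_ KJ).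
  have -> : - c *+ J.+1 + c = - c *+ J by rewrite mulrSr subrK.
  rewrite -/(N J) -/(N J.+1); have -> : sz c = - kap by rewrite opprK.
  lia.
pose k0 := absz kap; pose wn := absz (wprod v).
have kE : kap = k0%:Z by rewrite /k0 gez0_abs // ltW.
have wE : wprod v = wn%:Z by rewrite /wn gez0_abs // ltW.
have k1 : (0 < k0)%N by have := kap_pos; rewrite kE.
case: K K0 KP low => // K _ _ low.
have {}low J : (K <= k0 * J.+1 -> wn * N J + k0 * k0 * J.+1 <= wn * N J.+1 + K)%N.
  move=> KJ; have := low J; rewrite kE wE -mulr_natr natz => /(_ KJ).
  have key (w n r j q s : nat) : w%:Z * n%:Z + r%:Z * (r%:Z * j%:Z) - s%:Z <= w%:Z * q%:Z ->
    (w * n + r * r * j <= w * q + s)%N by rewrite -mulnA; lia.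
  exact: key.
pose T J := (\sum_(1 <= i < J.+1) i)%N.
have TS J : T J.+1 = (T J + J.+1)%N by rewrite /T big_nat_recr.
have T2 J : (2 * T J = J * J.+1)%N.
  by elim: J => [|J IH]; [rewrite /T big_geq|rewrite TS mulnDr IH; lia].
have lowT J : (K <= J -> k0 * k0 * T J <= wn * N J + K * J + k0 * k0 * T K)%N.
  elim: J => [|J IH]; first by rewrite leqn0 => /eqP ->; lia.
  rewrite leq_eqVlt => /orP[/eqP <-|]; first by rewrite leq_addl.
  rewrite ltnS => KJ; have h := IH KJ; have := low J.
  have -> : (K <= k0 * J.+1)%N by apply: leq_trans (leq_pmull _ k1); apply: leqW.
  by rewrite TS mulnDr mulnS => /(_ isT); move: h; lia.
have upT J : (Q * \sum_(1 <= i < J.+1) tau i <= P * T J + Q * J)%N.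
  elim: J => [|J IH]; first by rewrite !big_geq ?muln0.
  rewrite TS big_nat_recr //= !mulnDr mulnS.
  have : (Q * tau J.+1 <= P * J.+1 + Q)%N.
    by rewrite /tau mulnS addnC leq_add2r mulnC leq_trunc_div.
  by move: IH; lia.
pose b0 := (S * (wn + k0 * k0 * T K))%N; pose c0 := (Q + S * K)%N.
have main J : (K <= J -> k0 * T J <= b0 + c0 * J)%N.
  move=> KJ; have h1 := lowT J KJ; have h2 := upT J; have h3 := up J.
  have PE : (P * T J + k0 * T J = S * (k0 * k0 * T J))%N.
    have key (a s t : nat) : (0 < a * s)%N -> ((a * s - 1) * a * t + a * t = s * (a * a * t))%N.
      have -> : (s * (a * a * t) = (a * s) * (a * t))%N by lia.
      by case: (a * s)%N => // r _; rewrite subn1 /= mulSn -mulnA addnC.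
    by apply: key; rewrite muln_gt0 k1.
  have h4 : (S * (wn * N J) <= S * wn + Q * \sum_(1 <= i < J.+1) tau i)%N.
    have key (s w r x y : nat) : (x <= 1 + r * y -> s * (w * x) <= s * w + w * r * s * y)%N.
      move=> /(leq_mul (leqnn (s * w))); lia.
    exact: key.
  have h5 := leq_mul (leqnn S) h1.
  rewrite /b0 /c0; move: h2 PE h4 h5; rewrite !mulnDr !mulnDl.
  by rewrite -![(S * K * J)%N]mulnA; lia.
clearbody b0 c0; set J := (K + 2 * (b0 + c0)).+1.
have := main J ltac:(rewrite /J; lia); have := T2 J.
have Jb : (2 * (b0 + c0) < J)%N by rewrite /J; lia.
clearbody J; move: (T J) => t tE le.
have h1 : (t <= b0 + c0 * J)%N by apply: leq_trans le; rewrite leq_pmull.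
have h2 : ((2 * (b0 + c0)).+1 * J <= J * J)%N by rewrite leq_mul2r Jb orbT.
have h3 : (2 * (b0 * 1) <= 2 * (b0 * J))%N by rewrite !leq_mul2l; case: (J) Jb => //; lia.
by move: tE h1 h2 h3; rewrite mulnS mulSn; lia.
Qed.

End Necessity.

Lemma gmds_witness (k : closedFieldType) (A : gmodel k lattice) (v : fan3)
    (B : gmodel A bdiv) (xi : A) (c : {ffun 'I_3 -> int}) (m : nat) :
  good_fan v -> girreducible xi -> (forall i, ord_eq (v i) xi (c i)) ->
  mult_eq xi m -> (0 < m)%N -> kappa v c * kappa v c <= wprod v * (m * m)%N%:Z ->
  gmds v B -> exists f a t, witness v xi c m f a t.
Proof.
move=> vok xi_irr xi_ord xi_mult m_gt0 kle mds; apply: contrapT => nowit.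
have [[S|?] [// S0 SP]] := gmds_far vok xi_irr xi_ord m_gt0 mds nowit.
exact: (far_false vok xi_irr xi_ord xi_mult m_gt0 S0 SP kle).
Qed.

(** * Mixed areas of triangles *)

Section Planar.
Variable F : realFieldType.
Implicit Types (p e : F * F).

Definition ip p e : F := p.1 * e.1 + p.2 * e.2.
Definition cross p e : F := p.1 * e.2 - p.2 * e.1.

Lemma cramer2 (e n1 n2 : F * F) : cross n1 n2 != 0 -> ip e n1 = 0 ->
  e = (ip e n2 / cross n1 n2 * - n1.2, ip e n2 / cross n1 n2 * n1.1).
Proof.
case: e n1 n2 => [e f] [a b] [c d]; rewrite /ip /cross /= => nz E.
congr (_, _); apply: (mulIf nz); rewrite mulrAC divfK //.
  have -> : e * (a * d - b * c) = (e * a + f * b) * d - b * (e * c + f * d) by ring.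
  by rewrite E; ring.
have -> : f * (a * d - b * c) = a * (e * c + f * d) - c * (e * a + f * b) by ring.
by rewrite E; ring.
Qed.

Lemma cyc3 (i : 'I_3) : [/\ i + 1 + 1 = i + 2, i + 1 + 2 = i, i + 2 + 1 = i & i + 2 + 2 = i + 1].
Proof. by split; apply/val_inj; case: i => [[|[|[|]]]]. Qed.

(* The inward normals [n i] of the edges opposite to the vertices [q i] satisfy
   [\sum_i w i * n i = 0]. *)
Record tri_data (n q : 'I_3 -> F * F) (w C : 'I_3 -> F) (sg : F) := TriData {
  td_sg : sg * sg = 1;
  td_w : forall i, 0 < w i;
  td_cross : forall i, cross (n (i + 1)) (n (i + 2)) = sg * w i;
  td_edge1 : forall i, ip (q (i + 1)) (n i) = C i;
  td_edge2 : forall i, ip (q (i + 2)) (n i) = C i;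
  td_in : forall i, C i < ip (q i) (n i) }.

Section Tri.
Variables (n q : 'I_3 -> F * F) (w C : 'I_3 -> F) (sg : F).
Hypothesis T : tri_data n q w C sg.

Let sg2 := td_sg T. Let wp := td_w T.

(** The size of the triangle as a divisor; [width ^+ 2 / wvol] is twice its area by [area2E]. *)
Definition width : F := - \sum_i w i * C i.
Definition wvol : F := w 0 * w 1 * w 2.

Lemma wvol_gt0 : 0 < wvol. Proof. by rewrite !mulr_gt0. Qed.

Lemma wvolE i : wvol = w i * w (i + 1) * w (i + 2).
Proof. move: i; apply: ord3_ind; rewrite !ord3E /wvol; ring. Qed.

Lemma ip_rel p : \sum_i w i * ip p (n i) = 0.
Proof.
have h i : w i = sg * cross (n (i + 1)) (n (i + 2)).
  by rewrite (td_cross T) mulrA sg2 mul1r.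
rewrite sum_ord3 !h !ord3E /ip /cross; ring.
Qed.

Lemma width_vtx i : w i * (ip (q i) (n i) - C i) = width.
Proof.
have := ip_rel (q i); rewrite /width !(sum_cycle3 _ i).
have [E1 E2 E3 E4] := cyc3 i.
have := td_edge2 T (i + 1); rewrite E2 => ->.
have := td_edge1 T (i + 2); rewrite E3 => -> h.
by apply/eqP; rewrite -subr_eq0 -[X in _ == X]h; apply/eqP; ring.
Qed.

Lemma width_gt0 : 0 < width.
Proof. by rewrite -(width_vtx 0) mulr_gt0 // subr_gt0; apply: (td_in T). Qed.

Lemma ip_vtx i : ip (q i) (n i) = C i + width / w i.
Proof. by rewrite -(width_vtx i) mulrAC mulfV ?gt_eqF // mul1r addrC subrK. Qed.

Lemma normals_neq0 i : cross (n i) (n (i + 1)) != 0.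
Proof.
have [E1 E2 E3 E4] := cyc3 i; have := td_cross T (i + 2); rewrite E3 E4 => ->.
apply: mulf_neq0; last by rewrite gt_eqF.
apply/eqP => s0; by have := sg2; rewrite s0 mul0r => /eqP; rewrite eq_sym oner_eq0.
Qed.

Lemma ip_inj p e : (forall i, ip p (n i) = ip e (n i)) -> p = e.
Proof.
move=> h; have d i : ip (p.1 - e.1, p.2 - e.2) (n i) = 0.
  have := h i; rewrite /ip /= => E; apply/eqP; rewrite -(subrr (e.1 * (n i).1 + e.2 * (n i).2)).
  by rewrite -{1}E; apply/eqP; ring.
have := cramer2 (normals_neq0 0) (d 0); rewrite d mul0r !mul0r => -[/eqP + /eqP].
by rewrite !subr_eq0; case: p e {h d} => [? ?] [? ?] /= /eqP -> /eqP ->.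
Qed.

Lemma edge_normal i : (q (i + 1)).1 - (q (i + 2)).1 = - (sg * width * w i / wvol) * (n i).2 /\
  (q (i + 1)).2 - (q (i + 2)).2 = sg * width * w i / wvol * (n i).1.
Proof.
have [E1 E2 E3 E4] := cyc3 i.
pose e := ((q (i + 1)).1 - (q (i + 2)).1, (q (i + 1)).2 - (q (i + 2)).2).
have ipe j : ip e (n j) = ip (q (i + 1)) (n j) - ip (q (i + 2)) (n j).
  by rewrite /ip /e /=; ring.
have e0 : ip e (n i) = 0 by rewrite ipe (td_edge1 T) (td_edge2 T) subrr.
have e1 : ip e (n (i + 1)) = width / w (i + 1).
  by rewrite ipe ip_vtx; have := td_edge1 T (i + 1); rewrite E1 => ->; rewrite addrC addKr.
have := cramer2 (normals_neq0 i) e0.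
have := td_cross T (i + 2); rewrite E3 E4 => ->; rewrite e1 (wvolE i).
have sgV : sg^-1 = sg by apply: (mulIf (x := sg)); rewrite ?mulVf ?sg2 //;
  apply/eqP => s0; have := sg2; rewrite s0 mul0r => /eqP; rewrite eq_sym oner_eq0.
have w0 := lt0r_neq0 (wp i); have w1 := lt0r_neq0 (wp (i + 1)); have w2 := lt0r_neq0 (wp (i + 2)).
rewrite invfM sgV /e => -[-> ->]; split; field; rewrite ?w0 ?w1 ?w2 //.
Qed.

Definition area2 : F := cross (q 0) (q 1) + cross (q 1) (q 2) + cross (q 2) (q 0).

Lemma area2E : area2 = sg * width ^+ 2 / wvol.
Proof.
have [x0 y0] := edge_normal 0; have [x1 y1] := edge_normal 1.
rewrite !ord3E in x0 y0 x1 y1.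
have -> : area2 = ((q 1).1 - (q 2).1) * ((q 2).2 - (q 0).2) - ((q 1).2 - (q 2).2) * ((q 2).1 - (q 0).1).
  by rewrite /area2 /cross; ring.
rewrite x0 y0 x1 y1.
have := td_cross T 2; rewrite !ord3E => c2.
transitivity (sg * sg * width ^+ 2 * w 0 * w 1 * wvol^-1 ^+ 2 * cross (n 0) (n 1)).
  by rewrite /cross; ring.
rewrite c2 sg2 exprVn /wvol; field.
by rewrite !(gt_eqF (wp _)).
Qed.

Definition bary p i : F := w i * (ip p (n i) - C i) / width.

Lemma bary_sum p : \sum_i bary p i = 1.
Proof.
rewrite /bary -mulr_suml; under eq_bigr => i _ do rewrite mulrBr.
by rewrite sumrB ip_rel add0r divff // gt_eqF // width_gt0.
Qed.

Lemma baryE p : p = (\sum_i bary p i * (q i).1, \sum_i bary p i * (q i).2).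
Proof.
apply: ip_inj => j.
have -> : ip (\sum_i bary p i * (q i).1, \sum_i bary p i * (q i).2) (n j) =
    \sum_i bary p i * ip (q i) (n j).
  rewrite /ip /= !mulr_suml -big_split /=; apply: eq_bigr => i _; ring.
have [E1 E2 E3 E4] := cyc3 j.
rewrite (sum_cycle3 _ j) (td_edge1 T) (td_edge2 T) ip_vtx.
have := bary_sum p; rewrite (sum_cycle3 _ j) => s1.
transitivity ((bary p j + bary p (j + 1) + bary p (j + 2)) * C j + bary p j * (width / w j)); last by ring.
rewrite s1 mul1r /bary; field.
by rewrite (lt0r_neq0 (wp j)) (lt0r_neq0 width_gt0).
Qed.

End Tri.

Definition det3 (b : 'I_3 -> 'I_3 -> F) : F :=
  b 0 0 * (b 1 1 * b 2 2 - b 1 2 * b 2 1) - b 0 1 * (b 1 0 * b 2 2 - b 1 2 * b 2 0) +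
  b 0 2 * (b 1 0 * b 2 1 - b 1 1 * b 2 0).

(* [det b = tr b - 2 + (sum of the principal 2-minors of 1 - b)], and the minors of the
   Laplacian [1 - b] are sums of products of off-diagonal entries *)
Lemma det3_trace (b : 'I_3 -> 'I_3 -> F) : (forall i j, 0 <= b i j) ->
  (forall i, b i 0 + b i 1 + b i 2 = 1) -> det3 b <= 0 -> b 0 0 + b 1 1 + b 2 2 <= 2.
Proof.
move=> b0 b1; rewrite /det3.
have := b1 0; have := b1 1; have := b1 2.
have := b0 0 1; have := b0 0 2; have := b0 1 0; have := b0 1 2; have := b0 2 0; have := b0 2 1.
move: (b 0 1) (b 0 2) (b 1 0) (b 1 2) (b 2 0) (b 2 1) (b 0 0) (b 1 1) (b 2 2).
move=> a1 a2 e0 e2 c0 c1 p0 p1 p2 c1p c0p e2p e0p a2p a1p h2 h1 h0.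
have -> : p0 = 1 - a1 - a2 by rewrite -h0; ring.
have -> : p1 = 1 - e0 - e2 by rewrite -h1; ring.
have -> : p2 = 1 - c0 - c1 by rewrite -h2; ring.
have : 0 <= a1 * e2 + a2 * e0 + a2 * e2 + a1 * c0 + a1 * c1 + a2 * c1 + e0 * c0 + e0 * c1 + e2 * c0.
  by rewrite !addr_ge0 // mulr_ge0.
by lra.
Qed.

(** Permuting the columns by a permutation of sign [- e] makes the determinant negative, so
    [det3_trace] applies to the permuted matrix. *)
Lemma perm_trace (b : 'I_3 -> 'I_3 -> F) (e : F) : e * e = 1 -> (forall i j, 0 <= b i j) ->
  (forall i, b i 0 + b i 1 + b i 2 = 1) -> 0 < e * det3 b ->
  if 0 < e then [/\ b 0 0 + b 1 2 + b 2 1 <= 2, b 0 1 + b 1 0 + b 2 2 <= 2 &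
    b 0 2 + b 1 1 + b 2 0 <= 2]
  else [/\ b 0 0 + b 1 1 + b 2 2 <= 2, b 0 1 + b 1 2 + b 2 0 <= 2 &
    b 0 2 + b 1 0 + b 2 1 <= 2].
Proof.
move=> ee b0 b1.
have key x y z : (forall i, b i x + b i y + b i z = 1) ->
    det3 (fun i j => b i (if j == 0 then x else if j == 1 then y else z)) <= 0 ->
    b 0 x + b 1 y + b 2 z <= 2.
  by move=> h; apply: (@det3_trace (fun i j => b i _)).
have [->|->] : e = 1 \/ e = -1.
  have /eqP : (e - 1) * (e + 1) = 0 by rewrite mulrDr mulrBl ee; ring.
  rewrite mulf_eq0 subr_eq0 addr_eq0 => /orP[]/eqP; by [left|right].
  rewrite ltr01 mul1r => d; split; apply: key => [i|]; rewrite -?(b1 i) /det3 /=;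
    try ring; move: d; rewrite /det3; lra.
rewrite ltr0N1 mulN1r oppr_gt0 => d; split; apply: key => [i|]; rewrite -?(b1 i) /det3 /=;
    try ring; move: d; rewrite /det3; lra.
Qed.

(* [e] is the relative orientation of the triangle with barycentric coordinates [b] *)
Lemma mixed_bary (b Y : 'I_3 -> 'I_3 -> F) (e A : F) : e * e = 1 -> 0 < A ->
  (forall i j, 0 <= b i j) -> (forall i, b i 0 + b i 1 + b i 2 = 1) ->
  0 < e * det3 b -> (forall i j, Y i j = - Y j i) -> Y 0 1 + Y 1 2 + Y 2 0 = A ->
  forall l : 'I_3 -> 'I_3,
  let Z i j := b j 0 * Y i 0 + b j 1 * Y i 1 + b j 2 * Y i 2 in
  - e * (Z (l 0) 1 - Z (l 0) 2 + Z (l 1) 2 - Z (l 1) 0 + Z (l 2) 0 - Z (l 2) 1) <= A.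
Proof.
move=> ee A0 b0 b1 db YC YA l; have pt := perm_trace ee b0 b1 db.
have Yxx i : Y i i = 0 by apply/eqP; rewrite -[_ == _](mulrn_eq0 _ 2) mulr2n {1}YC addNr.
have Ab i j : 0 <= A * b i j by rewrite mulr_ge0 // ltW.
have A2 x : x <= 2 -> A * x <= A * 2 by rewrite ler_pM2l.
have Y20 : Y 2 0 = A - Y 0 1 - Y 1 2 by rewrite -YA; ring.
have bE i : b i 2 = 1 - b i 0 - b i 1 by rewrite -(b1 i); ring.
have := Ab 0 2; have := Ab 1 2; have := Ab 2 2.
have := Ab 0 0; have := Ab 1 0; have := Ab 2 0.
have := Ab 0 1; have := Ab 1 1; have := Ab 2 1.
rewrite !bE in pt *.
have {}pt : if 0 < e then [/\ A * (b 0 0 + (1 - b 1 0 - b 1 1) + b 2 1) <= A * 2,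
    A * (b 0 1 + b 1 0 + (1 - b 2 0 - b 2 1)) <= A * 2 &
    A * ((1 - b 0 0 - b 0 1) + b 1 1 + b 2 0) <= A * 2]
  else [/\ A * (b 0 0 + b 1 1 + (1 - b 2 0 - b 2 1)) <= A * 2,
    A * (b 0 1 + (1 - b 1 0 - b 1 1) + b 2 0) <= A * 2 &
    A * ((1 - b 0 0 - b 0 1) + b 1 0 + b 2 1) <= A * 2].
  by move: pt; case: ifP => _ [p1 p2 p3]; split; apply: A2.
move=> h21 h11 h01 h20 h10 h00 h22 h12 h02.
have [e1|e1] : e = 1 \/ e = -1.
  have /eqP : (e - 1) * (e + 1) = 0 by rewrite mulrDr mulrBl ee; ring.
  by rewrite mulf_eq0 subr_eq0 addr_eq0 => /orP[]/eqP; [left|right].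
all: move: (l 0) (l 1) (l 2) pt => {l}; rewrite e1 ?ltr01 ?ltr0N1 => i j k [p1 p2 p3].
all: move: i j k; apply: ord3_ind; apply: ord3_ind; apply: ord3_ind => /=.
all: rewrite !Yxx ?(YC 1 0) ?(YC 2 1) ?(YC 0 2) ?Y20 ?bE {b0 b1 db YC YA Yxx Ab A2 Y20 bE e1 ee e}.
all: lra.
Qed.

Lemma crossC p e : cross p e = - cross e p.
Proof. by rewrite /cross; ring. Qed.

Lemma crossxx p : cross p p = 0.
Proof. by rewrite /cross; ring. Qed.

Lemma cross_sum p (b : 'I_3 -> F) (q : 'I_3 -> F * F) :
  cross p (\sum_i b i * (q i).1, \sum_i b i * (q i).2) = \sum_i b i * cross p (q i).
Proof. by rewrite /cross !sum_ord3 /=; ring. Qed.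

(** [l] assigns a vertex of the outer triangle to each edge of the inner one. For the best choice
    the left side is twice the mixed area of the two triangles, while the right side is twice the
    area of the outer one. Barycentric coordinates of [r] with respect to [q] reduce the claim to
    [mixed_bary]. *)
Lemma mixed_vertices (n1 n2 r q : 'I_3 -> F * F) (w1 w2 C1 C2 : 'I_3 -> F) (sg1 sg2 : F) :
  tri_data n1 r w1 C1 sg1 -> tri_data n2 q w2 C2 sg2 ->
  (forall i j, C2 i <= ip (r j) (n2 i)) -> forall l : 'I_3 -> 'I_3,
  - sg1 * (cross (q (l 0)) (r 1) - cross (q (l 0)) (r 2) + cross (q (l 1)) (r 2)
    - cross (q (l 1)) (r 0) + cross (q (l 2)) (r 0) - cross (q (l 2)) (r 1))
  <= width w2 C2 ^+ 2 / wvol w2.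
Proof.
move=> T1 T2 sub l; set A := _ / _.
have A0 : 0 < A by rewrite divr_gt0 ?exprn_gt0 ?(width_gt0 T2) ?(wvol_gt0 T2).
pose b i j := bary n2 w2 C2 (r i) j.
have b0 i j : 0 <= b i j.
  apply: divr_ge0; last exact: ltW (width_gt0 T2).
  by apply: mulr_ge0; [exact: ltW (td_w T2 j)|rewrite subr_ge0].
have b1 i : b i 0 + b i 1 + b i 2 = 1 by rewrite -sum_ord3 (bary_sum T2).
have cr p j : cross p (r j) = b j 0 * cross p (q 0) + b j 1 * cross p (q 1) + b j 2 * cross p (q 2).
  by rewrite {1}[r j](baryE T2) cross_sum sum_ord3.
have sg1V : sg1 * sg1 = 1 := td_sg T1; have sg2V : sg2 * sg2 = 1 := td_sg T2.
have D2 : area2 q = sg2 * A by rewrite (area2E T2) -mulrA.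
have D1 : area2 r = det3 b * area2 q.
  rewrite /area2 (cr (r 0)) (cr (r 1)) (cr (r 2)) !(crossC (r _) (q _)) !cr !crossxx.
  rewrite (crossC (q 1) (q 0)) (crossC (q 2) (q 1)) (crossC (q 0) (q 2)) /det3.
  have -> : b 0 2 = 1 - b 0 0 - b 0 1 by rewrite -(b1 0); ring.
  have -> : b 1 2 = 1 - b 1 0 - b 1 1 by rewrite -(b1 1); ring.
  have -> : b 2 2 = 1 - b 2 0 - b 2 1 by rewrite -(b1 2); ring.
  ring.
have ee : (sg1 * sg2) * (sg1 * sg2) = 1 by rewrite mulrACA sg1V sg2V mulr1.
have e0 : 0 < sg1 * sg2 * det3 b.
  have : 0 < sg1 * area2 r.
    rewrite (area2E T1) -mulrA mulrA sg1V mul1r.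
    exact: divr_gt0 (exprn_gt0 _ (width_gt0 T1)) (wvol_gt0 T1).
  rewrite D1 D2; have -> : sg1 * (det3 b * (sg2 * A)) = sg1 * sg2 * det3 b * A by ring.
  by rewrite pmulr_lgt0.
pose Y i j := sg2 * cross (q i) (q j).
have YC i j : Y i j = - Y j i by rewrite /Y crossC mulrN.
have YA : Y 0 1 + Y 1 2 + Y 2 0 = A by rewrite /Y -!mulrDr -/(area2 q) D2 mulrA sg2V mul1r.
have := mixed_bary ee A0 b0 b1 e0 YC YA l.
have ZE i j : b j 0 * Y i 0 + b j 1 * Y i 1 + b j 2 * Y i 2 = sg2 * cross (q i) (r j).
  by rewrite cr /Y; ring.
rewrite /= !ZE; apply: le_trans; rewrite le_eqVlt; apply/orP; left; apply/eqP.
rewrite -[in LHS](mulr1 sg1) -sg2V; ring.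
Qed.

(* For [u i] in the polygon [P] with [h_P = a] this is the monotonicity
   [V(P, T1) <= V(P, T2)] of mixed areas, [P] being homothetic to [T2]. *)
Lemma mixed_le (n1 n2 r q : 'I_3 -> F * F) (w1 w2 C1 C2 : 'I_3 -> F) (sg1 sg2 : F)
    (u : 'I_3 -> F * F) (a : 'I_3 -> F) :
  tri_data n1 r w1 C1 sg1 -> tri_data n2 q w2 C2 sg2 ->
  (forall i j, C2 i <= ip (r j) (n2 i)) -> (forall i j, - a j <= ip (u i) (n2 j)) ->
  - (\sum_i w1 i * ip (u i) (n1 i)) * (width w1 C1 / wvol w1) <=
  (\sum_i w2 i * a i) * (width w2 C2 / wvol w2).
Proof.
move=> T1 T2 sub ua; have W2 := width_gt0 T2.
pose s := \sum_i w2 i * a i; pose W := width w2 C2; pose A := W ^+ 2 / wvol w2.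
pose X i l := - sg1 * cross (q l) ((r (i + 1)).1 - (r (i + 2)).1, (r (i + 1)).2 - (r (i + 2)).2).
have XE i l : X i l = - (w1 i * ip (q l) (n1 i)) * (width w1 C1 / wvol w1).
  have [e1 e2] := edge_normal T1 i; rewrite /X /cross /= e1 e2 /ip.
  rewrite -[in RHS](mulr1 (width w1 C1)) -(td_sg T1); ring.
have [l lP] : exists l : 'I_3 -> 'I_3, forall i j, X i j <= X i (l i).
  exists (fun i => [arg max_(j > 0) X i j]%O) => i j.
  by case: arg_maxP => // l _; apply.
have XA : \sum_i X i (l i) <= A.
  apply: le_trans (mixed_vertices T1 T2 sub l); rewrite sum_ord3 /X !ord3E le_eqVlt.
  by apply/orP; left; apply/eqP; rewrite /cross /=; ring.
pose y i j := w2 j * (ip (u i) (n2 j) + a j).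
have y0 i j : 0 <= y i j.
  by apply: mulr_ge0; [exact: ltW (td_w T2 j)|rewrite -lerBlDr sub0r].
have ys i : \sum_j y i j = s.
  rewrite /y; under eq_bigr => j _ do rewrite mulrDr.
  by rewrite big_split /= (ip_rel T2) add0r.
(* Each [u i] lies in the translate by [- tau / W] of the second triangle scaled by [s / W]. The
   translation drops out of the sum over [i] by [ip_rel]. *)
pose tau := (\sum_j w2 j * (C2 j + a j) * (q j).1, \sum_j w2 j * (C2 j + a j) * (q j).2).
have uE i p : W * ip (u i) p = \sum_j y i j * ip (q j) p - ip tau p.
  rewrite {1}[u i](baryE T2) /ip /bary -/W /y /tau /= !sum_ord3.
  by field; rewrite gt_eqF.
have main : - (\sum_i w1 i * ip (u i) (n1 i)) * (width w1 C1 / wvol w1) * W <= s * A.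
  have -> : - (\sum_i w1 i * ip (u i) (n1 i)) * (width w1 C1 / wvol w1) * W =
      \sum_i \sum_j y i j * X i j.
    have -> : \sum_i \sum_j y i j * X i j = - (\sum_i w1 i * (W * ip (u i) (n1 i))) *
        (width w1 C1 / wvol w1).
      under [in RHS]eq_bigr => i _ do rewrite uE mulrBr.
      rewrite sumrB (ip_rel T1) subr0 -sumrN mulr_suml.
      apply: eq_bigr => i _; rewrite !sum_ord3 !XE; ring.
    rewrite mulrAC; congr (_ * _); rewrite mulNr mulr_suml; congr (- _).
    by apply: eq_bigr => i _; ring.
  apply: (le_trans (y := \sum_i \sum_j y i j * X i (l i))).
    by apply: ler_sum => i _; apply: ler_sum => j _; rewrite ler_wpM2l.
  under eq_bigr => i _ do rewrite -mulr_suml ys.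
  rewrite -mulr_sumr ler_wpM2l // -(ys 0) sumr_ge0 //.
rewrite -(ler_pM2r W2) -/W; apply: (le_trans main).
by rewrite le_eqVlt; apply/orP; left; apply/eqP; rewrite /A -/s; ring.
Qed.

End Planar.

(** * Triangles supporting the curve *)

Definition castv (F : nzRingType) (v : lattice) : F * F := (v.1%:~R, v.2%:~R).

Lemma dot_ip (F : realFieldType) (p : F * F) (v : lattice) : dot p v = ip p (castv F v).
Proof. by rewrite /dot /ip !mulrzr. Qed.

Lemma dot_castv (F : realFieldType) (u v : lattice) :
  (dot u v)%:~R = ip (castv F u) (castv F v).
Proof. by rewrite dotE /ip intrD !intrM. Qed.

Lemma good_fan_nrm (R : realType) (T : triangle R) : good_fan (nrm T).
Proof.
split; first exact: nrm_primitive.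
have [[d0 [d1 d2]]|[d0 [d1 d2]]] := det2_nrm T; [exists 1|exists (-1)] => //.
  by apply: ord3_ind; rewrite !ord3E mul1r.
by apply: ord3_ind; rewrite !ord3E mulN1r oppr_gt0.
Qed.

Definition real_wt (F : nzRingType) (v : fan3) i : F := (wt v i)%:~R.

Definition side (R : realType) (T : triangle R) (i : 'I_3) : R := dot (vtx T (i + 1)) (nrm T i).

Lemma triangle_data (R : realType) (T : triangle R) : exists sg : R,
  tri_data (fun i => castv R (nrm T i)) (vtx T) (real_wt R (nrm T)) (side T) sg.
Proof.
have [sg sg2 sgP] := wt_sign (good_fan_nrm T); exists sg%:~R.
have n1 (i : 'I_3) : i + 1 != i by case: i => [[|[|[|]]]].
have n2 (i : 'I_3) : i + 2 != i by case: i => [[|[|[|]]]].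
split.
- by rewrite -intrM sg2.
- by move=> i; rewrite ltr0z (wt_gt0 (good_fan_nrm T)).
- move=> i; rewrite -intrM -(proj1 (sgP i)) /det2 /cross intrB !intrM /=; ring.
- by move=> i; rewrite -dot_ip.
- by move=> i; rewrite -dot_ip /side; apply: nrm_edge.
by move=> i; rewrite -dot_ip; apply: nrm_inward.
Qed.

Lemma in_triangleP (R : realType) (T : triangle R) p :
  in_triangle T p <-> forall i, side T i <= ip p (castv R (nrm T i)).
Proof.
have [sg D] := triangle_data T; split=> [[w [w0 w1 ->]] i|h].
  have -> : ip (\sum_i w i * (vtx T i).1, \sum_i w i * (vtx T i).2) (castv R (nrm T i)) =
      \sum_j w j * ip (vtx T j) (castv R (nrm T i)).
    by rewrite /ip /= !mulr_suml -big_split /=; apply: eq_bigr => j _; ring.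
  rewrite -[side T i]mul1r -w1 mulr_suml; apply: ler_sum => j _; apply: ler_wpM2l => //.
  have [<-|ij] := eqVneq i j; first exact: ltW (td_in D i).
  rewrite /side (@nrm_edge _ T i _ j) -?dot_ip // 1?eq_sym //.
  by case: (i) => [[|[|[|]]]].
exists (bary (fun i => castv R (nrm T i)) (real_wt R (nrm T)) (side T) p); split.
- move=> i; apply: divr_ge0; last exact: ltW (width_gt0 D).
  by apply: mulr_ge0; [exact: ltW (td_w D i)|rewrite subr_ge0].
- exact: bary_sum D p.
exact: baryE D p.
Qed.

(** Converse of [ip_rel]. The point is given by its barycentric coordinates [lam], which may be
    negative. *)
Lemma ip_solve (F : realFieldType) (n q : 'I_3 -> F * F) w C sg (x : 'I_3 -> F) :
  tri_data n q w C sg -> \sum_i w i * x i = 0 -> exists p, forall i, ip p (n i) = x i.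
Proof.
move=> D xs; pose lam i := w i * (x i - C i) / width w C.
have W0 := width_gt0 D.
have ls : \sum_i lam i = 1.
  rewrite /lam -mulr_suml; under eq_bigr => i _ do rewrite mulrBr.
  by rewrite sumrB xs add0r divff // gt_eqF.
exists (\sum_i lam i * (q i).1, \sum_i lam i * (q i).2) => j.
have -> : ip (\sum_i lam i * (q i).1, \sum_i lam i * (q i).2) (n j) =
    \sum_i lam i * ip (q i) (n j).
  by rewrite /ip /= !mulr_suml -big_split /=; apply: eq_bigr => i _; ring.
move: ls; rewrite !(sum_cycle3 _ j) (td_edge1 D) (td_edge2 D) (ip_vtx D) => s1.
transitivity ((lam j + lam (j + 1) + lam (j + 2)) * C j + lam j * (width w C / w j)); first by ring.
rewrite s1 mul1r /lam; field.
by rewrite (lt0r_neq0 (td_w D j)) (lt0r_neq0 W0).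
Qed.

Section Homothety.
Variables (R : realType) (T : triangle R) (s : R) (t : R * R).
Hypothesis s_gt0 : 0 < s.

Definition homothety (p : R * R) : R * R := (s * p.1 + t.1, s * p.2 + t.2).

Lemma dot_homothety p (v : lattice) : dot (homothety p) v = s * dot p v + dot t v.
Proof. by rewrite !dot_ip /ip /homothety /=; ring. Qed.

Lemma homothety_edge i j l : j != i -> l != i ->
  dot (homothety (vtx T j)) (nrm T i) = dot (homothety (vtx T l)) (nrm T i).
Proof. by move=> ji li; rewrite !dot_homothety (@nrm_edge _ T i j l ji li). Qed.

Lemma homothety_inward i j : j != i ->
  dot (homothety (vtx T j)) (nrm T i) < dot (homothety (vtx T i)) (nrm T i).
Proof. by move=> ji; rewrite !dot_homothety ltrD2r ltr_pM2l // nrm_inward. Qed.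

Definition homothetic : triangle R := @Triangle R (fun i => homothety (vtx T i)) (nrm T)
  (@nrm_primitive _ T) homothety_edge homothety_inward.

Lemma side_homothetic i : side homothetic i = s * side T i + dot t (nrm T i).
Proof. exact: dot_homothety. Qed.

Lemma parallel_homothetic : parallel T homothetic.
Proof.
exists s, t => // p; rewrite -/(homothety p); split=> /in_triangleP h; apply/in_triangleP => i.
  have := h i; rewrite side_homothetic -!dot_ip dot_homothety lerD2r.
  by rewrite ler_pM2l.
by have := h i; rewrite side_homothetic -!dot_ip dot_homothety lerD2r ler_pM2l.
Qed.

End Homothety.

Section Newton.
Variables (R : realType) (k : closedFieldType) (xi : laurent k) (c : {ffun 'I_3 -> int}).

Lemma newton_supp u : u \in msupp xi -> in_newton_polygon xi (castv R u).
Proof.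
move=> uxi; exists (fun w => (w == u)%:R); split=> [w||]; first by case: (_ == _).
  rewrite (bigD1_seq u) ?fset_uniq //= eqxx big1 ?addr0 // => w /negbTE -> //.
by congr (_, _); rewrite (bigD1_seq u) ?fset_uniq //= eqxx mul1r big1 ?addr0 // =>
  w /negbTE ->; rewrite mul0r.
Qed.

Lemma newton_ge p (v : lattice) (n : int) : (forall u, u \in msupp xi -> n <= dot u v) ->
  in_newton_polygon xi p -> n%:~R <= ip p (castv R v).
Proof.
move=> h [w [w0 w1 ->]].
have -> : ip (\sum_(u <- msupp xi) w u * u.1%:~R, \sum_(u <- msupp xi) w u * u.2%:~R)
    (castv R v) = \sum_(u <- msupp xi) w u * (dot u v)%:~R.
  rewrite /ip /= !mulr_suml -big_split /=; apply: eq_bigr => u _.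
  by rewrite dot_castv /ip /castv /=; ring.
have -> : n%:~R = \sum_(u <- msupp xi) w u * n%:~R :> R by rewrite -mulr_suml w1 mul1r.
rewrite big_seq [X in _ <= X]big_seq.
by apply: ler_sum => u uxi; apply: ler_wpM2l => //; rewrite ler_int; exact: h.
Qed.

(** The homothetic copy of [T] with sides [c i] contains the Newton polygon, so by minimality it
    contains [T]; the other inequality holds because [T] contains the Newton polygon. Negative size
    of [c] makes the scaling factor positive. *)
Lemma supports_tight (T : triangle R) : supports T xi ->
  (forall i, ord_ray (nrm T i) xi (c i)) -> size_div (nrm T) c < 0 ->
  forall i, side T i = (c i)%:~R.
Proof.
move=> [_ TN Tmin] co sc; have [sg D] := triangle_data T.
have le i : side T i <= (c i)%:~R.
  have [_ [u uxi <-]] := co i; rewrite dot_castv.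
  exact: (proj1 (in_triangleP T _) (TN _ (newton_supp uxi)) i).
pose cR i : R := (c i)%:~R; pose W := width (real_wt R (nrm T)) (side T).
have W0 : 0 < W := width_gt0 D.
have scE : (size_div (nrm T) c)%:~R = \sum_i real_wt R (nrm T) i * cR i.
  rewrite /size_div rmorph_sum /=; apply: eq_bigr => i _; exact: intrM.
pose s := - (size_div (nrm T) c)%:~R / W.
have s0 : 0 < s by rewrite divr_gt0 // oppr_gt0 ltrz0.
have [|t tP] := ip_solve (x := fun i => cR i - s * side T i) D.
  under eq_bigr => i _ do rewrite mulrBr.
  rewrite sumrB -scE; under eq_bigr => i _ do rewrite mulrCA.
  rewrite -mulr_sumr -[X in s * X]opprK -/(width _ _) -/W /s mulrN opprK.
  by rewrite divfK ?subrr // gt_eqF.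
have sE i : side (homothetic T t s0) i = cR i.
  by rewrite side_homothetic dot_ip tP addrC subrK.
have TT : triangle_sub T (homothetic T t s0).
  apply: Tmin; first exact: parallel_homothetic.
  move=> p pN; apply/in_triangleP => i; rewrite sE.
  by apply: newton_ge pN => u uxi; have [h _] := co i; apply: h.
move=> i; apply/eqP; rewrite eq_le le /= -/(cR i) -(sE i).
have vT : in_triangle T (vtx T (i + 1)).
  exists (fun j => (j == i + 1)%:R); split=> [j||]; first by case: (_ == _).
    by rewrite (bigD1 (i + 1)) //= eqxx big1 ?addr0 // => j /negbTE ->.
  rewrite [LHS]surjective_pairing.
  by congr (_, _); rewrite (bigD1 (i + 1)) //= eqxx mul1r big1 ?addr0 // =>
    j /negbTE ->; rewrite mul0r.
by have /in_triangleP/(_ i) := TT _ vT; rewrite -dot_ip.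
Qed.

End Newton.

Lemma width_kap (R : realType) (T : triangle R) (c : {ffun 'I_3 -> int}) :
  (forall i, side T i = (c i)%:~R) ->
  width (real_wt R (nrm T)) (side T) = (kappa (nrm T) c)%:~R.
Proof.
move=> cE; rewrite /width /kappa /size_div intrN rmorph_sum /=; congr (- _).
by apply: eq_bigr => i _; rewrite cE intrM.
Qed.

Lemma wvol_wprod (R : realType) (v : fan3) : wvol (real_wt R v) = (wprod v)%:~R.
Proof. by rewrite /wvol /wprod !intrM. Qed.

(** Tightness turns the widths into [kappa], so [mixed_le] compares the two numbers
    [kappa * size_div / wprod], which a witness requires to be at most [m * t]. *)
Lemma witness_transfer (k : closedFieldType) (R : realType) (A : gmodel k lattice)
    (T1 T2 : triangle R) (xi : A) (c1 c2 : {ffun 'I_3 -> int}) m f a t :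
  (forall i, side T1 i = (c1 i)%:~R) -> (forall i, side T2 i = (c2 i)%:~R) ->
  triangle_sub T1 T2 -> witness (nrm T2) xi c2 m f a t ->
  exists a', witness (nrm T1) xi c1 m f a' t.
Proof.
move=> e1 e2 sub [nf fa ft t0 neg].
have [sg1 D1] := triangle_data T1; have [sg2 D2] := triangle_data T2.
have f0 : f != 0 by apply/eqP => e; apply: nf; rewrite e; exact: gdvd0.
have uex i : exists u, ord_ge (nrm T1 i) f (dot u (nrm T1 i)) /\ u \in supp f.
  have [u ul] := lowest_ex (nrm T1 i) f0.
  by have [uf _] := ul; exists u; split=> //; case: (lowest_ord_eq ul).
have [u uP] := choice uex.
exists [ffun i => - dot (u i) (nrm T1 i)]; split=> //.
  by move=> i; rewrite ffunE opprK; case: (uP i).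
have sub' i j : side T2 i <= ip (vtx T1 j) (castv R (nrm T2 i)).
  apply: (proj1 (in_triangleP T2 _)); apply: sub; apply/in_triangleP => l.
  have [<-|lj] := eqVneq l j; first exact: ltW (td_in D1 l).
  rewrite /side (@nrm_edge _ T1 l _ j) -?dot_ip // 1?eq_sym //.
  by case: (l) => [[|[|[|]]]].
have ua i j : - (a j)%:~R <= ip (castv R (u i)) (castv R (nrm T2 j)).
  rewrite -dot_castv -intrN ler_int; apply: fa; exact: (proj2 (uP i)).
have := mixed_le D1 D2 sub' ua.
rewrite (width_kap e1) (width_kap e2) !wvol_wprod.
have -> : - (\sum_i real_wt R (nrm T1) i * ip (castv R (u i)) (castv R (nrm T1 i))) =
    (size_div (nrm T1) [ffun i => - dot (u i) (nrm T1 i)])%:~R.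
  rewrite /size_div rmorph_sum /= -sumrN; apply: eq_bigr => i _.
  by rewrite ffunE -dot_castv intrM intrN mulrN.
have -> : \sum_i real_wt R (nrm T2) i * (a i)%:~R = (size_div (nrm T2) a)%:~R.
  by rewrite /size_div rmorph_sum /=; apply: eq_bigr => i _; rewrite intrM.
have W1 := wprod_gt0 (good_fan_nrm T1); have W2 := wprod_gt0 (good_fan_nrm T2).
rewrite -!(ltr0z R) in W1 W2.
move=> le; rewrite -(ler_int R) intrM [X in _ <= X]intrM in neg.
have key (F : realFieldType) (K1 S1 V1 K2 S2 V2 M : F) : 0 < V1 -> 0 < V2 ->
    S1 * (K1 / V1) <= S2 * (K2 / V2) -> K2 * S2 <= V2 * M -> K1 * S1 <= V1 * M.
  move=> V10 V20 h h'; apply: (le_trans (y := V1 * (S2 * (K2 / V2)))).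
    have -> : K1 * S1 = V1 * (S1 * (K1 / V1)) by field; rewrite gt_eqF.
    by rewrite ler_pM2l.
  rewrite ler_pM2l // -(ler_pM2l V20).
  by have -> : V2 * (S2 * (K2 / V2)) = K2 * S2 by field; rewrite gt_eqF.
by rewrite -(ler_int R) intrM [X in _ <= X]intrM; apply: key W1 W2 le neg.
Qed.

(** The class group of the toric surface has rank one, so its intersection form is a product of two
    copies of [size_div] up to the factor [wprod]. *)
Lemma inter_size (v : fan3) (D : bdiv) : good_fan v ->
  inter v D D = (size_div v D.1 * size_div v D.1)%:~R / (wprod v)%:~R - (D.2 * D.2)%:~R.
Proof.
move=> vok; rewrite /inter; congr (_ - _).
have w0 i : (wt v i)%:~R != 0 :> rat by rewrite intr_eq0 gt_eqF // wt_gt0.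
have tE i j : toric_int v i j = (wt v i)%:~R * (wt v j)%:~R / (wprod v)%:~R.
  have dC u w : `|det2 u w| = `|det2 w u|.
    by rewrite -normrN; congr `|_|; rewrite /det2; ring.
  have wE : [/\ `|det2 (v 1) (v 2)| = wt v 0, `|det2 (v 2) (v 0)| = wt v 1 &
      `|det2 (v 0) (v 1)| = wt v 2] by rewrite /wt !ord3E.
  have [E0 E1 E2] := wE; have h0 := w0 0; have h1 := w0 1; have h2 := w0 2.
  move: i j; apply: ord3_ind; apply: ord3_ind;
    rewrite /toric_int /= ?ord3E ?(dC (v 1) (v 0)) ?(dC (v 2) (v 1)) ?(dC (v 0) (v 2)) ?E0 ?E1 ?E2
      /wprod !intrM; field; rewrite ?h0 ?h1 ?h2 //.
have -> : (size_div v D.1 * size_div v D.1)%:~R =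
    \sum_i \sum_j (wt v i * D.1 i * (wt v j * D.1 j))%:~R :> rat.
  rewrite intrM /size_div rmorph_sum /= mulr_suml; apply: eq_bigr => i _.
  by rewrite mulr_sumr; apply: eq_bigr => j _; rewrite [RHS]intrM.
rewrite mulr_suml; apply: eq_bigr => i _; rewrite mulr_suml; apply: eq_bigr => j _.
by rewrite tE !intrM; ring.
Qed.

(** * The concrete group algebras *)

Section GalgModel.
Variables (R : comNzRingType) (G : zmodType).
Local Notation ring := (galg R G).

Definition gconst (c : R) : ring := gmono c 0.

Lemma gconst_is_zmod_morphism : zmod_morphism gconst.
Proof. by move=> c d; exact: monalgUB. Qed.

Lemma gconst_is_monoid_morphism : monoid_morphism gconst.
Proof. by split=> // c d; rewrite -[RHS]/(gmul _ _) gmonoM addr0. Qed.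

HB.instance Definition _ := GRing.isZmodMorphism.Build R ring gconst gconst_is_zmod_morphism.
HB.instance Definition _ := GRing.isMonoidMorphism.Build R ring gconst gconst_is_monoid_morphism.

Lemma gmono_mul (c d : R) (u w : G) : (gmono c u : ring) * gmono d w = gmono (c * d) (u + w).
Proof. exact: gmonoM. Qed.

Lemma gmono_gconst (c : R) u : gmono c u = gconst c * gmono 1 u.
Proof. by rewrite /gconst gmono_mul mulr1 add0r. Qed.

Lemma gmodel_mon0 : gmono 1 0 = 1 :> ring. Proof. reflexivity. Qed.

Lemma gmodel_monD u w : gmono 1 (u + w) = gmono 1 u * gmono 1 w :> ring.
Proof. by rewrite gmono_mul mulr1. Qed.

Lemma gmodel_cfD (f g : ring) (u : G) : (f + g)@_u = f@_u + g@_u.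
Proof. exact: mcoeffD. Qed.

Lemma gmodel_cf_gmono (c : R) (u w : G) : (gconst c * gmono 1 u)@_w = c *+ (u == w).
Proof. by rewrite -gmono_gconst; exact: mcoeffU. Qed.

Lemma gmodel_supp_cf (f : ring) (u : G) : (u \in msupp f) = (f@_u != 0).
Proof. by rewrite mcoeff_neq0. Qed.

Lemma gmodel_gmE (f : ring) : f = \sum_(u <- msupp f) gconst f@_u * gmono 1 u.
Proof. by rewrite [LHS]gsumE; apply: eq_bigr => u _; exact: gmono_gconst. Qed.

Definition galg_model : gmodel R G := @GModel R G (galg R G) gconst (gmono 1)
  (fun f u => f@_u) (fun f => msupp f) gmodel_mon0 gmodel_monD gmodel_cfD gmodel_cf_gmono
  gmodel_supp_cf gmodel_gmE.

End GalgModel.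

(** * Transfer to the concrete Cox rings *)

Section Transfer.
Variable k : closedFieldType.
Let A : gmodel k lattice := galg_model k lattice.
Let B : gmodel A bdiv := galg_model A bdiv.

Lemma galg_irreducible (xi : laurent k) : laurent_irreducible xi = girreducible (A := A) xi.
Proof. reflexivity. Qed.

Lemma galg_char (v : fan3) u : char_elt k v u = gchar v B u.
Proof. exact: (gmono_gconst (R := A) (gmono 1 u) (- div_char v u)). Qed.

Lemma galg_subalg (G : seq (div_ring k)) (F : div_ring k) :
  subalgebra_generated G F <-> gsubalg (B := B) G F.
Proof.
split; elim => {F}.
- by move=> e; exact: (@GScalar _ _ B G e).
- by move=> F FG; exact: (@GGen _ _ B G F FG).
- by move=> F F' _ h _ h'; exact: (@GAdd _ _ B G F F' h h').
- by move=> F F' _ h _ h'; exact: (@GMul _ _ B G F F' h h').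
- by move=> e; exact: (@SubalgScalar k G e).
- by move=> F FG; exact: (@SubalgGen k G F FG).
- by move=> F F' _ h _ h'; exact: (@SubalgAdd k G F F' h h').
by move=> F F' _ h _ h'; exact: (@SubalgMul k G F F' h h').
Qed.

Lemma galg_cox (v : fan3) (F : div_ring k) : in_cox_ideal v F <-> gin_cox_ideal v (B := B) F.
Proof.
have E (s : seq (div_ring k * lattice)) :
    \sum_(p <- s) p.1 * (1 - char_elt k v p.2) = \sum_(p <- s) p.1 * (1 - gchar v B p.2).
  by apply: eq_bigr => p _; rewrite galg_char.
split=> -[s sP FE]; (exists s; first exact: sP); first exact: (etrans FE (E s)).
exact: (etrans FE (esym (E s))).
Qed.

Lemma galg_mds (v : fan3) : mori_dream_space k v <-> gmds v B.
Proof.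
split=> -[G GP GF]; (exists G; first exact: GP) => F /GF[F' F'G F'I]; exists F'.
- exact: (proj1 (galg_subalg G F') F'G).
- exact: (proj1 (galg_cox v (F - F')) F'I).
- exact: (proj2 (galg_subalg G F') F'G).
exact: (proj2 (galg_cox v (F - F')) F'I).
Qed.

(** The multiplicity is positive because [C.C <= 0] while [kappa] is positive. *)
Lemma negative_curve_data (R : realType) (T : triangle R) (xi : laurent k) :
  supports T xi -> exists (c : {ffun 'I_3 -> int}) m,
  [/\ forall i, ord_eq (A := A) (nrm T i) xi (c i),
    mult_eq (A := A) xi m, (0 < m)%N,
    kappa (nrm T) c * kappa (nrm T) c <= wprod (nrm T) * (m * m)%N%:Z &
    forall i, side T i = (c i)%:~R].
Proof.
move=> Ts; have [[xi_irr [D [co [m mm Dm]] neg]] _ _] := Ts.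
have vok := good_fan_nrm T; exists D.1, m.
have kp : 0 < kappa (nrm T) D.1 by exact: (kap_gt0 (A := A) vok xi_irr co).
have kle : kappa (nrm T) D.1 * kappa (nrm T) D.1 <= wprod (nrm T) * (m * m)%N%:Z.
  have key (x w : int) (n : nat) : - x * - x <= (- n%:Z * - n%:Z) * w ->
    - x * - x <= w * (n * n)%N%:Z by rewrite mulrC [X in _ <= X]mulrC PoszM [X in _ <= _ * X]mulrNN.
  move: neg; rewrite (inter_size _ vok) subr_le0.
  rewrite ler_pdivrMr ?ltr0z ?wprod_gt0 // -intrM ler_int /= size_divN Dm; exact: key.
split=> //.
- rewrite lt0n; apply/eqP => m0; move: kle; rewrite m0 mulr0.
  by apply/negP; rewrite -ltNge mulr_gt0.
by apply: (supports_tight Ts co); rewrite -oppr_gt0.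
Qed.

End Transfer.

Theorem proposition6p1 (k : closedFieldType) (k_char0 : [pchar k] =i pred0)
  (R : realType) (T1 T2 : triangle R) (xi : laurent k) :
  triangle_sub T1 T2 -> supports T1 xi -> supports T2 xi ->
  mori_dream_space k (nrm T2) -> mori_dream_space k (nrm T1).
Proof.
move=> sub s1 s2 /galg_mds mds; apply/galg_mds.
have [c1 [m [co1 mm m0 _ e1]]] := negative_curve_data s1.
have [c2 [m2 [co2 mm2 _ kle e2]]] := negative_curve_data s2.
have [[xi_irr _] _ _] := s1; rewrite galg_irreducible in xi_irr.
have mE : m2 = m.
  have [lt|lt|//] := ltngtP m2 m.
    by case: mm2 => _ []; apply: (in_mp_le lt (proj1 mm)).
  by case: mm => _ []; apply: (in_mp_le lt (proj1 mm2)).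
rewrite mE in kle mm2.
have [f [a [t w2]]] := gmds_witness (good_fan_nrm T2) xi_irr co2 mm2 m0 kle mds.
have [a' w1] := witness_transfer e1 e2 sub w2.
exact: witness_gmds (good_fan_nrm T1) xi_irr co1 mm m0 w1.
Qed.
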